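(* Let $(\mathbb{L}_n(k))_{k\in\mathbb{Z}}$ be the external profile of a binary search tree with $n+1$ external nodes. Put $\mathbb{L}_n^\circ(k):=\mathbb{L}_n(k)-\mathbb{E}[\mathbb{L}_n(k)]$ and let $(k_n)_{n\in\mathbb{N}}$ be a deterministic integer sequence. All limits below are almost sure, as $n\to\infty$. (a) If $k_n=2\log n+\alpha\sqrt{2\log n}+o(\sqrt{\log n})$ for some $\alpha\in\mathbb{R}$, then $$\frac{\log n}{n}\mathbb{L}_n^\circ(k_n)\longrightarrow\frac{\chi_1(0)-\mathbb{E}[\chi_1(0)]}{2\sqrt{2\pi}}\,\alpha e^{-\frac12\alpha^2}.$$ (b) If $k_n=2\log n+c_n$, where $c_n=o(\log n)$ and $\lim_{n\to\infty}|c_n|=\infty$, then $$\frac{(\log n)^{3/2}}{nc_ne^{c_n}}\left(\frac{k_n}{2\log n}\right)^{k_n}\mathbb{L}_n^\circ(k_n)\longrightarrow\frac{\chi_1(0)-\mathbb{E}[\chi_1(0)]}{4\sqrt\pi}.$$ In particular, if $c_n=o(\sqrt{\log n})$ and $\lim_{n\to\infty}|c_n|=\infty$, then $$\frac{(\log n)^{3/2}}{nc_n}\mathbb{L}_n^\circ(k_n)\longrightarrow\frac{\chi_1(0)-\mathbb{E}[\chi_1(0)]}{4\sqrt\pi}.$$ (c) If $k_n=2\log n+c_n$, where $c_n$ is bounded, then $$\frac{(\log n)^{3/2}}{n}\mathbb{L}_n^\circ(k_n)-\frac{\chi_1(0)-\mathbb{E}[\chi_1(0)]}{4\sqrt\p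i}\left(c_n+\frac12\right)\longrightarrow-\frac{W_\infty''(0)-\mathbb{E}[W_\infty''(0)]}{8\sqrt\pi}.$$
   Context: Binary search tree (BST) process: at time $n=0$ there is one external node, the root, at depth $0$. At each step one of the existing external nodes is picked uniformly at random (independently of the past given the current tree), declared internal, and connected to two new external nodes, each of depth one larger than that of the picked node. After $n$ steps the tree has $n$ internal and $n+1$ external nodes; the trees for all $n$ are defined on one probability space through this evolution. The depth of a node is its distance to the root. $\mathbb{L}_n(k)$ is the number of external nodes at depth $k$ after $n$ steps ($\mathbb{L}_n(k)=0$ for $k<0$); $x_{1,n},\dots,x_{n+1,n}$ are the depths of the external nodes. Let $\beta_-\approx-1.678$ and $\beta_+\approx0.768$ be the solutions of $2e^\beta(1-\beta)=1$, and let $W_n(\beta)=n^{-(2e^\beta-1)}\sum_{i=1}^{n+1}e^{\beta x_{i,n}}$, $\beta\in\mathbb{C}$. There are an open set $\mathscr{D}\subset\mathbb{C}$ containing $(\beta_-,\beta_+)$ and a random analytic function $W_\infty$ on $\mathscr{D}$ such that, almost surely, $W_n\to W_\infty$ uniformly on compact subsets of $\mathscr{D}$; one has $W_\infty(0)=1$. Put $\chi_1(0)=(\log W_\infty)'(0)=W_\infty'(0)$. *)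

(* Defs.v *)
From HB Require Import structures.
From mathcomp Require Export all_boot all_order all_algebra.
From mathcomp Require Export all_classical all_reals all_analysis.
From mathcomp Require Export complex.
Export Order.TTheory GRing.Theory Num.Theory.
Export numFieldNormedType.Exports.

Set Implicit Arguments.
Unset Strict Implicit.
Unset Printing Implicit Defensive.

Local Open Scope classical_set_scope.
Local Open Scope ring_scope.
Local Open Scope complex_scope.

(* [R[i]] seen through its [numClosedFieldType] structure, from which
   MathComp-Analysis derives the norm and the topology. *)
Definition Cplx (R : realType) : numClosedFieldType := R[i].

Inductive tree := External | Internal of tree & tree.

(* External nodes are addressed by the path from the root
   ([false] = left, [true] = right), so the depth of [v] is [size v]. *)
Fixpoint external (t : tree) : seq (seq bool) :=
  match t with
  | External => [:: [::]]
  | Internal l r =>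
      [seq false :: v | v <- external l] ++ [seq true :: v | v <- external r]
  end.

(* The tree in which the external node [v] of [t] has become internal, with two
   new external children; only used for [v \in external t]. *)
Fixpoint split_at (t : tree) (v : seq bool) : tree :=
  match t, v with
  | External, _ => Internal External External
  | Internal l r, false :: v' => Internal (split_at l v') r
  | Internal l r, true :: v' => Internal l (split_at r v')
  | Internal _ _, [::] => t
  end.

Definition profile (t : tree) (k : int) : nat :=
  count (fun v => (size v)%:Z == k) (external t).

Section Process.
Context {d : measure_display} {Omega : measurableType d} {R : realType}.
Variable P : probability Omega R.

(* The last clause of [is_BST_process] gives the conditional law of [Tr n.+1] given the whole past
   [Tr 0, ..., Tr n], multiplied out to avoid conditioning on null events.
   Distinct external nodes [v] give distinct trees [split_at (t n) v]. *)
Definition is_BST_process (Tr : nat -> Omega -> tree) : Prop :=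
  [/\ forall n t, measurable [set w | Tr n w = t],
      forall w, Tr 0%N w = External
    & forall (n : nat) (t : nat -> tree) (v : seq bool),
        v \in external (t n) ->
        P [set w | (forall m, (m <= n)%N -> Tr m w = t m) /\
                   Tr n.+1 w = split_at (t n) v]
        = (P [set w | forall m, (m <= n)%N -> Tr m w = t m]
           * ((size (external (t n)))%:R^-1)%:E)%E].

Definition centred (X : Omega -> R) (w : Omega) : R := X w - fine 'E_P[X].

End Process.

Section Martingale.
Context {R : realType}.

Definition cexp (z : Cplx R) : Cplx R :=
  (expR (complex.Re z) * cos (complex.Im z))
    +i* (expR (complex.Re z) * sin (complex.Im z)).

(* The power of [n] on the principal branch: n^s = exp (s log n). *)
Definition bigginsW (n : nat) (t : tree) (beta : Cplx R) : Cplx R :=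
  cexp (- (2 * cexp beta - 1) * (ln n%:R)%:C)
  * \sum_(v <- external t) cexp (beta * (size v)%:R).

Definition analytic_on (D : set (Cplx R)) (f : Cplx R -> Cplx R) : Prop :=
  forall z0, D z0 -> exists a : nat -> Cplx R,
    \forall z \near z0, series (fun j => a j * (z - z0) ^+ j) @ \oo --> f z.

Definition random_analytic {d : measure_display} {Omega : measurableType d}
    (D : set (Cplx R)) (W : Omega -> Cplx R -> Cplx R) : Prop :=
  (forall w, analytic_on D (W w)) /\
  (forall z, D z ->
    measurable_fun setT (fun w => complex.Re (W w z)) /\
    measurable_fun setT (fun w => complex.Im (W w z))).

(* Complex derivatives at 0. The limit of [bigginsW] takes real values on the
   real axis, so that the real part discards nothing. Since it equals 1 at 0,
   [chi1_0] is also its logarithmic derivative at 0. *)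
Definition chi1_0 {Omega : Type} (W : Omega -> Cplx R -> Cplx R) (w : Omega) : R :=
  complex.Re (derive1 (W w) 0).

Definition W2_0 {Omega : Type} (W : Omega -> Cplx R -> Cplx R) (w : Omega) : R :=
  complex.Re (derive1n 2 (W w) 0).

End Martingale.

(* Main.v *)
Require Import Defs.
From mathcomp Require Import measurable_realfun ring lra zify.
Set Implicit Arguments.
Unset Strict Implicit.
Unset Printing Implicit Defensive.
Local Open Scope classical_set_scope.
Local Open Scope ring_scope.
Local Open Scope complex_scope.

(** Let F_t(z) be the sum of z^|v| over the external nodes v of t, so that
    L_n(k) is the coefficient of z^k in F_n.  Splitting v adds
    (2z - 1) z^|v| to it; as v is uniform, E F_n(z) is the product of the
    1 + (2z - 1)/j for 1 <= j <= n, and, with lambda = 2 log n,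
    F_n(e^beta) = n^-1 e^(lambda e^beta) W_n(beta) exactly.  The centred
    polynomial G_n = F_n - E F_n therefore satisfies
    G_n(e^beta) = n^-1 e^(lambda e^beta) H_n(beta) with H_n = W_n - E W_n,
    and H_n(0) = 0 because the number of external nodes is deterministic.

    The hypothesis makes H_n bounded near 0, with derivatives at 0 that
    converge to those of W_oo - E W_oo.  For the expectations this is not
    automatic: it follows from an L^2 bound on the derivatives of W_n at 0
    ([tc_moment], [expectation_limits]).  A second order expansion in
    z - 1 = e^beta - 1 then gives, near z = 1,
      G_n(z) = n^-1 e^(lambda z) (a (z - 1) + h (z - 1)^2 + O(|log z|^3)),
    where a = H_n'(0) and h = (H_n''(0) - H_n'(0))/2.

    Taking the k-th coefficient of the explicit part turns e^(lambda z)
    into lambda^k/k! and, with r = k/lambda and x = r - 1, the bracket into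
    a x + h (x^2 - (1 + x)/lambda).  The remainder is controlled by
    averaging over the circle |z| = r ([circle_estimate]): near the
    positive axis |e^(lambda z)| decays like a Gaussian in the angle, which
    makes the cubic error negligible, and away from it
    |G_n(z)| <= K n^(1 - delta) almost surely ([away_ae]).  This last bound
    comes from second moments of F_n, which satisfy an explicit recursion
    ([m2S]), along the times j^A, together with the crude estimate of
    [genF2_ae] for the growth of F_n between two such times.

    With Stirling's formula the outcome ([scaledL_estimate], [master]) is
      sqrt(2 pi lambda) lambda n^-1 e^(-c) r^k (L_n(k) - E L_n(k))
        = chi c - eta + o(1 + |c|),          c = k - lambda = o(lambda),
    where chi is the centred value of W_oo'(0) and eta is half of the
    centred value of W_oo''(0) - W_oo'(0).  The three regimes read this off:
    the term chi c dominates when |c| is large, and when c is bounded the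
    constant eta survives.  The factor e^(-c) r^k tends to e^(a^2/2) when
    c/sqrt(lambda) tends to a ([saddle_factor_limit]).

    Two devices keep the complex analysis elementary.  Contour integrals are
    averages over roots of unity, which recover the coefficients of
    polynomials exactly ([dft_coef]).  Analyticity near 0 enters only as
    uniform approximability by polynomials on a disc ([polyapprox]), for
    which the Cauchy estimates follow from those of polynomials.  The
    numbers beta_- < 0 < beta_+ serve to place 0 in the domain. *)

(** * The complex modulus and exponential *)

Section Modulus.
Variable R : realType.
Local Notation C := (Cplx R).
Implicit Types (x y z : C) (a b : R).

(** The modulus as a real number; the norm of [Cplx R] itself takes values in [Cplx R]. *)
Definition nrm z : R := Normc.normc z.

Lemma norm_nrm z : `|z| = (nrm z)%:C.
Proof. by rewrite normc_def /nrm; case: z. Qed.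

Lemma nrm0 : nrm 0 = 0. Proof. exact: Normc.normc0. Qed.
Lemma nrm1 : nrm 1 = 1. Proof. exact: Normc.normc1. Qed.
Lemma nrmM x y : nrm (x * y) = nrm x * nrm y. Proof. exact: Normc.normcM. Qed.
Lemma nrmD x y : nrm (x + y) <= nrm x + nrm y.
Proof. exact: le_normcD. Qed.
Lemma nrmN x : nrm (- x) = nrm x. Proof. exact: normcN. Qed.
Lemma nrm_ge0 z : 0 <= nrm z. Proof. by case: z => a b; rewrite /nrm /= sqrtr_ge0. Qed.
Lemma nrmB x y : nrm (x - y) <= nrm x + nrm y.
Proof. by rewrite (le_trans (nrmD _ _))// nrmN. Qed.
Lemma nrm_distC x y : nrm (x - y) = nrm (y - x).
Proof. by rewrite -nrmN opprB. Qed.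
Lemma nrmX z n : nrm (z ^+ n) = nrm z ^+ n.
Proof. by elim: n => [|n IH]; rewrite ?expr0 ?nrm1// !exprS nrmM IH. Qed.
Lemma nrm_real a : nrm a%:C = `|a|.
Proof. by rewrite /nrm /= expr0n /= addr0 sqrtr_sqr. Qed.
Lemma nrm_nat n : nrm n%:R = n%:R.
Proof. by rewrite -[n%:R]/(n%:R : C) -(rmorph_nat (real_complex R)) nrm_real ger0_norm. Qed.
Lemma nrm_sqr z : nrm z ^+ 2 = complex.Re z ^+ 2 + complex.Im z ^+ 2.
Proof. by case: z => a b; rewrite /nrm /= sqr_sqrtr// addr_ge0 ?sqr_ge0. Qed.
Lemma Re_le_nrm z : `|complex.Re z| <= nrm z.
Proof. by rewrite -ler_sqr ?nnegrE ?nrm_ge0// nrm_sqr real_normK ?num_real// lerDl sqr_ge0. Qed.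
Lemma Im_le_nrm z : `|complex.Im z| <= nrm z.
Proof. by rewrite -ler_sqr ?nnegrE ?nrm_ge0// nrm_sqr real_normK ?num_real// lerDr sqr_ge0. Qed.
Lemma nrm_le_ReIm z : nrm z <= `|complex.Re z| + `|complex.Im z|.
Proof.
rewrite -ler_sqr ?nnegrE ?nrm_ge0 ?addr_ge0// nrm_sqr.
rewrite -(real_normK (num_real (complex.Re z))) -(real_normK (num_real (complex.Im z))).
have := normr_ge0 (complex.Re z); have := normr_ge0 (complex.Im z); nra.
Qed.
Lemma nrm_sum (I : Type) (s : seq I) (P : pred I) (F : I -> C) :
  nrm (\sum_(i <- s | P i) F i) <= \sum_(i <- s | P i) nrm (F i).
Proof.
elim/big_rec2: _ => [|i y1 y2 _ h]; first by rewrite nrm0.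
by rewrite (le_trans (nrmD _ _))// lerD2l.
Qed.
Lemma nrm_eq0 z : nrm z = 0 -> z = 0. Proof. exact: Normc.eq0_normc. Qed.
Lemma nrmV z : nrm z^-1 = (nrm z)^-1. Proof. exact: Normc.normcV. Qed.
Lemma nrmB_ge x y : nrm x - nrm y <= nrm (x - y).
Proof. by rewrite lerBlDr -{1}(subrK y x) nrmD. Qed.
Lemma ReD x y : complex.Re (x + y) = complex.Re x + complex.Re y.
Proof. by case: x y => [? ?] []. Qed.
Lemma ReB x y : complex.Re (x - y) = complex.Re x - complex.Re y.
Proof. by case: x y => [? ?] []. Qed.
Lemma ImD x y : complex.Im (x + y) = complex.Im x + complex.Im y.
Proof. by case: x y => [? ?] []. Qed.
Lemma ImB x y : complex.Im (x - y) = complex.Im x - complex.Im y.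
Proof. by case: x y => [? ?] []. Qed.
Lemma ReMr a z : complex.Re (a%:C * z) = a * complex.Re z.
Proof. by case: z => u v /=; rewrite mul0r subr0. Qed.
Lemma ReM x y : complex.Re (x * y) = complex.Re x * complex.Re y - complex.Im x * complex.Im y.
Proof. by case: x y => [? ?] []. Qed.
Lemma ImM x y : complex.Im (x * y) = complex.Re x * complex.Im y + complex.Im x * complex.Re y.
Proof. by case: x y => [? ?] []. Qed.

Lemma cexpD x y : cexp (x + y) = cexp x * cexp y.
Proof.
apply/eqP; rewrite eq_complex; case: x y => [a b] [c d] /=.
rewrite expRD cosD sinD; apply/andP; split; apply/eqP; ring.
Qed.
Lemma cexp0 : cexp (0 : C) = 1.
Proof. by rewrite /cexp /= expR0 cos0 sin0 mulr0 mulr1. Qed.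
Lemma cexpMn x n : cexp (x *+ n) = cexp x ^+ n.
Proof. by elim: n => [|n IH]; rewrite ?mulr0n ?cexp0// mulrS cexpD IH exprS. Qed.
Lemma cexp_real a : cexp a%:C = (expR a)%:C.
Proof. by rewrite /cexp /= cos0 sin0 mulr0 mulr1. Qed.
Lemma nrm_cexp z : nrm (cexp z) = expR (complex.Re z).
Proof.
case: z => a b; rewrite /cexp /nrm /= !exprMn -mulrDr cos2Dsin2 mulr1 sqrtr_sqr.
by rewrite ger0_norm// expR_ge0.
Qed.
End Modulus.

(** * Taylor bounds for the complex exponential *)

Section ExpTaylor.
Variable R : realType.
Local Notation C := (Cplx R).
Implicit Types (x y z : C) (a b : R).

(** [g] is the derivative of [f] along rays from 0.  This is all that the remainder estimate below needs from complex differentiation, and it reduces to real derivatives. *)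
Definition raydiff (f g : C -> C) := forall z (s : R),
  is_derive s 1 (fun s : R => complex.Re (f (s%:C * z))) (complex.Re (z * g (s%:C * z))) /\
  is_derive s 1 (fun s : R => complex.Im (f (s%:C * z))) (complex.Im (z * g (s%:C * z))).

Lemma is_derive_comp_scale (h h' : R -> R) (x s : R) :
  (forall u : R, is_derive u (1 : R) h (h' u)) ->
  is_derive s (1 : R) (fun s : R => h (s * x)) (x * h' (s * x)).
Proof.
move=> hd.
have h1 : is_derive s (1 : R) (fun s : R => s * x) x.
  by apply: is_derive_eq; rewrite scaler0 add0r /GRing.scale /= mulr1.
have := @is_derive1_comp _ h (fun s => s * x) s _ _ (hd (s * x)) h1.
by rewrite mulrC.
Qed.

Lemma raydiff_cexp : raydiff (@cexp R) (@cexp R).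
Proof.
move=> [x y] s.
have D1 := @is_derive_comp_scale _ _ x s (@is_derive_expR R).
have D2 := @is_derive_comp_scale _ _ y s (@is_derive_cos R).
have D3 := @is_derive_comp_scale _ _ y s (@is_derive_sin R).
have e (f : R -> R) (s0 : R) : cexp (s0%:C * (x +i* y)) =
   (expR (s0 * x) * cos (s0 * y)) +i* (expR (s0 * x) * sin (s0 * y)).
  by rewrite /cexp /= !mul0r subr0 addr0.
split.
  rewrite (_ : (fun s0 : R => _) = (fun s0 => expR (s0 * x)) * (fun s0 => cos (s0 * y)))%R; last first.
    by apply/funext => u; rewrite e.
  apply: is_derive_eq; rewrite e //= /GRing.scale /=; ring.
rewrite (_ : (fun s0 : R => _) = (fun s0 => expR (s0 * x)) * (fun s0 => sin (s0 * y)))%R; last first.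
  by apply/funext => u; rewrite e.
apply: is_derive_eq; rewrite e //= /GRing.scale /=; ring.
Qed.

Lemma raydiffB f g f' g' : raydiff f f' -> raydiff g g' ->
  raydiff (fun z => f z - g z) (fun z => f' z - g' z).
Proof.
move=> ff gg z s; have [a1 a2] := ff z s; have [b1 b2] := gg z s.
split.
  rewrite (_ : (fun s0 : R => _) = (fun s0 : R => complex.Re (f (s0%:C * z))) - (fun s0 => complex.Re (g (s0%:C * z))))%R; last first.
    by apply/funext => u; rewrite ReB.
  by rewrite mulrBr ReB; apply: is_derive_eq.
rewrite (_ : (fun s0 : R => _) = (fun s0 : R => complex.Im (f (s0%:C * z))) - (fun s0 => complex.Im (g (s0%:C * z))))%R; last first.
  by apply/funext => u; rewrite ImB.
by rewrite mulrBr ImB; apply: is_derive_eq.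
Qed.

Lemma raydiffD f g f' g' : raydiff f f' -> raydiff g g' ->
  raydiff (fun z => f z + g z) (fun z => f' z + g' z).
Proof.
move=> ff gg z s; have [a1 a2] := ff z s; have [b1 b2] := gg z s.
split.
  rewrite (_ : (fun s0 : R => _) = (fun s0 : R => complex.Re (f (s0%:C * z))) + (fun s0 => complex.Re (g (s0%:C * z))))%R; last first.
    by apply/funext => u; rewrite ReD.
  by rewrite mulrDr ReD; apply: is_derive_eq.
rewrite (_ : (fun s0 : R => _) = (fun s0 : R => complex.Im (f (s0%:C * z))) + (fun s0 => complex.Im (g (s0%:C * z))))%R; last first.
  by apply/funext => u; rewrite ImD.
by rewrite mulrDr ImD; apply: is_derive_eq.
Qed.

Lemma raydiff_monomial n :
  raydiff (fun z => (n.+1`!%:R)^-1 * z ^+ n.+1) (fun z => (n`!%:R)^-1 * z ^+ n).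
Proof.
have e m (u : R) z : ((m`!%:R)^-1 : C) * (u%:C * z) ^+ m = ((m`!%:R)^-1 * u ^+ m)%:C * z ^+ m.
  rewrite exprMn mulrA rmorphM fmorphV rmorph_nat rmorphXn //.
have D (s c : R) : is_derive s (1:R) (fun s0 : R => (n.+1`!%:R)^-1 * s0 ^+ n.+1 * c) ((n`!%:R)^-1 * s ^+ n * c).
  have := is_deriveZ ((n.+1`!%:R)^-1 * c) (is_deriveX n.+1 (is_derive_id s (1 : R))).
  rewrite (_ : _ \*: _ = (fun s0 : R => (n.+1`!%:R)^-1 * s0 ^+ n.+1 * c)); last first.
    by apply/funext => u /=; rewrite /GRing.scale /= mulrAC fctE.
  rewrite (_ : _ *: _ = (n`!%:R)^-1 * s ^+ n * c) //.
  rewrite /GRing.scale /= mulr1 factS natrM.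
  have h1 : (n`!%:R : R) != 0 by rewrite pnatr_eq0 -lt0n fact_gt0.
  have h2 : (n.+1%:R : R) != 0 by rewrite pnatr_eq0.
  by field; apply/andP.
move=> z s; split.
  rewrite (_ : (fun s0 : R => _) = (fun s0 => (n.+1`!%:R)^-1 * s0 ^+ n.+1 * complex.Re (z ^+ n.+1))); last first.
    by apply/funext => u; rewrite e ReMr.
  by rewrite e mulrCA -exprS ReMr.
rewrite (_ : (fun s0 : R => _) = (fun s0 => (n.+1`!%:R)^-1 * s0 ^+ n.+1 * complex.Im (z ^+ n.+1))); last first.
  by apply/funext => u; rewrite e; case: (z ^+ _) => /= *; rewrite mul0r addr0.
by rewrite e mulrCA -exprS; case: (z ^+ _) => /= *; rewrite mul0r addr0.
Qed.

Definition exptrunc M (z : C) : C := \sum_(l < M) (l`!%:R)^-1 * z ^+ l.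

Lemma exptruncS M z : exptrunc M.+1 z = exptrunc M z + (M`!%:R)^-1 * z ^+ M.
Proof. by rewrite /exptrunc big_ord_recr. Qed.

Lemma raydiff_exptrunc M : raydiff (exptrunc M.+1) (exptrunc M).
Proof.
elim: M => [|M IH].
  have -> : exptrunc 0 = cst 0 by apply/funext => z; rewrite /exptrunc big_ord0.
  have -> : exptrunc 1 = cst 1.
    by apply/funext => z; rewrite exptruncS /exptrunc big_ord0 expr0 add0r invr1 mulr1.
  by move=> z s; rewrite mulr0; split; exact: is_derive_cst.
have E k : exptrunc k.+1 = fun z => exptrunc k z + (k`!%:R)^-1 * z ^+ k.
  by apply/funext => z; rewrite exptruncS.
rewrite [X in raydiff X](E M.+1) [X in raydiff _ X](E M).
by apply: (@raydiffD (exptrunc M.+1)) => //; exact: raydiff_monomial.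
Qed.

(** The mean value inequality along the ray through [z], applied to the real and imaginary parts; this is where the factor 2 comes from. *)
Lemma raydiff_bound_pow f g z A m : raydiff f g ->
  (forall s : R, 0 <= s <= 1 -> nrm z * nrm (g (s%:C * z)) <= A * s ^+ m) ->
  nrm (f z - f 0) <= 2 * (A / m.+1%:R).
Proof.
move=> fg gB.
have m0 : (m.+1%:R : R) != 0 by rewrite pnatr_eq0.
pose k (s : R) := A / m.+1%:R * s ^+ m.+1.
have kd (s : R) : is_derive s (1:R) k (A * s ^+ m).
  have := is_deriveZ (A / m.+1%:R) (is_deriveX m.+1 (is_derive_id s (1 : R))).
  rewrite (_ : _ \*: _ = k); last by apply/funext => u; rewrite /k /= /GRing.scale /= fctE.
  by move=> h; apply: (is_derive_eq h); rewrite /GRing.scale /= mulr1 mulrA mulfVK.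
have key (h h' : R -> R) : (forall s : R, is_derive s (1:R) h (h' s)) ->
    (forall s : R, 0 <= s <= 1 -> `|h' s| <= A * s ^+ m) -> h 1 - h 0 <= A / m.+1%:R.
  move=> hd hb.
  have d (s : R) : is_derive s (1:R) (k - h) (A * s ^+ m - h' s) by apply: is_derive_eq.
  have c : {within `[0, 1], continuous (k - h)}.
    by apply: derivable_within_continuous => s _; have [] := d s.
  have [s s01 e] := MVT_segment (ler01 : (0:R) <= 1) (fun s _ => d s) c.
  have : 0 <= (k - h) 1 - (k - h) 0.
    rewrite e subr0 mulr1 subr_ge0; apply: le_trans (ler_norm _) (hb _ _).
    by move: s01; rewrite in_itv.
  have -> : (k - h) 1 - (k - h) 0 = A / m.+1%:R - (h 1 - h 0).
    by rewrite !fctE /k expr1n expr0n /= mulr0 mulr1; ring.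
  by rewrite subr_ge0.
have key2 (h h' : R -> R) : (forall s : R, is_derive s (1:R) h (h' s)) ->
    (forall s : R, 0 <= s <= 1 -> `|h' s| <= A * s ^+ m) -> `|h 1 - h 0| <= A / m.+1%:R.
  move=> hd hb; rewrite ler_norml (key h h')// andbT.
  have := key (- h) (- h') (fun s => is_deriveN (hd s)) (fun s hs => eq_ind_r (fun t => t <= _) (hb s hs) (normrN (h' s))).
  by rewrite !fctE opprK lerNl opprD opprK [- h 1 + _]addrC.
have zB s : 0 <= s <= 1 -> nrm (z * g (s%:C * z)) <= A * s ^+ m.
  by move=> hs; rewrite nrmM; exact: gB.
have -> : f z - f 0 = f (1%:C * z) - f (0%:C * z) by rewrite mul1r mul0r.
rewrite (le_trans (nrm_le_ReIm _))// mulr2n mulrDl mul1r lerD//.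
  rewrite ReB.
  apply: (key2 (fun s => complex.Re (f (s%:C * z))) (fun s => complex.Re (z * g (s%:C * z)))).
    by move=> s; have [] := fg z s.
  by move=> s /zB; apply: le_trans; exact: Re_le_nrm.
rewrite ImB.
apply: (key2 (fun s => complex.Im (f (s%:C * z))) (fun s => complex.Im (z * g (s%:C * z)))).
  by move=> s; have [] := fg z s.
by move=> s /zB; apply: le_trans; exact: Im_le_nrm.
Qed.

(** By induction on [M]: the remainder of order [M + 1] vanishes at 0 and its derivative is the remainder of order [M]. *)
Lemma exptrunc_bound M z : nrm (cexp z - exptrunc M z) <= expR (nrm z) * (2 * nrm z) ^+ M / M`!%:R.
Proof.
elim: M z => [|M IH] z.
  rewrite /exptrunc big_ord0 subr0 expr0 mulr1 fact0 divr1 nrm_cexp ler_expR.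
  by rewrite (le_trans (ler_norm _)) ?Re_le_nrm.
have -> : cexp z - exptrunc M.+1 z = (cexp z - exptrunc M.+1 z) - (cexp 0 - exptrunc M.+1 0).
  rewrite cexp0 (_ : exptrunc M.+1 0 = 1) ?subrr ?subr0//.
  rewrite /exptrunc big_ord_recl big1 ?addr0 ?expr0 ?mulr1 ?invr1// => i _.
  by rewrite exprS mul0r mulr0.
have h : raydiff (fun w => cexp w - exptrunc M.+1 w) (fun w => cexp w - exptrunc M w).
  by apply: raydiffB; [exact: raydiff_cexp|exact: raydiff_exptrunc].
have f0 : (M`!%:R : R) != 0 by rewrite pnatr_eq0 -lt0n fact_gt0.
have m0 : (M.+1%:R : R) != 0 by rewrite pnatr_eq0.
apply: (le_trans (raydiff_bound_pow (A := nrm z * (expR (nrm z) * (2 * nrm z) ^+ M / M`!%:R)) (m := M) h _)).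
  move=> s /andP[s0 s1]; rewrite -mulrA ler_wpM2l ?nrm_ge0// (le_trans (IH _))//.
  have -> : nrm (s%:C * z) = s * nrm z by rewrite nrmM nrm_real ger0_norm.
  rewrite (mulrCA 2) (exprMn M s).
  have -> : expR (s * nrm z) * (s ^+ M * (2 * nrm z) ^+ M) / M`!%:R =
     expR (s * nrm z) * ((2 * nrm z) ^+ M / M`!%:R * s ^+ M) by ring.
  have -> : expR (nrm z) * (2 * nrm z) ^+ M / M`!%:R * s ^+ M =
     expR (nrm z) * ((2 * nrm z) ^+ M / M`!%:R * s ^+ M) by ring.
  rewrite ler_wpM2r ?ler_expR ?ler_piMl ?nrm_ge0//.
  by rewrite !mulr_ge0 ?invr_ge0 ?exprn_ge0 ?mulr_ge0 ?nrm_ge0.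
rewrite factS natrM exprS le_eqVlt; apply/orP; left; apply/eqP; field.
by rewrite f0 addrC natr1 m0.
Qed.

Lemma exptruncE M z : nrm z <= 1 -> nrm (cexp z - exptrunc M z) <= expR 1 * (2 * nrm z) ^+ M.
Proof.
move=> z1; apply: (le_trans (exptrunc_bound M z)).
have f1 : 1 <= (M`!%:R : R) by rewrite ler1n fact_gt0.
have k : 0 <= (2 * nrm z) ^+ M by rewrite exprn_ge0// mulr_ge0// nrm_ge0.
rewrite ler_pdivrMr ?(lt_le_trans ltr01)//.
apply: (@le_trans _ _ (expR 1 * (2 * nrm z) ^+ M)); first by rewrite ler_wpM2r// ler_expR.
by rewrite ler_peMr// mulr_ge0// expR_ge0.
Qed.
End ExpTaylor.

(** * Averages over roots of unity *)

Section CircleAverage.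
Variable R : realType.
Local Notation C := (Cplx R).
Implicit Types (z : C) (u r : R).

Definition cis u : C := cos u +i* sin u.

Lemma cexpE x y : cexp ((x +i* y) : C) = (expR x)%:C * cis y.
Proof. by apply/eqP; rewrite eq_complex /= !mul0r subr0 addr0 !eqxx. Qed.
Lemma cisD u v : cis (u + v) = cis u * cis v.
Proof. by apply/eqP; rewrite eq_complex /= cosD sinD; apply/andP; split; apply/eqP; ring. Qed.
Lemma cis0 : cis 0 = 1. Proof. by rewrite /cis cos0 sin0. Qed.
Lemma cisMn u n : cis (u *+ n) = cis u ^+ n.
Proof. by elim: n => [|n IH]; rewrite ?mulr0n ?cis0// mulrS cisD IH exprS. Qed.
Lemma nrm_cis u : nrm (cis u) = 1.
Proof. by rewrite /nrm /= cos2Dsin2 sqrtr1. Qed.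
Lemma cisN_mul u : cis u * cis (- u) = 1. Proof. by rewrite -cisD subrr cis0. Qed.

(** The [2 M + 1] equidistant angles between -pi and pi, symmetric about 0. *)
Definition ang (M l : nat) : R := 2 * pi * (l%:R - M%:R) / (M.*2.+1)%:R.
Definition cavg (M : nat) (f : R -> C) : C :=
  (M.*2.+1)%:R^-1 * \sum_(l < M.*2.+1) f (ang M l).
Definition ravg (M : nat) (f : R -> R) : R :=
  (M.*2.+1)%:R^-1 * \sum_(l < M.*2.+1) f (ang M l).

Lemma nrm_cavg M f : nrm (cavg M f) <= ravg M (fun u => nrm (f u)).
Proof.
rewrite nrmM nrmV nrm_nat /ravg ler_wpM2l ?invr_ge0// ?ler0n//; exact: nrm_sum.
Qed.

Lemma le_ravg M f g : (forall u, `|u| <= pi -> f u <= g u) -> ravg M f <= ravg M g.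
Proof.
move=> fg; rewrite ler_wpM2l ?invr_ge0 ?ler0n//; apply: ler_sum => l _; apply: fg.
rewrite /ang !normrM normfV (ger0_norm (ler0n _ _)) normr_nat (ger0_norm (pi_ge0 R)).
rewrite ler_pdivrMr ?ltr0n// mulrAC mulrC ler_wpM2l ?pi_ge0//.
rewrite -[X in X * _]normr_nat -normrM ler_norml; have := ltn_ord l; move: (nat_of_ord l) => k hk.
have hk' : (k%:R : R) <= M%:R * 2 by rewrite -natrM ler_nat muln2 -ltnS.
have k0 : 0 <= (k%:R : R) by [].
have e : (M.*2.+1%:R : R) = M%:R * 2 + 1 by rewrite -addn1 natrD -muln2 natrM.
rewrite e; apply/andP; split; lra.
Qed.

Lemma ravg_cst M c : ravg M (fun=> c) = c.
Proof.
by rewrite /ravg sumr_const card_ord -(mulr_natl c) mulrA mulVf ?mul1r// pnatr_eq0.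
Qed.

Lemma ravgD M f g : ravg M f + ravg M g = ravg M (fun u => f u + g u).
Proof. by rewrite /ravg -mulrDr -big_split. Qed.

(** Through the half angle: cos u = 1 forces sin (u/2) = 0, which has no solution in the given range. *)
Lemma cis_neq1 u : 0 < `|u| < 2 * pi -> cis u != 1.
Proof.
move=> /andP[u0 u2]; apply/eqP => -[h _].
have h2 : cos `|u| = 1 by rewrite -h; case: (ger0P u) => //; rewrite cosN.
have := sin_gt0_pi (x := `|u| / 2).
have -> : 0 < `|u| / 2 < pi by apply/andP; split; lra.
move=> /(_ isT) s0.
have : cos (`|u| / 2 + `|u| / 2) = 1 by rewrite -splitr.
rewrite cosD -!expr2 => e.
have := cos2Dsin2 (`|u| / 2); nra.
Qed.

(** A geometric sum whose ratio is a nontrivial root of unity. *)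
Lemma sum_cis_ang M (j : int) : j != 0 -> (`|j| < M.*2.+1)%N ->
  \sum_(l < M.*2.+1) cis (j%:~R * ang M l) = 0.
Proof.
move=> j0 jN.
set N := M.*2.+1 in jN *.
have N0 : (N%:R : R) != 0 by rewrite pnatr_eq0.
have N1 : 0 < (N%:R : R) by rewrite ltr0n.
set t := (2 * pi * j%:~R / N%:R : R).
pose w := cis t.
have E l : cis (j%:~R * ang M l) = cis (- (t * M%:R)) * w ^+ l.
  rewrite /w -cisMn -cisD; congr cis; rewrite /t /ang -/N -mulr_natr; field; exact: N0.
under eq_bigr => l _ do rewrite E.
rewrite -mulr_sumr.
suff : (w - 1) * (\sum_(l < N) w ^+ l) = 0.
  move/eqP; rewrite mulf_eq0 => /orP[|/eqP ->]; rewrite ?mulr0//.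
  rewrite subr_eq0 => /eqP wE; exfalso.
  have : cis t != 1.
    apply: cis_neq1.
    have jR : 0 < (`|j%:~R| : R) by rewrite normr_gt0 intr_eq0.
    have jN' : (`|j%:~R| : R) < N%:R.
      by rewrite -intr_norm -[N%:R]/(N%:Z%:~R) ltr_int -abszE ltz_nat.
    have -> : `|t| = 2 * pi * (`|j%:~R| / N%:R).
      by rewrite /t !normrM normfV !normr_nat (ger0_norm (pi_ge0 R)) mulrA.
    have pp := pi_gt0 R.
    apply/andP; split; first by rewrite !mulr_gt0 ?invr_gt0.
    by rewrite gtr_pMr ?mulr_gt0// ltr_pdivrMr ?mul1r.
  by rewrite -/w wE eqxx.
rewrite -subrX1 /w -cisMn -mulr_natr /t mulfVK//.
suff -> : cis (2 * pi * j%:~R) = 1 by rewrite subrr.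
have per n : cis (2 * pi * n%:R) = 1.
  rewrite mulr_natr cisMn (_ : cis _ = 1) ?expr1n//.
  by rewrite /cis mulr_natl cos2pi sin2pi.
case: j {j0 jN t w E} => n; first exact: per.
rewrite NegzE mulrNz mulrN; have := cisN_mul (2 * pi * n.+1%:R).
by rewrite per mul1r.
Qed.

(** Discrete Fourier inversion, exact as soon as there are more angles than coefficients. *)
Lemma dft_coef M (p : {poly C}) r k : (size p <= M.*2.+1)%N -> (k < M.*2.+1)%N ->
  cavg M (fun u => p.[r%:C * cis u] * cis (- (k%:R * u))) = p`_k * r%:C ^+ k.
Proof.
move=> sp kN.
rewrite /cavg.
under eq_bigr => l _ do rewrite (horner_coef_wide _ sp) mulr_suml.
rewrite exchange_big /=.
have E (i : 'I_M.*2.+1) : \sum_(l < M.*2.+1) p`_i * (r%:C * cis (ang M l)) ^+ i * cis (- (k%:R * ang M l)) =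
   p`_i * r%:C ^+ i * (\sum_(l < M.*2.+1) cis ((i%:Z - k%:Z)%:~R * ang M l)).
  rewrite mulr_sumr; apply: eq_bigr => l _.
  move: (ang M l) => a.
  rewrite exprMn -cisMn -!mulrA -cisD; congr (_ * (_ * cis _)).
  by rewrite rmorphB /= mulrBl -(mulr_natl a i).
rewrite (eq_bigr _ (fun i _ => E i)) (bigD1 (Ordinal kN)) //= [X in _ + X]big1 ?addr0.
  rewrite (eq_bigr (fun=> 1)); last by move=> l _; rewrite subrr mul0r cis0.
  rewrite sumr_const card_ord mulrCA mulVf ?mulr1//.
move=> i ik; rewrite sum_cis_ang ?mulr0//.
  by rewrite subr_eq0; apply: contra ik => /eqP[e]; apply/eqP/val_inj.
have := ltn_ord i; lia.
Qed.

(** Cauchy's estimate for the coefficients of a polynomial, with an average instead of a supremum. *)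
Lemma coef_le_ravg M (p : {poly C}) r k : 0 <= r -> (size p <= M.*2.+1)%N -> (k < M.*2.+1)%N ->
  nrm p`_k * r ^+ k <= ravg M (fun u => nrm p.[r%:C * cis u]).
Proof.
move=> r0 sp kN.
have := nrm_cavg M (fun u => p.[r%:C * cis u] * cis (- (k%:R * u))).
rewrite dft_coef// nrmM nrmX nrm_real ger0_norm// => /le_trans; apply.
by apply: le_ravg => u _; rewrite nrmM nrm_cis mulr1.
Qed.

Lemma coef_le_sup (p : {poly C}) r k B : 0 <= r ->
  (forall z, nrm z <= r -> nrm p.[z] <= B) -> nrm p`_k * r ^+ k <= B.
Proof.
move=> r0 pB.
pose M := maxn (size p) k.
apply: (le_trans (coef_le_ravg (M := M) r0 _ _)); [rewrite /M; lia.. |].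
rewrite -[leRHS](ravg_cst M); apply: le_ravg => u _; apply: pB.
by rewrite nrmM nrm_cis mulr1 nrm_real ger0_norm.
Qed.
End CircleAverage.

(** * Uniform approximation by polynomials on a disc *)

Section Topology.
Variable R : realType.
Local Notation C := (Cplx R).

Lemma cvg_nrmP (T : Type) (F : set_system T) (FF : Filter F) (f : T -> C) (l : C) :
  (f @ F --> l) <-> (forall e : R, 0 < e -> \forall x \near F, nrm (l - f x) <= e).
Proof.
split.
  move=> /cvgrPdist_le h e e0.
  have := h e%:C; rewrite ltcR => /(_ e0); apply: filterS => x.
  by rewrite norm_nrm lecR.
move=> h; apply/cvgrPdist_le => e.
case: e => a b; rewrite ltcE /= => /andP[/eqP -> a0].
by have := h a a0; apply: filterS => x; rewrite norm_nrm lecR.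
Qed.

Lemma nbhs_nrm (z0 : C) (d : R) : 0 < d -> \forall z \near z0, nrm (z - z0) < d.
Proof.
move=> d0; apply/nbhs_normP; exists d%:C; rewrite /= ?ltcR//.
by move=> z; rewrite /= norm_nrm ltcR nrm_distC.
Qed.

Lemma nbhs_nrmE (z0 : C) (P : set C) : nbhs z0 P -> exists2 d : R, 0 < d & forall z, nrm (z - z0) < d -> P z.
Proof.
move=> /nbhs_normP [[a b]]; rewrite /= ltcE /= => /andP[/eqP -> a0] h.
by exists a => // z hz; apply: h; rewrite /= norm_nrm ltcR nrm_distC.
Qed.

(** Completeness of the complex numbers in quantitative form, obtained from suprema of real sets for the real and imaginary parts. *)
Lemma nrm_complete (u : nat -> C) (K : R) :
  (forall i j, nrm (u i - u j) <= K / i.+1%:R + K / j.+1%:R) ->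
  exists l, forall j, nrm (l - u j) <= 2 * K / j.+1%:R.
Proof.
move=> uK.
have key (x : nat -> R) : (forall i j, x i - x j <= K / i.+1%:R + K / j.+1%:R) ->
    exists a, forall j, `|a - x j| <= K / j.+1%:R.
  move=> xK.
  pose A := [set y | exists i, y = x i - K / i.+1%:R].
  have A0 : A !=set0 by exists (x 0%N - K / 1%:R), 0%N.
  have ubA j : ubound A (x j + K / j.+1%:R).
    by move=> _ [i ->]; rewrite lerBlDr -addrA -lerBlDl [leRHS]addrC; exact: xK.
  exists (sup A) => j; rewrite ler_norml; apply/andP; split.
    rewrite lerBrDl.
    by apply: (ub_le_sup (E := A)); [exists (x j + K / j.+1%:R)|exists j].
  by rewrite lerBlDl; apply: ge_sup.
have [a ha] := key (fun i => complex.Re (u i)) (fun i j => le_trans (le_trans (ler_norm _) (eq_ind _ (fun t => `|t| <= _) (Re_le_nrm _) _ (ReB _ _))) (uK i j)).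
have [b hb] := key (fun i => complex.Im (u i)) (fun i j => le_trans (le_trans (ler_norm _) (eq_ind _ (fun t => `|t| <= _) (Im_le_nrm _) _ (ImB _ _))) (uK i j)).
exists (a +i* b) => j; rewrite (le_trans (nrm_le_ReIm _))// ReB ImB /=.
by rewrite -mulrA mulr_natl mulr2n lerD ?ha ?hb.
Qed.
End Topology.

Section PolyApprox.
Variable R : realType.
Local Notation C := (Cplx R).
Implicit Types (f g : C -> C) (rho : R) (p : {poly C}).

(** Equivalent to continuity on the closed disc and analyticity inside; stated so that all estimates can be checked on polynomials. *)
Definition polyapprox rho f := forall e : R, 0 < e ->
  exists p : {poly C}, forall z, nrm z <= rho -> nrm (f z - p.[z]) <= e.

Lemma nrm_horner p z : nrm p.[z] <= \sum_(i < size p) nrm p`_i * nrm z ^+ i.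
Proof.
rewrite horner_coef (le_trans (nrm_sum _ _ _))//.
by apply: ler_sum => i _; rewrite nrmM nrmX.
Qed.

Lemma pa_bounded rho f : polyapprox rho f ->
  exists2 B : R, 0 < B & forall z, nrm z <= rho -> nrm (f z) <= B.
Proof.
move=> /(_ 1 ltr01)[p hp].
have S0 : 0 <= \sum_(i < size p) nrm p`_i * `|rho| ^+ i.
  by apply: sumr_ge0 => i _; rewrite mulr_ge0 ?nrm_ge0// exprn_ge0.
exists (1 + \sum_(i < size p) nrm p`_i * `|rho| ^+ i).
  by rewrite ltr_pwDl.
move=> z zr; rewrite -(subrK p.[z] (f z)) (le_trans (nrmD _ _))// lerD ?hp//.
rewrite (le_trans (nrm_horner _ _))//; apply: ler_sum => i _.
rewrite ler_wpM2l ?nrm_ge0// lerXn2r ?nnegrE ?nrm_ge0//.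
by rewrite (le_trans zr)// ler_norm.
Qed.

Lemma pa_cst rho c : polyapprox rho (fun=> c).
Proof. by move=> e e0; exists c%:P => z _; rewrite hornerC subrr nrm0 ltW. Qed.
Lemma pa_id rho : polyapprox rho id.
Proof. by move=> e e0; exists 'X => z _; rewrite hornerX subrr nrm0 ltW. Qed.

Lemma pa_lim rho f : (forall e : R, 0 < e -> exists2 g, polyapprox rho g & forall z, nrm z <= rho -> nrm (f z - g z) <= e) ->
  polyapprox rho f.
Proof.
move=> h e e0; have e2 : 0 < e / 2 by rewrite divr_gt0.
have [g pg fg] := h _ e2; have [p gp] := pg _ e2.
exists p => z zr; rewrite -(subrK (g z) (f z)) -addrA (le_trans (nrmD _ _))//.
by rewrite (splitr e) lerD ?fg ?gp.
Qed.

Lemma pa_add rho f g : polyapprox rho f -> polyapprox rho g -> polyapprox rho (fun z => f z + g z).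
Proof.
move=> hf hg e e0; have e2 : 0 < e / 2 by rewrite divr_gt0.
have [p hp] := hf _ e2; have [q hq] := hg _ e2.
exists (p + q) => z zr; rewrite hornerD opprD addrACA (le_trans (nrmD _ _))//.
by rewrite (splitr e) lerD ?hp ?hq.
Qed.

Lemma pa_mul rho f g : polyapprox rho f -> polyapprox rho g -> polyapprox rho (fun z => f z * g z).
Proof.
move=> hf hg e e0.
have [A A0 fA] := pa_bounded hf.
have [B B0 gB] := pa_bounded hg.
have [p hp] := hf (e / 2 / (B + 1)) ltac:(by rewrite !divr_gt0// addr_gt0).
have [q hq] := hg (e / 2 / (A + 1) / (1 + e / 2 / (B + 1))) ltac:(by rewrite !divr_gt0 ?addr_gt0 ?divr_gt0// addr_gt0).
exists (p * q) => z zr.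
have -> : f z * g z - (p * q).[z] = (f z - p.[z]) * g z + p.[z] * (g z - q.[z]).
  by rewrite hornerM; ring.
rewrite (le_trans (nrmD _ _))// !nrmM (splitr e) lerD//.
  rewrite (le_trans (ler_pM (nrm_ge0 _) (nrm_ge0 _) (hp _ zr) (gB _ zr)))//.
  by rewrite mulrAC ler_pdivrMr ?addr_gt0// ler_wpM2l ?divr_ge0 ?ltW// ltrDl.
have pA : nrm p.[z] <= A + e / 2 / (B + 1).
  have := nrmB_ge p.[z] (f z); rewrite nrm_distC => h1; have := hp _ zr; have := fA _ zr; lra.
have hqz := hq _ zr.
rewrite (le_trans (ler_pM (nrm_ge0 _) (nrm_ge0 _) pA hqz))//.
set t := e / 2 / (B + 1).
have t0 : 0 < t by rewrite !divr_gt0// addr_gt0.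
have -> : (A + t) * (e / 2 / (A + 1) / (1 + t)) = e / 2 * ((A + t) / ((A + 1) * (1 + t))).
  by field; rewrite !lt0r_neq0 ?addr_gt0.
rewrite ler_piMr ?divr_ge0 ?ltW//.
by rewrite ltr_pdivrMr ?mulr_gt0 ?addr_gt0//; nra.
Qed.

Lemma pa_scale rho c f : polyapprox rho f -> polyapprox rho (fun z => c * f z).
Proof. by move=> hf; apply: pa_mul => //; exact: pa_cst. Qed.
Lemma pa_sub rho f g : polyapprox rho f -> polyapprox rho g -> polyapprox rho (fun z => f z - g z).
Proof.
move=> hf hg; have := pa_add hf (pa_scale (-1) hg).
by rewrite (_ : (fun z => f z + -1 * g z) = (fun z => f z - g z))//; apply/funext => z; rewrite mulN1r.
Qed.
Lemma pa_sum (I : Type) (s : seq I) rho (f : I -> C -> C) :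
  (forall i, polyapprox rho (f i)) -> polyapprox rho (fun z => \sum_(i <- s) f i z).
Proof.
move=> hf; elim: s => [|i s IH].
  by rewrite (_ : (fun z => _) = (fun=> 0)); [exact: pa_cst|apply/funext => z; rewrite big_nil].
rewrite (_ : (fun z => _) = (fun z => f i z + \sum_(i <- s) f i z)); first exact: pa_add.
by apply/funext => z; rewrite big_cons.
Qed.
Lemma pa_exp rho n f : polyapprox rho f -> polyapprox rho (fun z => f z ^+ n).
Proof.
move=> hf; elim: n => [|n IH].
  by rewrite (_ : (fun z => _) = (fun=> 1)); [exact: pa_cst|apply/funext => z; rewrite expr0].
rewrite (_ : (fun z => _) = (fun z => f z * f z ^+ n)); first exact: pa_mul.
by apply/funext => z; rewrite exprS.
Qed.

(** Taylor polynomials of the exponential converge geometrically on the disc of radius 1/4; dividing [f] by a large integer [m] reduces to that case, and the [m]-th power restores [cexp (f z)]. *)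
Lemma pa_cexp rho f : polyapprox rho f -> polyapprox rho (fun z => cexp (f z)).
Proof.
move=> hf; have [B B0 fB] := pa_bounded hf.
pose m := (Num.truncn (4 * B)).+1.
have mB : 4 * B <= m%:R by rewrite ltW// /m truncnS_gt.
have m0 : 0 < (m%:R : R) by rewrite ltr0n.
have mC : (m%:R : C) != 0 by rewrite pnatr_eq0.
rewrite (_ : (fun z => _) = (fun z => cexp (m%:R^-1 * f z) ^+ m)); last first.
  by apply/funext => z; rewrite -cexpMn -(mulr_natl (_ * _) m) mulrA mulfV// mul1r.
apply: pa_exp; apply: pa_lim => e e0.
have small z : nrm z <= rho -> nrm (m%:R^-1 * f z) <= 1 / 4.
  move=> zr; rewrite nrmM nrmV nrm_nat ler_pdivrMl//.
  by have := fB _ zr; lra.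
have [M hM] : exists M, expR 1 * (2^-1) ^+ M <= e.
  have /cvgrPdist_le/(_ (e / expR 1)) : (2^-1 : R) ^+ n @[n --> \oo] --> (0 : R).
    by apply: cvg_expr; rewrite ger0_norm; lra.
  rewrite divr_gt0 ?expR_gt0// => /(_ isT)[M _ /(_ M (leqnn M))] /=.
  rewrite sub0r normrN ger0_norm ?exprn_ge0// => h; exists M.
  by rewrite mulrC -ler_pdivlMr ?expR_gt0.
exists (fun z => exptrunc M (m%:R^-1 * f z)).
  rewrite (_ : (fun z => _) = (fun z => \sum_(l < M) (l`!%:R)^-1 * (m%:R^-1 * f z) ^+ l)); last by apply/funext.
  apply: pa_sum => l; apply: pa_scale; apply: pa_exp; exact: pa_scale.
move=> z zr; have s4 := small _ zr.
rewrite (le_trans (exptruncE _ _)) ?(le_trans s4)//; first lra.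
rewrite (le_trans _ hM)// ler_wpM2l ?expR_ge0// lerXn2r ?nnegrE ?mulr_ge0 ?nrm_ge0//.
lra.
Qed.
End PolyApprox.

(** * Cauchy estimates and derivatives *)

Section PolyTaylor.
Variable R : realType.
Local Notation C := (Cplx R).
Implicit Types (f g : C -> C) (rho B : R) (p : {poly C}).

Lemma geo_sum_le2 (x : R) d : 0 <= x -> x <= 1 / 2 -> \sum_(i < d) x ^+ i <= 2.
Proof.
move=> x0 x2; elim: d => [|d IH]; first by rewrite big_ord0.
rewrite big_ord_recl expr0.
under eq_bigr => i _ do rewrite lift0 exprS.
rewrite -mulr_sumr.
have : 0 <= \sum_(i < d) x ^+ i by apply: sumr_ge0 => i _; exact: exprn_ge0.
nra.
Qed.

(** Cauchy's estimate bounds the [i]-th coefficient by [B / rho ^+ i], so the tail is dominated by a geometric series of ratio at most 1/2. *)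
Lemma poly_taylor p rho B m h : 0 < rho ->
  (forall z, nrm z <= rho -> nrm p.[z] <= B) -> nrm h <= rho / 2 ->
  nrm (p.[h] - \sum_(i < m) p`_i * h ^+ i) <= 2 * B * (nrm h / rho) ^+ m.
Proof.
move=> r0 pB hr.
have B0 : 0 <= B by rewrite (le_trans (nrm_ge0 p.[0]))// pB// nrm0 ltW.
rewrite (@horner_coef_wide _ (m + size p)) ?leq_addl// big_split_ord /= addrAC subrr add0r.
rewrite (le_trans (nrm_sum _ _ _))//.
set x := nrm h / rho.
have x0 : 0 <= x by rewrite divr_ge0 ?nrm_ge0 ?ltW.
have x2 : x <= 1 / 2 by rewrite ler_pdivrMr// mulrC mul1r.
apply: (@le_trans _ _ (\sum_(i < size p) B * x ^+ m * x ^+ i)).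
  apply: ler_sum => i _.
  rewrite nrmM nrmX -mulrA -exprD /x expr_div_n mulrA ler_pdivlMr ?exprn_gt0//.
  rewrite mulrAC ler_wpM2r ?exprn_ge0 ?nrm_ge0//.
  by apply: coef_le_sup => //; exact: ltW.
rewrite -mulr_sumr -[leRHS]mulrA.
have /(_ (size p)) := geo_sum_le2 _ x0 x2.
have : 0 <= B * x ^+ m by rewrite mulr_ge0 ?exprn_ge0.
move: (B * _) (\sum_(i < _) _) => u v; nra.
Qed.

Definition pshift (zeta : C) p : {poly C} := p \Po ('X + zeta%:P).

Lemma pshiftE zeta p h : (pshift zeta p).[h] = p.[h + zeta].
Proof. by rewrite horner_comp hornerD hornerX hornerC. Qed.

Lemma pshift_coef0 zeta p : (pshift zeta p)`_0 = p.[zeta].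
Proof. by rewrite -horner_coef0 pshiftE add0r. Qed.
Lemma pshift_coef1 zeta p : (pshift zeta p)`_1 = p^`().[zeta].
Proof.
have -> : (pshift zeta p)`_1 = ((pshift zeta p)^`())`_0 by rewrite coef_deriv mulr1n.
by rewrite -horner_coef0 deriv_comp derivD derivX derivC addr0 mulr1 horner_comp hornerD hornerX hornerC add0r.
Qed.

Lemma pshift_bound zeta p rho B : (forall z, nrm z <= rho -> nrm p.[z] <= B) ->
  nrm zeta <= rho / 2 -> forall z, nrm z <= rho / 2 -> nrm (pshift zeta p).[z] <= B.
Proof.
move=> pB zr z z2; rewrite pshiftE pB// (le_trans (nrmD _ _))//.
by rewrite (splitr rho) lerD.
Qed.

(** Cauchy's estimate for the first coefficient of the polynomial recentred at [zeta], on a disc of half the radius. *)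
Lemma cauchy_deriv p rho B zeta : 0 < rho -> (forall z, nrm z <= rho -> nrm p.[z] <= B) ->
  nrm zeta <= rho / 2 -> nrm p^`().[zeta] <= 2 * B / rho.
Proof.
move=> r0 pB zr.
have r2 : 0 < rho / 2 by rewrite divr_gt0.
have := coef_le_sup 1 (ltW r2) (pshift_bound pB zr).
rewrite pshift_coef1 expr1 -ler_pdivlMr// => /le_trans; apply.
by rewrite invf_div mulrA [B * 2]mulrC.
Qed.

Lemma deriv_taylor p rho B zeta h : 0 < rho -> (forall z, nrm z <= rho -> nrm p.[z] <= B) ->
  nrm zeta <= rho / 2 -> nrm h <= rho / 4 ->
  nrm (p.[h + zeta] - p.[zeta] - p^`().[zeta] * h) <= 8 * B / rho ^+ 2 * nrm h ^+ 2.
Proof.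
move=> r0 pB zr hr.
have r2 : 0 < rho / 2 by rewrite divr_gt0.
have hr' : nrm h <= rho / 2 / 2 by lra.
have := poly_taylor 2 r2 (pshift_bound pB zr) hr'.
rewrite pshiftE !big_ord_recl big_ord0 /= /bump /= pshift_coef0 pshift_coef1 expr0 mulr1 expr1 addr0.
rewrite opprD addrA => /le_trans; apply.
rewrite le_eqVlt; apply/orP; left; apply/eqP; field; exact: lt0r_neq0.
Qed.
End PolyTaylor.

Section PolyApproxDeriv.
Variable R : realType.
Local Notation C := (Cplx R).
Implicit Types (f g : C -> C) (rho B : R) (p : {poly C}).

Lemma ler_eps_inv (a b K : R) : (forall j : nat, a <= b + K / j.+1%:R) -> a <= b.
Proof.
move=> h; apply/ler_addgt0Pr => e e0.
pose j := Num.truncn (`|K| / e).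
apply: (le_trans (h j)); rewrite lerD2l.
apply: (@le_trans _ _ (`|K| / j.+1%:R)); first by rewrite ler_wpM2r ?invr_ge0// ler_norm.
by rewrite ler_pdivrMr// mulrC -ler_pdivrMr// ltW// /j truncnS_gt.
Qed.

(** The derivatives of approximating polynomials form a Cauchy sequence on the half disc, by [cauchy_deriv]; their limit is the derivative of [f], because the second order Taylor bound [deriv_taylor] is uniform over the approximations. *)
Lemma pa_deriv rho f : 0 < rho -> polyapprox rho f -> exists g,
  [/\ polyapprox (rho / 2) g,
      forall zeta, nrm zeta < rho / 2 ->
        h^-1 *: (f (h + zeta) - f zeta) @[h --> 0^'] --> g zeta
    & forall p (e : R), (forall z, nrm z <= rho -> nrm (f z - p.[z]) <= e) ->
      forall zeta, nrm zeta <= rho / 2 -> nrm (g zeta - p^`().[zeta]) <= 2 * e / rho].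
Proof.
move=> r0 hf.
have /choice[p hp] : forall j : nat, exists p : {poly C}, forall z, nrm z <= rho -> nrm (f z - p.[z]) <= j.+1%:R^-1.
  by move=> j; apply: hf; rewrite invr_gt0.
have pq (p1 p2 : {poly C}) (e1 e2 : R) : (forall z, nrm z <= rho -> nrm (f z - p1.[z]) <= e1) ->
   (forall z, nrm z <= rho -> nrm (f z - p2.[z]) <= e2) ->
   forall zeta, nrm zeta <= rho / 2 -> nrm (p1^`().[zeta] - p2^`().[zeta]) <= 2 * (e1 + e2) / rho.
  move=> h1 h2 zeta zr; rewrite -hornerN -hornerD -derivB; apply: cauchy_deriv => // z zr'.
  rewrite hornerD hornerN -(subrK (f z) p1.[z]) -addrA (le_trans (nrmD _ _))//.
  by rewrite lerD ?h2// nrm_distC h1.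
have /choice[g hg] : forall zeta, exists l, nrm zeta <= rho / 2 ->
     forall j : nat, nrm (l - (p j)^`().[zeta]) <= 2 * (2 / rho) / j.+1%:R.
  move=> zeta; have [zr|] := boolP (nrm zeta <= rho / 2); last by exists 0.
  have [|l hl] := @nrm_complete R (fun j => (p j)^`().[zeta]) (2 / rho); last by exists l.
  move=> i j; rewrite -mulrDr mulrAC; exact: (pq _ _ _ _ (hp i) (hp j)).
have gp q (e : R) : (forall z, nrm z <= rho -> nrm (f z - q.[z]) <= e) ->
      forall zeta, nrm zeta <= rho / 2 -> nrm (g zeta - q^`().[zeta]) <= 2 * e / rho.
  move=> fq zeta zr; apply: (@ler_eps_inv _ _ (2 * (2 / rho) + 2 / rho)) => j.
  rewrite -(subrK (p j)^`().[zeta] (g zeta)) -addrA (le_trans (nrmD _ _))//.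
  rewrite [X in _ <= _ + X](mulrDl (2 * (2 / rho)) (2 / rho)) addrCA lerD ?hg//.
  rewrite (le_trans (pq _ _ _ _ (hp j) fq _ zr))//.
  by rewrite (mulrDr 2) (mulrDl (2 * _)) [leLHS]addrC lerD2l [leLHS]mulrAC.
exists g; split => //.
  move=> e e0; have e1 : 0 < e * rho / 2 by rewrite !(divr_gt0, mulr_gt0).
  have [q hq] := hf _ e1; exists q^`() => z zr.
  rewrite (le_trans (gp _ _ hq _ zr))// le_eqVlt; apply/orP; left; apply/eqP; field.
  exact: lt0r_neq0.
move=> zeta zr.
have [B B0 fB] := pa_bounded hf.
have T h : nrm h <= rho / 4 -> nrm (f (h + zeta) - f zeta - g zeta * h) <= 8 * (B + 1) / rho ^+ 2 * nrm h ^+ 2.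
  move=> hr; apply: (@ler_eps_inv _ _ (1 + 1 + 2 * (2 / rho) * nrm h)) => j.
  have pB z : nrm z <= rho -> nrm (p j).[z] <= B + 1.
    move=> z1; rewrite -(subrK (f z) (p j).[z]) addrC (le_trans (nrmD _ _))// lerD ?fB//.
    by rewrite nrm_distC (le_trans (hp j _ z1))// invf_le1// ler1n.
  have := deriv_taylor r0 pB (ltW zr) hr.
  have -> : f (h + zeta) - f zeta - g zeta * h = ((p j).[h + zeta] - (p j).[zeta] - (p j)^`().[zeta] * h)
    + ((f (h + zeta) - (p j).[h + zeta]) + ((p j).[zeta] - f zeta) + ((p j)^`().[zeta] - g zeta) * h).
    by ring.
  move=> h1; rewrite (le_trans (nrmD _ _))// lerD//.
  have r4 : rho / 4 <= rho / 2 by lra.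
  have z1 : nrm zeta <= rho by lra.
  have -> : (1 + 1 + 2 * (2 / rho) * nrm h) / j.+1%:R = j.+1%:R^-1 + j.+1%:R^-1 + 2 * (2 / rho) / j.+1%:R * nrm h :> R.
    by ring.
  rewrite (le_trans (nrmD _ _))// lerD//.
    rewrite (le_trans (nrmD _ _))// lerD//.
      by apply: hp; rewrite (le_trans (nrmD _ _))//; lra.
    by rewrite nrm_distC hp.
  rewrite nrmM ler_wpM2r ?nrm_ge0// nrm_distC; apply: hg; exact: ltW.
apply/cvg_nrmP => e e0.
set K := 8 * (B + 1) / rho ^+ 2 in T.
have K0 : 0 < K by rewrite !(divr_gt0, mulr_gt0, exprn_gt0, addr_gt0).
clearbody K.
have d0 : 0 < Num.min (rho / 4) (e / K) by rewrite lt_min !divr_gt0.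
rewrite near_withinE; have := nbhs_nrm (0 : C) d0; apply: filterS => h; rewrite subr0 lt_min => /andP[h1 h2] hn0.
rewrite /GRing.scale /=.
have -> : g zeta - h^-1 * (f (h + zeta) - f zeta) = - (h^-1 * (f (h + zeta) - f zeta - g zeta * h)).
  by field.
have hp0 : 0 < nrm h.
  by rewrite lt_neqAle nrm_ge0 andbT eq_sym; apply: contra hn0 => /eqP/nrm_eq0 ->.
rewrite nrmN nrmM nrmV ler_pdivrMl//.
rewrite (le_trans (T _ (ltW h1)))// expr2 mulrA [leRHS]mulrC ler_wpM2r ?nrm_ge0//.
by rewrite mulrC -ler_pdivlMr// ltW.
Qed.
End PolyApproxDeriv.

Section TaylorCoef.
Variable R : realType.
Local Notation C := (Cplx R).
Implicit Types (f g : C -> C) (rho B e : R) (p : {poly C}).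

(** [tc1] and [tc2] are the first two Taylor coefficients at 0. *)
Definition tc1 f : C := derive1 f 0.
Definition tc2 f : C := derive1n 2 f 0 / 2%:R.

(** The Taylor coefficients of [f] are determined, with an explicit error, by those of any polynomial close to [f] on the disc.  The linearity and continuity of [tc1] and [tc2] follow from it. *)
Lemma pa_tc rho f : 0 < rho -> polyapprox rho f ->
  forall p e, (forall z, nrm z <= rho -> nrm (f z - p.[z]) <= e) ->
  nrm (tc1 f - p`_1) <= 2 * e / rho /\ nrm (tc2 f - p`_2) <= 4 * e / rho ^+ 2.
Proof.
move=> r0 hf p e fp.
have r2 : 0 < rho / 2 by rewrite divr_gt0.
have [g [pg dg gp]] := pa_deriv r0 hf.
have [g2 [_ dg2 g2p]] := pa_deriv r2 pg.
have d1 zeta : nrm zeta < rho / 2 -> derive1 f zeta = g zeta.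
  by move=> /dg; apply: cvg_lim; exact: norm_hausdorff.
have p1 : p`_1 = p^`().[0] by rewrite horner_coef0 coef_deriv mulr1n.
have p2 : p`_2 = p^`()^`().[0] / 2%:R.
  by rewrite horner_coef0 !coef_deriv mulr1n -(mulr_natr p`_2 2) mulfK// pnatr_eq0.
split; first by rewrite p1 /tc1 d1 ?nrm0//; apply: gp => //; rewrite nrm0 ltW.
rewrite /tc2 p2 -mulrBl nrmM nrmV nrm_nat.
suff -> : derive1n 2 f 0 = g2 0.
  have h0 : nrm (0 : C) <= rho / 2 / 2 by rewrite nrm0 !divr_ge0// ltW.
  have := g2p _ _ (gp _ _ fp) _ h0.
  rewrite -(ler_pM2r (_ : 0 < 2^-1 :> R)) ?invr_gt0// => /le_trans; apply.
  rewrite le_eqVlt; apply/orP; left; apply/eqP; field; exact: lt0r_neq0.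
apply: cvg_lim; first exact: norm_hausdorff.
have := dg2 0; rewrite nrm0 divr_gt0// => /(_ isT); apply: cvg_trans.
apply: near_eq_cvg; rewrite near_withinE.
have := nbhs_nrm (0 : C) r2; apply: filterS => h; rewrite subr0 => hr _.
by rewrite /= addr0 !d1 ?nrm0.
Qed.

Lemma nrm_eps_eq (x y : C) (K : R) : (forall j : nat, nrm (x - y) <= K / j.+1%:R) -> x = y.
Proof.
move=> h; apply/eqP; rewrite -subr_eq0; apply/eqP/nrm_eq0/le_anti; rewrite nrm_ge0 andbT.
by apply: (@ler_eps_inv _ _ _ K) => j; rewrite add0r.
Qed.

Lemma tc_lin rho f g c : 0 < rho -> polyapprox rho f -> polyapprox rho g ->
  tc1 (fun z => f z + c * g z) = tc1 f + c * tc1 g /\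
  tc2 (fun z => f z + c * g z) = tc2 f + c * tc2 g.
Proof.
move=> r0 hf hg.
have hfg : polyapprox rho (fun z => f z + c * g z) by apply: pa_add => //; exact: pa_scale.
pose K := (1 + nrm c).
have K0 : 0 <= K by rewrite addr_ge0 ?nrm_ge0.
have key j : nrm (tc1 (fun z => f z + c * g z) - (tc1 f + c * tc1 g)) <= (2 * (2 * K / rho)) / j.+1%:R
   /\ nrm (tc2 (fun z => f z + c * g z) - (tc2 f + c * tc2 g)) <= (2 * (4 * K / rho ^+ 2)) / j.+1%:R.
  have e0 : 0 < (j.+1%:R^-1 : R) by rewrite invr_gt0.
  have [p hp] := hf _ e0; have [q hq] := hg _ e0.
  have hpq z : nrm z <= rho -> nrm (f z + c * g z - (p + c%:P * q).[z]) <= K / j.+1%:R.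
    move=> zr; rewrite hornerD hornerM hornerC opprD addrACA -mulrBr (le_trans (nrmD _ _))//.
    by rewrite /K mulrDl mul1r lerD ?hp// nrmM ler_wpM2l ?nrm_ge0// hq.
  have [a1 a2] := pa_tc r0 hfg hpq.
  have [b1 b2] := pa_tc r0 hf hp.
  have [c1 c2] := pa_tc r0 hg hq.
  have tri (x y z u v : C) (A A' B' : R) : nrm (x - (u + c * v)) <= A -> nrm (y - u) <= A' ->
     nrm (z - v) <= B' -> nrm (x - (y + c * z)) <= A + (A' + nrm c * B').
    move=> h1 h2 h3.
    have -> : x - (y + c * z) = (x - (u + c * v)) - ((y - u) + c * (z - v)) by ring.
    rewrite (le_trans (nrmB _ _))// lerD// (le_trans (nrmD _ _))// lerD//.
    by rewrite nrmM ler_wpM2l// nrm_ge0.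
  rewrite coefD coefCM in a1; rewrite coefD coefCM in a2.
  split.
    apply: (le_trans (tri _ _ _ _ _ _ _ _ a1 b1 c1)).
    by rewrite le_eqVlt /K; apply/orP; left; apply/eqP; ring.
  apply: (le_trans (tri _ _ _ _ _ _ _ _ a2 b2 c2)).
  by rewrite le_eqVlt /K; apply/orP; left; apply/eqP; ring.
by split; apply: nrm_eps_eq => j; have [h1 h2] := key j; [exact: h1|exact: h2].
Qed.

Lemma tc_cst c : tc1 (fun=> c) = 0 /\ tc2 (fun=> c) = 0.
Proof.
have [h1 h2] := pa_tc ltr01 (pa_cst (1:R) c) (p := c%:P) (e := 0)
  ltac:(by move=> z _; rewrite hornerC subrr nrm0).
move: h1 h2; rewrite !coefC /= !subr0 !mulr0 !mul0r => h1 h2.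
by split; apply: nrm_eq0; apply/le_anti; rewrite nrm_ge0 ?h1 ?h2.
Qed.

Lemma tc_scale rho c g : 0 < rho -> polyapprox rho g ->
  tc1 (fun z => c * g z) = c * tc1 g /\ tc2 (fun z => c * g z) = c * tc2 g.
Proof.
move=> r0 hg; have [h1 h2] := tc_lin c r0 (pa_cst rho 0) hg.
have [c1 c2] := tc_cst 0.
by move: h1 h2; rewrite c1 c2 !add0r; under eq_fun do rewrite add0r.
Qed.

Lemma tc_sub rho f g : 0 < rho -> polyapprox rho f -> polyapprox rho g ->
  tc1 (fun z => f z - g z) = tc1 f - tc1 g /\ tc2 (fun z => f z - g z) = tc2 f - tc2 g.
Proof.
move=> r0 hf hg; have := tc_lin (-1) r0 hf hg.
by under eq_fun do rewrite mulN1r; rewrite !mulN1r.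
Qed.

Lemma tc_sum (I : Type) (s : seq I) rho (f : I -> C -> C) : 0 < rho ->
  (forall i, polyapprox rho (f i)) ->
  tc1 (fun z => \sum_(i <- s) f i z) = \sum_(i <- s) tc1 (f i) /\
  tc2 (fun z => \sum_(i <- s) f i z) = \sum_(i <- s) tc2 (f i).
Proof.
move=> r0 hf; elim: s => [|i s [IH1 IH2]].
  under eq_fun do rewrite big_nil.
  by rewrite !big_nil; exact: tc_cst.
have := tc_lin 1 r0 (hf i) (pa_sum s hf).
under eq_fun do rewrite mul1r -(big_cons 0 +%R i s xpredT (f ^~ _)).
by rewrite !big_cons !mul1r IH1 IH2.
Qed.

Lemma tc_bound rho f B : 0 < rho -> polyapprox rho f -> (forall z, nrm z <= rho -> nrm (f z) <= B) ->
  nrm (tc1 f) <= 2 * B / rho /\ nrm (tc2 f) <= 4 * B / rho ^+ 2.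
Proof.
move=> r0 hf fB.
have := pa_tc r0 hf (p := 0) (e := B) ltac:(by move=> z zr; rewrite horner0 subr0 fB).
by rewrite !coef0 !subr0.
Qed.

Lemma tc_dist rho f g e : 0 < rho -> polyapprox rho f -> polyapprox rho g ->
  (forall z, nrm z <= rho -> nrm (f z - g z) <= e) ->
  nrm (tc1 f - tc1 g) <= 2 * e / rho /\ nrm (tc2 f - tc2 g) <= 4 * e / rho ^+ 2.
Proof.
move=> r0 hf hg fg; have [<- <-] := tc_sub r0 hf hg.
by apply: tc_bound => //; exact: pa_sub.
Qed.

(** The bound [poly_taylor] is uniform in the degree, hence passes to uniform limits. *)
Lemma pa_taylor rho f B z : 0 < rho -> polyapprox rho f -> (forall z, nrm z <= rho -> nrm (f z) <= B) ->
  nrm z <= rho / 2 ->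
  nrm (f z - f 0 - tc1 f * z - tc2 f * z ^+ 2) <= 2 * B * (nrm z / rho) ^+ 3.
Proof.
move=> r0 hf fB zr.
set x := nrm z / rho.
apply: (@ler_eps_inv _ _ _ (2 * x ^+ 3 + 2 + 2 / rho * nrm z + 4 / rho ^+ 2 * nrm z ^+ 2)) => j.
have e0 : 0 < (j.+1%:R^-1 : R) by rewrite invr_gt0.
have [p hp] := hf _ e0.
have [a1 a2] := pa_tc r0 hf hp.
have pB w : nrm w <= rho -> nrm p.[w] <= B + j.+1%:R^-1.
  move=> wr; rewrite -(subrK (f w) p.[w]) addrC (le_trans (nrmD _ _))// lerD ?fB//.
  by rewrite nrm_distC hp.
have := poly_taylor 3 r0 pB zr.
rewrite !big_ord_recl big_ord0 /= /bump /= !expr0 !expr1 mulr1 addr0 -horner_coef0 -/x => T.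
have zr' : nrm z <= rho by rewrite (le_trans zr)// ler_pdivrMr// mulr_natr mulr2n lerDl ltW.
have h0 : nrm (0 : C) <= rho by rewrite nrm0 ltW.
have -> : f z - f 0 - tc1 f * z - tc2 f * z ^+ 2 =
  (p.[z] - (p.[0] + (p`_1 * z + p`_2 * z ^+ 2))) +
  ((f z - p.[z]) + (p.[0] - f 0) + (p`_1 - tc1 f) * z + (p`_2 - tc2 f) * z ^+ 2) by ring.
rewrite (le_trans (nrmD _ _))//.
have -> : 2 * B * x ^+ 3 + (2 * x ^+ 3 + 2 + 2 / rho * nrm z + 4 / rho ^+ 2 * nrm z ^+ 2) / j.+1%:R =
  2 * (B + j.+1%:R^-1) * x ^+ 3 + (j.+1%:R^-1 + j.+1%:R^-1 + 2 * j.+1%:R^-1 / rho * nrm z + 4 * j.+1%:R^-1 / rho ^+ 2 * nrm z ^+ 2).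
  by ring.
rewrite lerD// (le_trans (nrmD _ _))// lerD//; last first.
  by rewrite nrmM nrmX ler_wpM2r ?exprn_ge0 ?nrm_ge0// nrm_distC.
rewrite (le_trans (nrmD _ _))// lerD//; last first.
  by rewrite nrmM ler_wpM2r ?nrm_ge0// nrm_distC.
by rewrite (le_trans (nrmD _ _))// lerD ?hp// nrm_distC hp.
Qed.

(** Cauchy's estimate for the Taylor coefficients in terms of an average over the circle, which, unlike a supremum, can be exchanged with an expectation. *)
Lemma tc_ravg rho f e : 0 < rho -> 0 < e -> polyapprox rho f -> exists M0, forall M, (M0 <= M)%N ->
  nrm (tc1 f) <= (ravg M (fun u => nrm (f (rho%:C * cis u))) + e) / rho /\
  nrm (tc2 f) <= (ravg M (fun u => nrm (f (rho%:C * cis u))) + e) / rho ^+ 2.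
Proof.
move=> r0 e0 hf.
have e5 : 0 < e / 5 by rewrite divr_gt0.
have [p hp] := hf _ e5.
exists (maxn 2 (size p)) => M hM.
have [a1 a2] := pa_tc r0 hf hp.
have avg k : (k <= 2)%N -> nrm p`_k * rho ^+ k <= ravg M (fun u => nrm (f (rho%:C * cis u))) + e / 5.
  move=> k2.
  apply: (le_trans (coef_le_ravg (M := M) (ltW r0) _ _)); [lia..|].
  rewrite -[e / 5](ravg_cst M) ravgD.
  apply: le_ravg => u _.
  rewrite -{1}(subrK (f (rho%:C * cis u)) p.[_]) addrC (le_trans (nrmD _ _))// lerD//.
  by rewrite nrm_distC hp// nrmM nrm_cis mulr1 nrm_real ger0_norm// ltW.
have b1 := avg 1%N isT; have b2 := avg 2%N isT.
rewrite !ler_pdivlMr ?exprn_gt0//.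
move: b1 b2; set A := ravg _ _; rewrite expr1 => b1 b2.
split.
  have : nrm (tc1 f) <= nrm p`_1 + 2 * (e / 5) / rho.
    by rewrite -(subrK p`_1 (tc1 f)) addrC (le_trans (nrmD _ _))// lerD2l.
  rewrite -(ler_pM2r r0) mulrDl mulfVK ?lt0r_neq0// => h; lra.
have : nrm (tc2 f) <= nrm p`_2 + 4 * (e / 5) / rho ^+ 2.
  by rewrite -(subrK p`_2 (tc2 f)) addrC (le_trans (nrmD _ _))// lerD2l.
rewrite -(ler_pM2r (exprn_gt0 2 r0)) mulrDl mulfVK ?expf_neq0 ?lt0r_neq0// => h; lra.
Qed.
End TaylorCoef.

(** * Trees and their generating polynomials *)

Section Trees.

(** Splitting [v] replaces it by its two children; the removed term is moved to the left since [V] has no subtraction. *)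
Lemma sum_split (V : nmodType) (h : seq bool -> V) t v : v \in external t ->
  \sum_(u <- external (split_at t v)) h u + h v =
  \sum_(u <- external t) h u + (h (rcons v false) + h (rcons v true)).
Proof.
elim: t v h => [|l IHl r IHr] v h /=.
  rewrite inE => /eqP -> /=.
  by rewrite !big_cons !big_nil !addr0 [RHS]addrC.
rewrite mem_cat => /orP[] /mapP[w win ->] /=; rewrite !big_cat /= !big_map.
  by rewrite addrAC (IHl w (fun u => h (false :: u)) win) addrAC.
by rewrite -addrA (IHr w (fun u => h (true :: u)) win) addrA.
Qed.

Lemma size_external_gt0 t : (0 < size (external t))%N.
Proof. by elim: t => //= l IH r _; rewrite size_cat size_map addn_gt0 IH. Qed.

Lemma size_split t v : v \in external t ->
  size (external (split_at t v)) = (size (external t)).+1.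
Proof.
move=> vt; have := sum_split (fun=> 1 : int) vt.
by rewrite !big_const_seq !count_predT !iter_addr_0 !natz; lia.
Qed.

Lemma uniq_external t : uniq (external t).
Proof.
elim: t => //= l IHl r IHr; rewrite cat_uniq !map_inj_uniq ?IHl ?IHr ?andbT /=; try by move=> ? ? [].
by apply/hasPn => _ /mapP[v _ ->]; apply/mapP => -[].
Qed.

Lemma split_at_inj t : {in external t &, injective (split_at t)}.
Proof.
elim: t => [|l IHl r IHr] u v /=; first by rewrite !inE => /eqP -> /eqP ->.
rewrite !mem_cat => /orP[] /mapP[u' hu ->] /orP[] /mapP[v' hv ->] /= [].
- by move=> /(IHl _ _ hu hv) ->.
- move=> e; have := size_split hu; rewrite e; lia.
- move=> e; have := size_split hv; rewrite -e; lia.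
- by move=> /(IHr _ _ hu hv) ->.
Qed.

Lemma size_external_depth t v : v \in external t -> (size v < size (external t))%N.
Proof.
elim: t v => [|l IHl r IHr] v /=; first by rewrite inE => /eqP ->.
have l0 := size_external_gt0 l; have r0 := size_external_gt0 r.
rewrite mem_cat size_cat !size_map => /orP[] /mapP[w hw ->] /=.
  by rewrite -addn1 leq_add// IHl.
by rewrite -add1n leq_add// IHr.
Qed.

Definition genF (K : pzSemiRingType) (t : tree) (z : K) : K :=
  \sum_(v <- external t) z ^+ size v.

(** The identity behind everything: [2 z - 1] is the change caused by a leaf at depth 0. *)
Lemma genF_split (K : comPzRingType) t v (z : K) : v \in external t ->
  genF (split_at t v) z = genF t z + (2 * z - 1) * z ^+ size v.
Proof.
move=> vt; have := sum_split (fun u => z ^+ size u) vt.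
rewrite /genF !size_rcons !exprS => h.
apply: (addIr (z ^+ size v)); rewrite h; ring.
Qed.

Lemma genF1 (K : pzSemiRingType) t : genF t (1 : K) = (size (external t))%:R.
Proof.
rewrite /genF; under eq_bigr do rewrite expr1n.
by rewrite big_const_seq count_predT iter_addr_0.
Qed.

End Trees.

(** * Expectations along the evolution *)

Section Expectation.
Variable K : numFieldType.
Implicit Types (f g : tree -> K).

(** One step of the Markov chain: the mean of [f] after splitting a uniform external node. *)
Definition Avg f (t : tree) : K :=
  (size (external t))%:R^-1 * \sum_(v <- external t) f (split_at t v).

(** The expectation of [f] at the tree after [n] steps, computed by iterating [Avg]; [law_tree] identifies it with an integral over the probability space.  It makes sense in any field, in particular for complex-valued [f]. *)
Fixpoint EE (n : nat) f : K := if n is m.+1 then EE m (Avg f) else f External.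

Definition reach n t := size (external t) = n.+1.

Lemma eq_EE n f g : (forall t, reach n t -> f t = g t) -> EE n f = EE n g.
Proof.
elim: n f g => [|n IH] f g fg /=; first exact: fg.
apply: IH => t ht; rewrite /Avg; congr (_ * _); apply: eq_big_seq => v vt.
by apply: fg; rewrite /reach size_split// ht.
Qed.

Lemma le_EE n f g : (forall t, reach n t -> f t <= g t) -> EE n f <= EE n g.
Proof.
elim: n f g => [|n IH] f g fg /=; first exact: fg.
apply: IH => t ht; rewrite /Avg ler_wpM2l ?invr_ge0//.
rewrite big_seq [leRHS]big_seq; apply: ler_sum => v vt.
by apply: fg; rewrite /reach size_split// ht.
Qed.

Lemma EE_lin n f g c : EE n (fun t => f t + c * g t) = EE n f + c * EE n g.
Proof.
elim: n f g => [//|n IH] f g /=.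
rewrite -IH; apply: eq_EE => t _; rewrite /Avg big_split /= -mulr_sumr; ring.
Qed.

Lemma EE_cst n c : EE n (fun=> c) = c.
Proof.
elim: n => [//|n IH] /=; rewrite -[RHS]IH; apply: eq_EE => t _.
rewrite /Avg big_const_seq count_predT iter_addr_0 -(mulr_natl c) mulKf//.
by rewrite pnatr_eq0 -lt0n size_external_gt0.
Qed.

Lemma EE_scale n f c : EE n (fun t => c * f t) = c * EE n f.
Proof.
have := EE_lin n (fun=> 0) f c; rewrite EE_cst add0r => <-.
by apply: eq_EE => t _; rewrite add0r.
Qed.

Lemma EE_add n f g : EE n (fun t => f t + g t) = EE n f + EE n g.
Proof.
have := EE_lin n f g 1; rewrite mul1r => <-.
by apply: eq_EE => t _; rewrite mul1r.
Qed.

Lemma EE_sub n f g : EE n (fun t => f t - g t) = EE n f - EE n g.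
Proof.
have := EE_lin n f g (-1); rewrite mulN1r => <-.
by apply: eq_EE => t _; rewrite mulN1r.
Qed.

Lemma EE_sum n (I : Type) (s : seq I) (f : I -> tree -> K) :
  EE n (fun t => \sum_(i <- s) f i t) = \sum_(i <- s) EE n (f i).
Proof.
elim: s => [|i s IH].
  by under eq_EE do rewrite big_nil; rewrite big_nil EE_cst.
rewrite big_cons -IH -EE_add; apply: eq_EE => t _; exact: big_cons.
Qed.

Definition Qprod n (s : K) : K := \prod_(j < n) (1 + s / j.+1%:R).

Lemma QprodS n s : Qprod n.+1 s = Qprod n s * (1 + s / n.+1%:R).
Proof. by rewrite /Qprod big_ord_recr. Qed.

(** Averaging [genF_split] over [v] multiplies the mean by [1 + (2 z - 1) / (n + 1)]. *)
Lemma EE_genF n (z : K) : EE n (fun t => genF t z) = Qprod n (2 * z - 1).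
Proof.
elim: n => [|n IH]; first by rewrite /= /genF big_seq1 expr0 /Qprod big_ord0.
rewrite QprodS -IH /= mulrC -EE_scale; apply: eq_EE => t ht.
rewrite /Avg ht big_seq.
under eq_bigr => v vt do rewrite genF_split//.
rewrite -big_seq big_split /= -mulr_sumr -/(genF t z).
rewrite big_const_seq count_predT iter_addr_0 ht -(mulr_natl (genF _ _)).
have h : (n.+1%:R : K) != 0 by rewrite pnatr_eq0.
by field; rewrite addrC natr1.
Qed.

End Expectation.

(** * Second moments of the generating polynomial *)

Section SecondMoment.
Variable R : realType.
Local Notation C := (Cplx R).
Implicit Types (z : C) (s x : R).

Lemma EE_ge0 n (f : tree -> R) : (forall t, reach n t -> 0 <= f t) -> 0 <= EE n f.
Proof. by move=> h; rewrite -(EE_cst n 0); exact: le_EE. Qed.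

Lemma Re_sum (I : Type) (s : seq I) (f : I -> C) :
  complex.Re (\sum_(i <- s) f i) = \sum_(i <- s) complex.Re (f i).
Proof. by elim/big_ind2: _ => // x1 x2 y1 y2 <- <-; rewrite ReD. Qed.
Lemma Im_sum (I : Type) (s : seq I) (f : I -> C) :
  complex.Im (\sum_(i <- s) f i) = \sum_(i <- s) complex.Im (f i).
Proof. by elim/big_ind2: _ => // x1 x2 y1 y2 <- <-; rewrite ImD. Qed.

Lemma natC n : (n%:R : C) = (n%:R : R)%:C. Proof. by rewrite rmorph_nat. Qed.

Lemma EE_Re n (f : tree -> C) : complex.Re (EE n f) = EE n (fun t => complex.Re (f t)).
Proof.
elim: n f => [//|n IH] f /=; rewrite IH; apply: eq_EE => t _.
by rewrite /Avg natC -fmorphV ReMr Re_sum.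
Qed.

Lemma EE_nrm n (f : tree -> C) : nrm (EE n f) <= EE n (fun t => nrm (f t)).
Proof.
elim: n f => [//|n IH] f /=; rewrite (le_trans (IH _))//; apply: le_EE => t _.
by rewrite /Avg nrmM nrmV nrm_nat ler_wpM2l ?invr_ge0// nrm_sum.
Qed.

(** Jensen's inequality, from the nonnegativity of the variance. *)
Lemma EE_sqr_le n (f : tree -> R) : (EE n f) ^+ 2 <= EE n (fun t => f t ^+ 2).
Proof.
set m := EE n f.
rewrite -subr_ge0.
have -> : EE n (fun t => f t ^+ 2) - m ^+ 2 = EE n (fun t => (f t - m) ^+ 2).
  have -> : EE n (fun t => (f t - m) ^+ 2) = EE n (fun t => f t ^+ 2 + (- 2 * m) * f t) + m ^+ 2.
    by rewrite -[X in _ = _ + X](EE_cst n (m ^+ 2)) -EE_add; apply: eq_EE => t _; ring.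
  by rewrite EE_lin -/m; ring.
by apply: EE_ge0 => t _; exact: sqr_ge0.
Qed.

Lemma nrm_sqrD (a b : C) : nrm (a + b) ^+ 2 = nrm a ^+ 2 +
  2 * (complex.Re a * complex.Re b + complex.Im a * complex.Im b) + nrm b ^+ 2.
Proof. by rewrite !nrm_sqr ReD ImD; ring. Qed.

Definition m2 n z : R := EE n (fun t => nrm (genF t z) ^+ 2).

Lemma m2_ge0 n z : 0 <= m2 n z. Proof. by apply: EE_ge0 => t _; exact: sqr_ge0. Qed.

(** Expand |F + (2 z - 1) z^|v||^2: averaging over [v] turns the cross term into a multiple of |F|^2, and the square into the first moment of F at |z|^2, which is explicit. *)
Lemma m2S n z : m2 n.+1 z = (1 + (4 * complex.Re z - 2) / n.+1%:R) * m2 n z +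
   nrm (2 * z - 1) ^+ 2 / n.+1%:R * Qprod n (2 * nrm z ^+ 2 - 1).
Proof.
rewrite -EE_genF /m2 /= -!EE_scale -EE_add; apply: eq_EE => t ht.
rewrite /Avg ht big_seq.
under eq_bigr => v vt do rewrite genF_split// nrm_sqrD nrmM exprMn nrmX -exprM mulnC exprM.
rewrite -big_seq !big_split /= -!mulr_sumr -/(genF t (nrm z ^+ 2)) big_split /= -!mulr_sumr -Re_sum -Im_sum.
rewrite -mulr_sumr -/(genF t z).
rewrite big_const_seq count_predT iter_addr_0 ht -(mulr_natl (nrm _)).
have h : (n.+1%:R : R) != 0 by rewrite pnatr_eq0.
have -> : complex.Re (genF t z) * complex.Re ((2 * z - 1) * genF t z) +
  complex.Im (genF t z) * complex.Im ((2 * z - 1) * genF t z) = (2 * complex.Re z - 1) * nrm (genF t z) ^+ 2.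
  rewrite nrm_sqr ReM ImM ReB ImB !natC ReMr.
  case: (genF t z) => a b; case: z => u v /=; ring.
by field; rewrite addrC natr1.
Qed.

Lemma m2_zero z : m2 0 z = 1.
Proof. by rewrite /m2 /= /genF big_seq1 expr0 nrm1 expr1n. Qed.

Lemma Qprod0 s : Qprod 0 s = 1. Proof. by rewrite /Qprod big_ord0. Qed.

Lemma Qprod_ge0 n s : -1 <= s -> 0 <= Qprod n s.
Proof.
move=> s1; apply: prodr_ge0 => i _.
by rewrite -(@pmulr_lge0 _ i.+1%:R)// mulrDl mul1r mulfVK ?pnatr_eq0// -natr1; have := ler0n R i; lra.
Qed.

Lemma le_Qprod n s x : -1 <= s -> s <= x -> Qprod n s <= Qprod n x.
Proof.
move=> s1 sx; apply: ler_prod => i _.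
rewrite lerD2l ler_wpM2r ?invr_ge0// andbT.
by rewrite -(@pmulr_lge0 _ i.+1%:R)// mulrDl mul1r mulfVK ?pnatr_eq0// -natr1; have := ler0n R i; lra.
Qed.

(** The recursion is driven by the larger of its two exponents; the gap [g] absorbs the inhomogeneous term and avoids a logarithm when they are close.  It is used away from 1, where [s] is only slightly smaller than 2. *)
Lemma m2_crude n z s g : 0 < g -> g <= s -> 4 * complex.Re z - 2 + g <= s -> 2 * nrm z ^+ 2 - 1 <= s ->
  m2 n z <= (1 + nrm (2 * z - 1) ^+ 2 / g) * Qprod n s.
Proof.
move=> g0 gs h1 h2.
set b := nrm (2 * z - 1) ^+ 2; have b0 : 0 <= b by exact: sqr_ge0.
have k0 : 0 <= b / g by rewrite divr_ge0// ltW.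
have t1 : -1 <= 2 * nrm z ^+ 2 - 1 by have := sqr_ge0 (nrm z); lra.
elim: n => [|n IH]; first by rewrite m2_zero Qprod0 mulr1 lerDl.
have hn : 0 < (n.+1%:R : R) by rewrite ltr0n.
have Q0 : 0 <= Qprod n s by apply: Qprod_ge0; lra.
rewrite m2S -/b QprodS.
apply: (@le_trans _ _ ((1 + (s - g) / n.+1%:R) * ((1 + b / g) * Qprod n s) + b / n.+1%:R * Qprod n s)).
  rewrite lerD//.
    rewrite (@le_trans _ _ ((1 + (s - g) / n.+1%:R) * m2 n z))//.
      by rewrite ler_wpM2r ?m2_ge0// lerD2l ler_wpM2r ?invr_ge0 ?ler0n//; lra.
    rewrite ler_wpM2l// addr_ge0// divr_ge0 ?ler0n//; lra.
  by rewrite ler_wpM2l ?divr_ge0 ?ler0n// le_Qprod.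
rewrite -subr_ge0.
have -> : (1 + b / g) * (Qprod n s * (1 + s / n.+1%:R)) -
  ((1 + (s - g) / n.+1%:R) * ((1 + b / g) * Qprod n s) + b / n.+1%:R * Qprod n s) = g * Qprod n s / n.+1%:R.
  by field; rewrite addrC natr1 !lt0r_neq0.
by rewrite divr_ge0 ?mulr_ge0 ?ler0n // ltW.
Qed.

(** Near 1 the exponent of the square of the mean wins, [s - t >= 1/2], so E |F|^2 is of the order of |E F|^2: this is the L^2 boundedness of the martingale. *)
Lemma m2_near n z : nrm (z - 1) <= 1 / 2 ->
  m2 n z <= 9 * Qprod n (4 * complex.Re z - 2).
Proof.
move=> z1.
set s := 4 * complex.Re z - 2; set t := 2 * nrm z ^+ 2 - 1.
set b := nrm (2 * z - 1) ^+ 2; have b0 : 0 <= b by exact: sqr_ge0.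
have z12 : nrm (z - 1) ^+ 2 <= 1 / 4.
  by have := nrm_ge0 (z - 1); nra.
have st : 1 / 2 <= s - t.
  have -> : s - t = 1 - 2 * nrm (z - 1) ^+ 2 by rewrite /s /t !nrm_sqr ReB ImB /=; ring.
  lra.
have t1 : -1 <= t by rewrite /t; have := sqr_ge0 (nrm z); lra.
have b4 : b <= 4.
  have : nrm (2 * z - 1) <= 2.
    have -> : 2 * z - 1 = 2 * (z - 1) + 1 by ring.
    by rewrite (le_trans (nrmD _ _))// nrmM nrm1 (nrm_nat R 2); lra.
  by rewrite /b; have := nrm_ge0 (2 * z - 1); nra.
(* The recursion is solved exactly: a combination of its homogeneous solution and of the driving product. *)
have key : (s - t) * m2 n z = (s - t + b) * Qprod n s - b * Qprod n t.
  elim: n => [|n IH]; first by rewrite m2_zero !Qprod0; ring.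
  rewrite m2S -/b -/s -/t !QprodS mulrDr mulrCA IH.
  have h : (n.+1%:R : R) != 0 by rewrite pnatr_eq0.
  by field; rewrite addrC natr1.
have st0 : 0 < s - t by lra.
have Qt : 0 <= Qprod n t by exact: Qprod_ge0.
have Qs : 0 <= Qprod n s by apply: Qprod_ge0; lra.
rewrite -(ler_pM2l st0) key; nra.
Qed.

(** The power n^s, total in [n]. *)
Definition pw (n : nat) (s : R) : R := expR (s * ln n%:R).

(** The product is at most exp(s H_n) with the harmonic number H_n at most 1 + log n. *)
Lemma Qprod_le n s : 0 <= s -> (0 < n)%N -> Qprod n s <= expR s * pw n s.
Proof.
move=> s0 n0; rewrite /pw -expRD -[X in expR (X + _)]mulr1 -mulrDr.
elim: n n0 => [//|n IH] _; rewrite QprodS.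
have h : 0 < (n.+1%:R : R) by rewrite ltr0n.
have [->|n0] := posnP n.
  rewrite Qprod0 mul1r ln1 addr0 !divr1 mulr1; exact: expR_ge1Dx.
have nR : 0 < (n%:R : R) by rewrite ltr0n.
have step : n.+1%:R^-1 <= ln (n.+1%:R : R) - ln n%:R.
  rewrite -lerN2 opprB -ln_div ?posrE//.
  rewrite -ler_expR lnK ?posrE ?divr_gt0//.
  have -> : (n%:R : R) / n.+1%:R = 1 + - n.+1%:R^-1.
    by rewrite -natr1; field; rewrite natr1 lt0r_neq0.
  exact: expR_ge1Dx.
apply: (@le_trans _ _ (expR (s * (1 + ln n%:R)) * expR (s / n.+1%:R))).
  apply: ler_pM; rewrite ?Qprod_ge0 ?IH ?expR_ge1Dx//; first lra.
  by rewrite addr_ge0// divr_ge0// ltW.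
by rewrite -expRD ler_expR -mulrDr ler_wpM2l// -addrA lerD2l -lerBrDl.
Qed.
End SecondMoment.

(** * The law of the process *)

Section Law.
Context {d : measure_display} {Omega : measurableType d} {R : realType}.
Variable P : probability Omega R.
Variable Tr : nat -> Omega -> tree.
Hypothesis hTr : is_BST_process P Tr.

(** Through the list of its leaves a tree embeds into a countable type; a history of the process is then coded by a natural number. *)
Lemma external_inj : injective external.
Proof.
elim=> [|l IHl r IHr] [|l' r'] //=.
- move=> /(congr1 size); rewrite size_cat !size_map /=.
  have := size_external_gt0 l'; have := size_external_gt0 r'; lia.
- move=> /(congr1 size); rewrite size_cat !size_map /=.
  have := size_external_gt0 l; have := size_external_gt0 r; lia.
move=> e.
have sub (b : bool) (a c : tree) : [seq v <- [seq false :: v | v <- external a] ++ [seq true :: v | v <- external c] | head b v == b] =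
    [seq b :: v | v <- external (if b then c else a)].
  have fl (b' : bool) (u : seq (seq bool)) : [seq v <- [seq b' :: v | v <- u] | head b v == b] =
      if b' == b then [seq b' :: v | v <- u] else [::].
    by elim: u => [|x u /= ->]; case: (b' == b).
  by rewrite filter_cat !fl; case: b {fl}; rewrite //= cats0.
have hl := congr1 (seq.filter (fun v => head false v == false)) e; rewrite !sub in hl.
have hr := congr1 (seq.filter (fun v => head true v == true)) e; rewrite !sub in hr.
congr Internal; [apply: IHl|apply: IHr].
  by apply: (inj_map _ hl) => ? ? [].
by apply: (inj_map _ hr) => ? ? [].
Qed.

Definition hcode n w : nat := pickle [seq external (Tr i w) | i <- iota 0 n.+1].

Lemma hcodeP n w w' : hcode n w = hcode n w' <-> (forall m, (m <= n)%N -> Tr m w = Tr m w').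
Proof.
split.
  move=> /(pcan_inj pickleK) e m mn; apply: external_inj.
  have := congr1 (fun s => nth [::] s m) e.
  by rewrite !(nth_map 0%N) ?size_iota// nth_iota.
move=> h; congr pickle; apply/eq_in_map => i; rewrite mem_iota add0n => /andP[_ hi].
by rewrite h.
Qed.

Definition hset n (t : nat -> tree) := [set w | forall m, (m <= n)%N -> Tr m w = t m].

Lemma measurable_hset n t : measurable (hset n t).
Proof.
rewrite (_ : hset n t = \bigcap_(m in [set m | (m <= n)%N]) [set w | Tr m w = t m]); last first.
  by apply/seteqP; split => w.
by apply: bigcap_measurable => [|m _]; [by exists 0%N|]; have [h _ _] := hTr; exact: h.
Qed.

Lemma hcode_set n w0 : [set w | hcode n w = hcode n w0] = hset n (Tr ^~ w0).
Proof. by apply/seteqP; split => w /hcodeP. Qed.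

Lemma measurable_hcode n m : measurable [set w | hcode n w = m].
Proof.
have [[w0 h]|h] := pselect (exists w, hcode n w = m).
  by rewrite -h hcode_set; exact: measurable_hset.
rewrite (_ : [set w | _] = set0) //.
by apply/seteqP; split => w //= e; apply: h; exists w.
Qed.

(** A set that depends on the first [n] steps only is a countable union of histories. *)
Lemma measurable_hist n (S : set Omega) :
  (forall w w', (forall m, (m <= n)%N -> Tr m w = Tr m w') -> S w -> S w') -> measurable S.
Proof.
move=> hS.
rewrite (_ : S = \bigcup_(m in [set m | exists2 w, S w & hcode n w = m]) [set w | hcode n w = m]).
  by apply: bigcup_measurable => m _; exact: measurable_hcode.
apply/seteqP; split => w; first by move=> Sw; exists (hcode n w) => //; exists w.
by move=> [m [w' Sw' <-]] /= /hcodeP e; apply: (hS w') => // i hi; rewrite e.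
Qed.

Lemma measurable_fun_hist d' (T' : measurableType d') n (g : Omega -> T') :
  (forall w w', (forall m, (m <= n)%N -> Tr m w = Tr m w') -> g w = g w') -> measurable_fun setT g.
Proof.
move=> hg _ Y mY; rewrite setTI; apply: (@measurable_hist n) => w w' h /=.
by rewrite (hg _ _ h).
Qed.

Lemma measurable_fun_tree d' (T' : measurableType d') n (f : tree -> T') :
  measurable_fun setT (fun w => f (Tr n w)).
Proof. by apply: (@measurable_fun_hist _ _ n) => w w' h; rewrite h. Qed.

Local Open Scope ereal_scope.

(** On a fixed history the next tree is uniform among the splittings, by the conditional law of the process.  These events exhaust the history up to a null set, because their probabilities add up to that of the history. *)
Lemma integral_hset n (t : nat -> tree) (f : tree -> R) : (forall u, 0 <= f u)%R ->
  \int[P]_(w in hset n t) (f (Tr n.+1 w))%:E = (Avg f (t n))%:E * P (hset n t).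
Proof.
move=> f0.
pose vs := external (t n).
pose F v := hset n t `&` [set w | Tr n.+1 w = split_at (t n) v].
have mB := measurable_hset n t.
have mF v : measurable (F v) by apply: measurableI => //; have [h _ _] := hTr; exact: h.
have PF v : v \in vs -> P (F v) = P (hset n t) * ((size vs)%:R^-1)%:E.
  by move=> hv; have [_ _ h] := hTr; rewrite -(h n t v hv); congr (P _).
have tF : trivIset [set` vs] F.
  move=> u v /= hu hv [w [[_ /= h1] [_ /= h2]]].
  by apply: (split_at_inj hu hv); rewrite -h1 -h2.
pose D := \big[setU/set0]_(v <- vs) F v.
have mD : measurable D by exact: bigsetU_measurable.
have DB : D `<=` hset n t by rewrite /D -bigcup_seq => w [v _ []].
have mf (A : set Omega) : measurable_fun A ((fun w => (f (Tr n.+1 w))%:E) : Omega -> \bar R).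
  apply: (@measurable_funS _ _ _ _ setT) => //.
  by apply/measurable_EFinP; exact: measurable_fun_tree.
have PD : P D = P (hset n t).
  rewrite -[LHS]mul1e -integral_cst// ge0_integral_bigsetU//; last exact: uniq_external.
  rewrite (eq_big_seq (fun=> P (hset n t) * ((size vs)%:R^-1)%:E)); last first.
    by move=> v hv; rewrite (integral_cst P (mF v)) mul1e; exact: PF.
  have [p hp] : exists p : R, P (hset n t) = p%:E by exists (fine (P (hset n t))); rewrite fineK ?fin_num_measure.
  rewrite hp -EFinM sumEFin big_const_seq count_predT iter_addr_0; congr EFin.
  rewrite -(mulr_natr (p / _)%R) mulfVK// pnatr_eq0 -lt0n; exact: size_external_gt0.
have PN : P (hset n t `\` D) = 0.
  rewrite measureD//; last by rewrite -ge0_fin_numE// fin_num_measure.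
  rewrite (setIidr DB); apply: etrans (congr1 (fun x => P (hset n t) - x) PD) _.
  by rewrite subee//; exact: fin_num_measure.
rewrite -[X in \int[P]_(w in X) _](setUIDK (hset n t) D) (setIidr DB).
rewrite ge0_integral_setU//; [|exact: measurableD|by move=> w _; rewrite lee_fin|].
rewrite (null_set_integral _ _ PN)//; last exact: measurableD.
rewrite adde0 ge0_integral_bigsetU//; [|exact: uniq_external|by move=> w _; rewrite lee_fin].
rewrite (eq_big_seq (fun v => (f (split_at (t n) v))%:E * (P (hset n t) * ((size vs)%:R^-1)%:E))).
  have [p hp] : exists p : R, P (hset n t) = p%:E by exists (fine (P (hset n t))); rewrite fineK ?fin_num_measure.
  rewrite hp /Avg -/vs.
  under eq_bigr do rewrite -!EFinM.
  rewrite sumEFin -EFinM; congr EFin.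
  rewrite -mulr_suml; ring.
  move=> v hv; rewrite -(PF v hv) -integral_cst//; apply: eq_integral => w.
  by rewrite inE => -[_ /= ->].
by apply/disj_setPS => w [Dw [_ nDw]].
Qed.

(** Sum [integral_hset] over the countably many histories. *)
Lemma markov_step n (f : tree -> tree -> R) : (forall u u', 0 <= f u u')%R ->
  \int[P]_w (f (Tr n w) (Tr n.+1 w))%:E = \int[P]_w (Avg (f (Tr n w)) (Tr n w))%:E.
Proof.
move=> f0.
have Avg0 (g : tree -> R) u : (forall u, 0 <= g u)%R -> (0 <= Avg g u)%R.
  by move=> g0; rewrite mulr_ge0// sumr_ge0.
have cov : setT = \bigcup_k [set w | hcode n w = k].
  by apply/seteqP; split => w // _; exists (hcode n w).
have triv : trivIset setT (fun k => [set w | hcode n w = k]).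
  by move=> i j _ _ [w [/= <- <-]].
have mf : measurable_fun setT ((fun w => (f (Tr n w) (Tr n.+1 w))%:E) : Omega -> \bar R).
  apply/measurable_EFinP; apply: (@measurable_fun_hist _ _ n.+1) => w w' h.
  by rewrite !h.
have mg : measurable_fun setT ((fun w => (Avg (f (Tr n w)) (Tr n w))%:E) : Omega -> \bar R).
  apply/measurable_EFinP; apply: (@measurable_fun_hist _ _ n) => w w' h.
  by rewrite !h.
rewrite cov !ge0_integral_bigcup -?cov//; last 4 first.
- by move=> k; exact: measurable_hcode.
- by move=> w _; rewrite lee_fin Avg0.
- by move=> k; exact: measurable_hcode.
- by move=> w _; rewrite lee_fin.
apply: eq_eseriesr => k _.
have [[w0 <-]|h] := pselect (exists w, hcode n w = k); last first.
  rewrite (_ : [set w | _] = set0); first by rewrite !integral_set0.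
  by apply/seteqP; split => w //= e; apply: h; exists w.
rewrite hcode_set.
transitivity (\int[P]_(w in hset n (Tr ^~ w0)) (f (Tr n w0) (Tr n.+1 w))%:E).
  by apply: eq_integral => w; rewrite inE => /(_ n (leqnn n)) ->.
rewrite integral_hset// -integral_cst; last exact: measurable_hset.
by apply: eq_integral => w; rewrite inE => /(_ n (leqnn n)) ->.
Qed.

Lemma law_tree n (f : tree -> R) : (forall u, 0 <= f u)%R ->
  \int[P]_w (f (Tr n w))%:E = (EE n f)%:E.
Proof.
elim: n f => [|n IH] f f0.
  have [_ h _] := hTr.
  under eq_integral do rewrite h.
  rewrite /= -[RHS]mule1 -[X in _ = _ * X](probability_setT P) -integral_cst//.
rewrite (@markov_step n (fun _ => f))// IH// => u.
by rewrite mulr_ge0// sumr_ge0.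
Qed.

(** The hypothesis prescribes the probabilities of the splittings only; that nothing else happens follows by applying [markov_step] to the indicator of the complement. *)
Lemma ae_split : {ae P, forall w, forall n, exists2 v, v \in external (Tr n w) & Tr n.+1 w = split_at (Tr n w) v}.
Proof.
apply/ae_foralln => n.
pose bad (t t' : tree) := ~ exists2 v, v \in external t & t' = split_at t v.
pose f (t t' : tree) : R := (`[< bad t t' >])%:R.
have f0 t t' : (0 <= f t t')%R by [].
have h := markov_step n f0.
have A0 t : Avg (f t) t = 0%R.
  rewrite /Avg big_seq big1 ?mulr0// => v hv.
  by rewrite /f (_ : `[< _ >] = false)//; apply/asboolP => -[]; exists v.
rewrite [RHS](eq_integral (cst 0)) in h; last by move=> w _; rewrite A0.
rewrite integral0 in h.
have mf : measurable_fun setT ((fun w => (f (Tr n w) (Tr n.+1 w))%:E) : Omega -> \bar R).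
  apply/measurable_EFinP; apply: (@measurable_fun_hist _ _ n.+1) => w w' h'.
  by rewrite !h'.
have : ae_eq P setT (fun w => (f (Tr n w) (Tr n.+1 w))%:E) (cst 0).
  apply/(ae_eq_integral_abs P measurableT mf).
  by rewrite -[RHS]h; apply: eq_integral => w _; rewrite gee0_abs// lee_fin.
apply: filterS => w hw.
have e : f (Tr n w) (Tr n.+1 w) = 0%R by apply: EFin_inj; exact: (hw I).
move: e; rewrite /f; case: asboolP => // hb.
  by move=> /eqP; rewrite oner_eq0.
move=> _; apply: contrapT => hb'; apply: hb; exact: hb'.
Qed.
End Law.

(** * Limits of expectations and almost sure bounds *)

Section AlmostSure.
Context {d : measure_display} {Omega : measurableType d} {R : realType}.
Variable P : probability Omega R.
Local Open Scope ereal_scope.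

Lemma limn_einf_le (u : (\bar R)^nat) (K : \bar R) : (forall n, u n <= K) -> limn_einf u <= K.
Proof.
move=> uK; rewrite limn_einf_lim; apply: lime_le; first exact: is_cvg_einfs.
apply: nearW => n; rewrite (le_trans _ (uK n))//.
by apply: ereal_inf_lbound; exists n => /=.
Qed.

Lemma fatou_sqr (X : nat -> Omega -> R) (Y : Omega -> R) (K : R) :
  (forall n, measurable_fun setT (X n)) -> measurable_fun setT Y ->
  (forall n, \int[P]_w (X n w ^+ 2)%:E <= K%:E) ->
  {ae P, forall w, X n w @[n --> \oo] --> Y w} ->
  \int[P]_w (Y w ^+ 2)%:E <= K%:E.
Proof.
move=> mX mY XK XY.
have mX2 n : measurable_fun setT ((fun w => (X n w ^+ 2)%:E) : Omega -> \bar R).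
  by apply/measurable_EFinP; apply: measurable_funX.
apply: (@le_trans _ _ (\int[P]_w limn_einf (fun n => (X n w ^+ 2)%:E))).
  apply: ae_ge0_le_integral => //.
  - by move=> w _; rewrite lee_fin sqr_ge0.
  - by apply/measurable_EFinP; apply: measurable_funX.
  - move=> w _; rewrite limn_einf_lim; apply: lime_ge; first exact: is_cvg_einfs.
    by apply: nearW => n; apply: le_ereal_inf_tmp => _ [m _ <-]; rewrite lee_fin sqr_ge0.
  - rewrite (_ : (fun w => _) = (fun w => - limn_esup (fun n => - (X n w ^+ 2)%:E))) //.
    apply: measurableT_comp => //; apply: measurable_fun_limn_esup => n.
    by apply: measurableT_comp.
  apply: filterS XY => w hw _.
  have h : (X n w ^+ 2)%:E @[n --> \oo] --> (Y w ^+ 2)%:E.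
    by apply: cvg_EFin; [exact: nearW|apply: cvgM; exact: hw].
  by rewrite (cvg_limn_einf_sup h).
apply: (le_trans (fatou P measurableT mX2 _)).
  by move=> n w _; rewrite lee_fin sqr_ge0.
exact: limn_einf_le.
Qed.

Lemma sqr_integrable (Y : Omega -> R) (K : R) : measurable_fun setT Y ->
  \int[P]_w (Y w ^+ 2)%:E <= K%:E -> P.-integrable setT (EFin \o Y).
Proof.
move=> mY YK.
apply: (@le_integrable _ _ _ _ _ measurableT _ (fun w => (1 + Y w ^+ 2)%:E)).
- exact/measurable_EFinP.
- move=> w _ /=; rewrite lee_fin [leRHS]ger0_norm ?addr_ge0 ?sqr_ge0//.
  rewrite -(real_normK (num_real (Y w))); have := normr_ge0 (Y w); nra.
rewrite (_ : (fun w => _) = (EFin \o cst 1%R) \+ (fun w => (Y w ^+ 2)%:E)); last by apply/funext => w.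
apply: integrableD => //; first exact: (finite_measure_integrable_cst P 1 measurableT).
apply/integrableP; split; first by apply/measurable_EFinP; apply: measurable_funX.
rewrite (eq_integral (fun w => (Y w ^+ 2)%:E)); first exact: (le_lt_trans YK (ltry _)).
by move=> w _; rewrite gee0_abs// lee_fin sqr_ge0.
Qed.

(** An L^2 bound gives uniform integrability.  Concretely, |X - Y| is at most its truncation at [m], which is handled by dominated convergence, plus 2 (X^2 + Y^2)/m, whose integral is small for [m] large. *)
Lemma cvg_expectation_sqr (X : nat -> Omega -> R) (Y : Omega -> R) (K : R) :
  (forall n, measurable_fun setT (X n)) -> measurable_fun setT Y ->
  (forall n, \int[P]_w (X n w ^+ 2)%:E <= K%:E) ->
  {ae P, forall w, X n w @[n --> \oo] --> Y w} ->
  fine (\int[P]_w (X n w)%:E) @[n --> \oo] --> fine (\int[P]_w (Y w)%:E).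
Proof.
move=> mX mY XK XY.
have YK := fatou_sqr mX mY XK XY.
have iX n := sqr_integrable (mX n) (XK n).
have iY := sqr_integrable mY YK.
have K0 : (0 <= K)%R by rewrite -lee_fin (le_trans _ YK)// integral_ge0// => w _; rewrite lee_fin sqr_ge0.
apply/cvgrPdist_le => e e0.
pose m : R := (8 * (K + 1) / e)%R.
have m0 : (0 < m)%R by rewrite divr_gt0// mulr_gt0// ltr_wpDl.
have em : (e * m / 4 = 2 * (K + 1))%R by rewrite /m; field; exact: lt0r_neq0.
clearbody m.
have mD n : measurable_fun setT (fun w => `|X n w - Y w|%R).
  by apply: measurableT_comp => //; exact: measurable_funB.
have mM n : measurable_fun setT (fun w => Num.min `|X n w - Y w|%R m).
  exact: (measurable_minr (mD n) (measurable_cst m)).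
have n0 n w : (0 <= Num.min `|X n w - Y w| m)%R by rewrite le_min normr_ge0 ltW.
have cM : {ae P, forall w, setT w -> (Num.min `|X n w - Y w|%R m)%:E @[n --> \oo] --> (0 : \bar R)}.
  apply: filterS XY => w /cvgrPdist_le hw _; apply: cvg_EFin; first exact: nearW.
  apply/cvgrPdist_le => e' /hw; apply: filterS => n /=; rewrite sub0r normrN distrC => h.
  by rewrite ger0_norm// ge_min h.
have bM : {ae P, forall w n, setT w -> `|(Num.min `|X n w - Y w|%R m)%:E| <= m%:E}.
  apply: aeW => w n _ /=.
  by rewrite lee_fin ger0_norm// ge_min lexx orbT.
have [_ _] := @dominated_convergence _ _ _ P setT measurableT
   (fun n w => (Num.min `|X n w - Y w|%R m)%:E) (cst 0) (EFin \o cst m)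
   (fun n => proj2 (measurable_EFinP _ _) (mM n)) (measurable_cst _) cM
   (finite_measure_integrable_cst P m measurableT) bM.
rewrite integral0 => /fine_cvgP[hfin /cvgrPdist_le /(_ (e / 2)%R)].
rewrite divr_gt0// => /(_ isT); apply: filterS2 hfin => n /= hf; rewrite sub0r normrN => hn.
have fX : \int[P]_w (X n w)%:E \is a fin_num by exact: (integrable_fin_num measurableT (iX n)).
have fY : \int[P]_w (Y w)%:E \is a fin_num by exact: (integrable_fin_num measurableT iY).
rewrite -fineB// -lee_fin -integralB_EFin//.
have mXY : measurable_fun setT ((fun w => (Y w)%:E - (X n w)%:E) : Omega -> \bar R).
  by under eq_fun do rewrite -EFinB; apply/measurable_EFinP; exact: measurable_funB.
have fB : \int[P]_w ((Y w)%:E - (X n w)%:E) \is a fin_num.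
  by rewrite integralB_EFin// fin_numB fX fY.
rewrite -fine_abse// fineK; last by rewrite abse_fin_num.
apply: (le_trans (le_abse_integral P measurableT mXY)).
have m2 : measurable_fun setT (fun w => X n w ^+ 2 + Y w ^+ 2)%R.
  by apply: measurable_funD; exact: measurable_funX.
have mX2 : measurable_fun setT (fun w => X n w ^+ 2)%R by exact: measurable_funX.
have mY2 : measurable_fun setT (fun w => Y w ^+ 2)%R by exact: measurable_funX.
apply: (@le_trans _ _ (\int[P]_w ((Num.min `|X n w - Y w|%R m)%:E + (2 / m)%:E * ((X n w ^+ 2)%:E + (Y w ^+ 2)%:E)))).
  apply: ge0_le_integral => //.
  - by apply: measurableT_comp.
  - apply: emeasurable_funD; first exact/measurable_EFinP.
    by apply: emeasurable_funM => //; under eq_fun do rewrite -EFinD; apply/measurable_EFinP.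
  - move=> w _.
    suff h : (`|Y w - X n w| <= Num.min `|X n w - Y w| m + 2 / m * (X n w ^+ 2 + Y w ^+ 2))%R by exact: h.
    rewrite distrC; set x := X n w; set y := Y w.
    have [h|h] := leP `|x - y|%R m.
      by rewrite lerDl mulr_ge0 ?divr_ge0 ?addr_ge0 ?sqr_ge0// ltW.
    apply: (@le_trans _ _ (2 / m * (x ^+ 2 + y ^+ 2))%R); last by rewrite lerDr ltW.
    rewrite mulrAC ler_pdivlMr//.
    apply: (@le_trans _ _ (`|x - y| * `|x - y|)%R); first by rewrite ler_wpM2l// ltW.
    rewrite -expr2 real_normK ?num_real//.
    have := sqr_ge0 (x + y); nra.
rewrite ge0_integralD//; last 4 first.
- by move=> w _; rewrite lee_fin le_min normr_ge0 ltW.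
- exact/measurable_EFinP.
- by move=> w _; rewrite mule_ge0// ?adde_ge0 ?lee_fin ?sqr_ge0// divr_ge0// ltW.
- by apply: emeasurable_funM => //; under eq_fun do rewrite -EFinD; apply/measurable_EFinP.
rewrite ge0_integralZl//; last 3 first.
- by under eq_fun do rewrite -EFinD; apply/measurable_EFinP.
- by move=> w _; rewrite adde_ge0 ?lee_fin ?sqr_ge0.
- by rewrite lee_fin divr_ge0// ltW.
rewrite ge0_integralD//; last 4 first.
- by move=> w _; rewrite lee_fin sqr_ge0.
- exact/measurable_EFinP.
- by move=> w _; rewrite lee_fin sqr_ge0.
- exact/measurable_EFinP.
have -> : e%:E = (e / 2)%:E + (2 / m)%:E * (K%:E + (e * m / 4 - K)%:E) :> \bar R.
  have h : e = (e / 2 + (2 / m) * (K + (e * m / 4 - K)))%R by field; exact: lt0r_neq0.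
  by rewrite [LHS](congr1 (@EFin R) h) EFinD EFinM EFinD.
apply: leeD; first by rewrite -[leLHS]fineK// lee_fin (le_trans (ler_norm _)).
apply: lee_wpmul2l; first by rewrite lee_fin divr_ge0// ltW.
apply: leeD => //; apply: (le_trans YK); rewrite lee_fin.
rewrite em; lra.
Qed.

(** The series of the [X n] has a finite integral, so it is finite almost surely and bounds its terms. *)
Lemma ae_bounded_of_summable (X : nat -> Omega -> R) (K : R) :
  (forall n, measurable_fun setT (X n)) -> (forall n w, (0 <= X n w)%R) ->
  (forall n, \int[P]_w (X n w)%:E <= (K / (n.+1%:R * n.+2%:R))%:E) ->
  {ae P, forall w, exists C : R, forall n, (X n w <= C)%R}.
Proof.
move=> mX X0 XK.
have K0 : (0 <= K)%R.
  have h : 0 <= \int[P]_w (X 0%N w)%:E by apply: integral_ge0 => w _; rewrite lee_fin.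
  by have := le_trans h (XK 0%N); rewrite lee_fin; lra.
have mE n : measurable_fun setT ((fun w => (X n w)%:E) : Omega -> \bar R).
  exact/measurable_EFinP.
pose S w := \sum_(0 <= n <oo) (X n w)%:E.
have S0 w : 0 <= S w by apply: nneseries_ge0 => n _ _; rewrite lee_fin.
have mS : measurable_fun setT S by apply: ge0_emeasurable_sum => // n w _ _; rewrite lee_fin.
have SK : \int[P]_w S w <= K%:E.
  rewrite integral_nneseries//; last by move=> n w _; rewrite lee_fin.
  apply: lime_le.
    by apply: is_cvg_nneseries => n _ _; apply: integral_ge0 => w _; rewrite lee_fin.
  apply: nearW => n.
  apply: (@le_trans _ _ (\sum_(0 <= i < n) (K / (i.+1%:R * i.+2%:R))%:E)).
    by apply: lee_sum => i _; exact: XK.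
  rewrite sumEFin lee_fin.
  suff -> : (\sum_(0 <= i < n) K / (i.+1%:R * i.+2%:R) = K * (1 - n.+1%:R^-1))%R.
    by rewrite ler_piMr// lerBlDr lerDl invr_ge0.
  elim: n => [|n IH]; first by rewrite big_geq// invr1 subrr mulr0.
  rewrite big_nat_recr//= IH.
  have h1 : (n.+1%:R : R) != 0%R by rewrite pnatr_eq0.
  have h2 : (n.+2%:R : R) != 0%R by rewrite pnatr_eq0.
  rewrite -[n.+2]addn1 natrD in h2 *; field; apply/andP; split => //.
have iS : P.-integrable setT S.
  apply/integrableP; split => //.
  rewrite (eq_integral S); first exact: (le_lt_trans SK (ltry _)).
  by move=> w _; rewrite gee0_abs.
have := integrable_ae measurableT iS; apply: filterS => w /(_ I) fw.
exists (fine (S w)) => n; rewrite -lee_fin fineK//.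
apply: (le_trans _ (nneseries_lim_ge n.+1 _)); last by move=> i _ _; rewrite lee_fin.
rewrite big_nat_recr//= leeDr// sume_ge0// => i _.
by rewrite lee_fin.
Qed.
End AlmostSure.

(** * Smallness away from the point 1 *)

Section Powers.
Variable R : realType.
Implicit Types s t : R.

Lemma pw_gt0 n s : 0 < pw n s. Proof. exact: expR_gt0. Qed.
Lemma pw_ge0 n s : 0 <= pw n s. Proof. exact: expR_ge0. Qed.
Lemma pwD n s t : pw n (s + t) = pw n s * pw n t.
Proof. by rewrite /pw mulrDl expRD. Qed.
Lemma ln_nat_ge0 n : 0 <= ln (n%:R : R).
Proof. by case: n => [|n]; [rewrite ln0|rewrite ln_ge0// ler1n]. Qed.
Lemma le_pw n s t : s <= t -> pw n s <= pw n t.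
Proof. by move=> st; rewrite ler_expR ler_wpM2r// ln_nat_ge0. Qed.
Lemma le_pw_nat m n s : 0 <= s -> (0 < m)%N -> (m <= n)%N -> pw m s <= pw n s.
Proof.
move=> s0 m0 mn; rewrite ler_expR ler_wpM2l// ler_ln ?posrE ?ltr0n ?ler_nat//.
exact: leq_trans mn.
Qed.
Lemma pw_nat n k : (0 < n)%N -> pw n (k%:R : R) = n%:R ^+ k.
Proof.
move=> n0; rewrite /pw mulrC mulr_natr; elim: k => [|k IH]; first by rewrite mulr0n expR0 expr0.
by rewrite mulrS expRD IH exprS lnK// posrE ltr0n.
Qed.
Lemma pwX n s k : pw n s ^+ k = pw n (s * k%:R).
Proof.
rewrite /pw; elim: k => [|k IH]; first by rewrite mulr0 mul0r expR0 expr0.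
by rewrite exprS IH -expRD -natr1 mulrDr mulr1 mulrDl addrC.
Qed.
Lemma pw_expn j A s : (0 < j)%N -> pw (j ^ A) s = pw j (s * A%:R).
Proof.
move=> j0; rewrite /pw natrX lnXn ?ltr0n// -mulr_natr; congr expR; ring.
Qed.

(** Successive [A]-th powers differ by at most a constant times the power of order [A - 1]. *)
Lemma expn_step (x A : nat) : (0 < x)%N -> (x.+1 ^ A.+1 + x ^ A <= x ^ A.+1 + 2 ^ A.+1 * x ^ A)%N.
Proof.
move=> x0; elim: A => [|A IH]; first by rewrite !expn0 !expn1; lia.
rewrite (expnS x.+1) (expnS x A.+1) (expnS 2 A.+1).
have : (x ^ A <= x ^ A.+1)%N by rewrite leq_pexp2l.
have : (1 <= 2 ^ A.+1)%N by rewrite expn_gt0.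
move: IH; rewrite !(expnS x A).
move: (2 ^ A.+1)%N (x ^ A)%N (x.+1 ^ A.+1)%N => T Y Z; nia.
Qed.
End Powers.

Section AwayMoment.
Variable R : realType.
Local Notation C := (Cplx R).

(** For [z] near a point [zeta] of the unit circle other than 1 both exponents of the recursion, 4 Re z - 2 and 2 |z|^2 - 1, are below 2; hence E |F_n(z)|^2 is smaller than n^2 by a power of [n]. *)
Lemma m2_away (zeta z : C) (eta : R) n : nrm zeta = 1 -> 0 < eta -> eta <= 1 / 2 ->
  eta <= nrm (zeta - 1) ^+ 2 -> nrm (z - zeta) <= eta / 16 -> (0 < n)%N ->
  m2 n z <= (1 + 32 / eta) * expR 2 * pw n (2 - eta).
Proof.
move=> z1 e0 e2 ez zz n0.
have h1 : complex.Re zeta ^+ 2 + complex.Im zeta ^+ 2 = 1 by rewrite -nrm_sqr z1 expr1n.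
have h2 : nrm (zeta - 1) ^+ 2 = 2 - 2 * complex.Re zeta.
  rewrite nrm_sqr ReB ImB /= subr0.
  have -> : (complex.Re zeta - 1) ^+ 2 + complex.Im zeta ^+ 2 = complex.Re zeta ^+ 2 + complex.Im zeta ^+ 2 + 1 - 2 * complex.Re zeta by ring.
  rewrite h1; ring.
have h3 : complex.Re z <= complex.Re zeta + eta / 16.
  have := le_trans (ler_norm _) (Re_le_nrm (z - zeta)); rewrite ReB; lra.
have h4 : nrm z <= 1 + eta / 16.
  have := nrmB_ge z zeta; rewrite z1; lra.
have h5 : nrm z ^+ 2 <= 1 + eta / 4.
  have := nrm_ge0 z; nra.
have h6 : nrm (2 * z - 1) ^+ 2 <= 16.
  have : nrm (2 * z - 1) <= 4.
    by rewrite (le_trans (nrmB _ _))// nrmM nrm1 (nrm_nat R 2); lra.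
  have := nrm_ge0 (2 * z - 1); nra.
have g0 : 0 < eta / 2 by rewrite divr_gt0.
have := @m2_crude R n z (2 - eta) (eta / 2) g0 ltac:(lra) ltac:(lra) ltac:(lra).
move=> /le_trans; apply.
rewrite -mulrA; apply: ler_pM.
- by rewrite addr_ge0// divr_ge0 ?sqr_ge0// ltW.
- by apply: Qprod_ge0; lra.
- rewrite lerD2l ler_pdivrMr//; apply: (le_trans h6).
  by rewrite le_eqVlt; apply/orP; left; apply/eqP; field; exact: lt0r_neq0.
rewrite (le_trans (Qprod_le _ n0))//; first lra.
by rewrite ler_wpM2r ?pw_ge0// ler_expR; lra.
Qed.

Lemma ravg_sqr M (f : R -> R) : ravg M f ^+ 2 <= ravg M (fun u => f u ^+ 2).
Proof.
set m := ravg M f; rewrite -subr_ge0.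
have h : ravg M (fun u => (f u - m) ^+ 2) = ravg M (fun u => f u ^+ 2) - m ^+ 2.
  have -> : ravg M (fun u => (f u - m) ^+ 2) =
     ravg M (fun u => f u ^+ 2) + (- 2 * m) * ravg M f + ravg M (fun=> m ^+ 2).
    rewrite /ravg mulrCA -!mulrDr [_ * \sum_(l < _) _ in RHS]mulr_sumr -!big_split /=; congr (_ * _).
    by apply: eq_bigr => i _; ring.
  by rewrite ravg_cst -/m; ring.
rewrite -h /ravg mulr_ge0 ?invr_ge0 ?ler0n// sumr_ge0// => i _; exact: sqr_ge0.
Qed.

(** [genF] as a polynomial, whose coefficients are the profile. *)
Definition genP (t : tree) : {poly C} := \sum_(v <- external t) 'X^(size v).

Lemma genPE t z : (genP t).[z] = genF t z.
Proof. by rewrite /genP /genF horner_sum; apply: eq_bigr => v _; rewrite hornerXn. Qed.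

Lemma size_genP t n : reach n t -> (size (genP t) <= n.+1)%N.
Proof.
move=> ht; apply: (leq_trans (size_sum _ _ _)).
apply/bigmax_leqP_seq => v hv _; rewrite size_polyXn.
by rewrite -ht; exact: size_external_depth.
Qed.

Lemma genP_coef t k : (genP t)`_k = (count (fun v => size v == k) (external t))%:R.
Proof.
rewrite /genP coef_sum -sum1_count natr_sum [RHS]big_mkcond /=; apply: eq_bigr => v _.
by rewrite coefXn eq_sym; case: eqP.
Qed.

(** Pointwise values are controlled by circle averages, hence by second moments, since the coefficients of the recentred polynomial are. *)
Lemma disc_sup (p : {poly C}) (zeta z : C) (rho : R) M : 0 < rho -> (size p <= M)%N ->
  nrm (z - zeta) <= rho / 2 ->
  nrm p.[z] <= 2 * ravg M (fun u => nrm p.[rho%:C * cis u + zeta]).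
Proof.
move=> r0 sp zr.
set A := ravg M _.
have A0 : 0 <= A by rewrite /A /ravg mulr_ge0 ?invr_ge0 ?ler0n// sumr_ge0// => i _; exact: nrm_ge0.
have ssp : (size (pshift zeta p) <= M)%N.
  by rewrite /pshift size_comp_poly2 ?size_XaddC.
have c k : (k < M)%N -> nrm (pshift zeta p)`_k * rho ^+ k <= A.
  move=> kM; apply: (le_trans (coef_le_ravg (M := M) (ltW r0) _ _)); [lia..|].
  by apply: le_ravg => u _; rewrite pshiftE.
have -> : p.[z] = (pshift zeta p).[z - zeta] by rewrite pshiftE subrK.
rewrite (horner_coef_wide _ ssp) (le_trans (nrm_sum _ _ _))//.
apply: (@le_trans _ _ (\sum_(i < M) A * (1 / 2) ^+ i)).
  apply: ler_sum => i _; rewrite nrmM nrmX.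
  apply: (@le_trans _ _ (nrm (pshift zeta p)`_i * (rho ^+ i * (1 / 2) ^+ i))).
    rewrite ler_wpM2l ?nrm_ge0// -exprMn lerXn2r ?nnegrE ?nrm_ge0//; last lra.
    by rewrite mulr_ge0// ltW.
  by rewrite mulrA ler_wpM2r ?exprn_ge0 ?c.
rewrite -mulr_sumr mulrC ler_wpM2r//; apply: geo_sum_le2 => //.
Qed.
End AwayMoment.

Section AwayAE.
Context {d : measure_display} {Omega : measurableType d} {R : realType}.
Variable P : probability Omega R.
Variable Tr : nat -> Omega -> tree.
Hypothesis hTr : is_BST_process P Tr.
Local Notation C := (Cplx R).

(** The deterministic content of the evolution, which holds along almost every path. *)
Definition splits (T : nat -> tree) := T 0%N = External /\
  forall n, exists2 v, v \in external (T n) & T n.+1 = split_at (T n) v.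

Lemma ae_splits : {ae P, forall w, splits (Tr ^~ w)}.
Proof.
have := ae_split hTr; apply: filterS => w h; split => //.
by have [_ h0 _] := hTr.
Qed.

Lemma splits_reach T : splits T -> forall n, reach n (T n).
Proof.
move=> [T0 Ts]; elim=> [|n IH]; first by rewrite T0.
by have [v hv ->] := Ts n; rewrite /reach size_split// IH.
Qed.

(** Between times [m] and [n] each step changes F by at most |2 z - 1| times one monomial. *)
Lemma genF_diff T (z : C) (B : R) m n : splits T -> (m <= n)%N ->
  (forall i v, (m <= i < n)%N -> v \in external (T i) -> nrm z ^+ size v <= B) ->
  nrm (genF (T n) z - genF (T m) z) <= nrm (2 * z - 1) * ((n - m)%:R * B).
Proof.
move=> Ts mn; rewrite -(subnK mn) addnK; move: (n - m)%N => k {mn n}.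
elim: k => [|k IH] hB; first by rewrite subrr nrm0 mul0r mulr0.
have [v hv e] := Ts.2 (k + m)%N.
rewrite addSn e genF_split// addrAC (le_trans (nrmD _ _))//.
have -> : nrm (2 * z - 1) * (k.+1%:R * B) = nrm (2 * z - 1) * (k%:R * B) + nrm (2 * z - 1) * B.
  by ring.
rewrite lerD//.
  by apply: IH => i v' hi; apply: hB; lia.
rewrite nrmM nrmX ler_wpM2l ?nrm_ge0//; apply: hB hv; lia.
Qed.

Lemma succ_mul_le n : n.+1%:R * n.+2%:R <= 2 * n.+1%:R ^+ 2 :> R.
Proof. by rewrite -natrX -!natrM ler_nat; nia. Qed.

Lemma genF_ge0 t (x : R) : 0 <= x -> 0 <= genF t x.
Proof. by move=> x0; apply: sumr_ge0 => v _; rewrite exprn_ge0. Qed.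

(** The mean of F_n(2) is of order n^3; the two extra powers make the expectations summable.  Since 2^|v| <= F_n(2), this also bounds the depths of all external nodes. *)
Lemma genF2_ae : {ae P, forall w, exists2 K : R, 0 <= K & forall n, (0 < n)%N -> genF (Tr n w) 2 <= K * pw n 5}.
Proof.
pose X n w : R := genF (Tr n.+1 w) 2 / (pw n.+1 3 * (n.+1%:R * n.+2%:R)).
have den n : 0 < pw n.+1 3 * (n.+1%:R * n.+2%:R) :> R by rewrite !mulr_gt0 ?pw_gt0.
have X0 n w : 0 <= X n w by rewrite divr_ge0 ?genF_ge0// ltW.
have mX n : measurable_fun setT (X n).
  exact: (measurable_fun_tree hTr n.+1 (fun t => genF t 2 / (pw n.+1 3 * (n.+1%:R * n.+2%:R)) : R)).
have := @ae_bounded_of_summable _ _ _ P X (expR 3) mX X0.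
have EX n : (\int[P]_w (X n w)%:E <= (expR 3 / (n.+1%:R * n.+2%:R))%:E)%E.
  rewrite (law_tree hTr n.+1 (f := fun t => genF t 2 / (pw n.+1 3 * (n.+1%:R * n.+2%:R)))); last first.
    by move=> t; rewrite divr_ge0 ?genF_ge0// ltW.
  rewrite lee_fin.
  under eq_EE do rewrite mulrC.
  rewrite EE_scale EE_genF invfM mulrAC mulrC [leRHS]mulrC ler_wpM2l//.
  rewrite mulrC ler_pdivrMr ?pw_gt0// (_ : 2 * 2 - 1 = 3 :> R); last by ring.
  exact: Qprod_le.
move=> /(_ EX); apply: filterS => w [K hK].
exists (`|K| * 2); first by rewrite mulr_ge0.
case=> // n _.
have := hK n; rewrite /X ler_pdivrMr// => h; apply: (le_trans h).
apply: (@le_trans _ _ (`|K| * (pw n.+1 3 * (n.+1%:R * n.+2%:R)))).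
  by rewrite ler_wpM2r ?ler_norm// ltW.
rewrite -mulrA ler_wpM2l// (_ : 5 = 3 + 2%:R :> R); last by ring.
rewrite (pwD n.+1 3 2%:R) [leRHS]mulrCA ler_wpM2l ?pw_ge0// pw_nat//; exact: succ_mul_le.
Qed.

Lemma power_block A n : (0 < A)%N -> (0 < n)%N -> exists j, ((j.+1 ^ A <= n) && (n < j.+2 ^ A))%N.
Proof.
move=> A0; elim: n => [//|[|n] IH] _.
  by exists 0%N; rewrite exp1n /= -{1}(exp1n A) ltn_exp2r.
have [j /andP[h1 h2]] := IH isT.
have [h|h] := ltnP n.+2 (j.+2 ^ A).
  by exists j; rewrite h (leq_trans h1).
exists j.+1; rewrite h /= (leq_ltn_trans h2)// ltn_exp2r//.
Qed.

(** By [m2_away] the second moments, divided by N_j^(2 - eta) (j + 1) (j + 2), are summable along the times N_j = (j + 1)^A, and for [A] large this divisor is below N_j^2 by a power; so F is small at these times.  Between N_j and N_(j+1) there are O(n^(1 - 1/A)) steps, and each changes F by at most n^(5/q), since |z|^|v| is a small power of 2^|v| when [z] is close to the unit circle. *)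
Lemma local_away_ae (eta : R) : 0 < eta -> eta <= 1 / 2 ->
  exists delta rho : R, [/\ 0 < delta, delta <= eta / 2, 0 < rho, rho <= eta / 16 &
   forall zeta : C, nrm zeta = 1 -> eta <= nrm (zeta - 1) ^+ 2 ->
   {ae P, forall w, exists2 K : R, 0 <= K & forall n z, (0 < n)%N -> nrm (z - zeta) <= rho ->
      nrm (genF (Tr n w) z) <= K * pw n (1 - delta)}].
Proof.
move=> e0 e2.
pose A' := Num.truncn (4 / eta); pose A := A'.+1.
have Aeta : 4 / eta <= A%:R by rewrite ltW// /A truncnS_gt.
have AR : 0 < (A%:R : R) by rewrite ltr0n.
(* With q = 10 A the loss n^(5/q) is the square root of the gain n^(1/A). *)
pose q := (10 * A)%N.
have qR : 0 < (q%:R : R) by rewrite ltr0n /q /A; lia.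
pose r := eta / 16.
have r0 : 0 < r by rewrite divr_gt0.
have ln2 : 0 < ln (2 : R) by rewrite ln_gt0// ltr1n.
(* The second bound ensures |z|^q <= 2 on the disc. *)
pose rho := Num.min (r / 2) (ln 2 / q%:R).
have rho0 : 0 < rho by rewrite lt_min !divr_gt0.
exists (1 / (2 * A%:R)), rho; split => //.
- by rewrite divr_gt0// mulr_gt0.
- move: Aeta; rewrite ler_pdivrMr// ler_pdivrMr ?mulr_gt0// => h4; lra.
- by rewrite (@le_trans _ _ (r / 2))// ?ge_min ?lexx// /r; lra.
move=> zeta z1 ez.
pose N j := (j.+1 ^ A)%N.
have N0 j : (0 < N j)%N by rewrite expn_gt0.
pose D j : R := pw (N j) (2 - eta) * (j.+1%:R * j.+2%:R).
have D0 j : 0 < D j by rewrite !mulr_gt0 ?pw_gt0.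
pose Y j (t : tree) : R := ravg (N j).+1 (fun u => nrm (genF t (r%:C * cis u + zeta)) ^+ 2).
have Y0 j t : 0 <= Y j t by rewrite mulr_ge0 ?invr_ge0 ?ler0n// sumr_ge0// => i _; exact: sqr_ge0.
pose X j w : R := Y j (Tr (N j) w) / D j.
have X0 j w : 0 <= X j w by rewrite divr_ge0// ltW.
have mX j : measurable_fun setT (X j).
  exact: (measurable_fun_tree hTr (N j) (fun t => Y j t / D j : R)).
pose K0 : R := (1 + 32 / eta) * expR 2.
have EX j : (\int[P]_w (X j w)%:E <= (K0 / (j.+1%:R * j.+2%:R))%:E)%E.
  rewrite (law_tree hTr (N j) (f := fun t => Y j t / D j)); last first.
    by move=> t; rewrite divr_ge0// ltW.
  rewrite lee_fin.
  under eq_EE do rewrite mulrC.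
  rewrite EE_scale /D invfM mulrAC mulrC [leRHS]mulrC ler_wpM2l//.
  rewrite mulrC ler_pdivrMr ?pw_gt0//.
  rewrite /Y /ravg EE_scale EE_sum -/(ravg (N j).+1 (fun u => EE (N j) (fun t => nrm (genF t (r%:C * cis u + zeta)) ^+ 2))).
  rewrite -[leRHS](ravg_cst (N j).+1); apply: le_ravg => u _.
  apply: (m2_away z1) => //.
  by rewrite addrK nrmM nrm_cis mulr1 nrm_real (ger0_norm (ltW r0)).
have aeX := @ae_bounded_of_summable _ _ _ P X K0 mX X0 EX.
apply: filterS3 aeX genF2_ae ae_splits => w [K1 hK1] [K2 K20 hK2] Ts.
have hr := splits_reach Ts.
pose B1 : R := 8 * `|K1| + 1.
have B10 : 0 <= B1 by rewrite addr_ge0 ?mulr_ge0.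
have main j z : nrm (z - zeta) <= rho -> nrm (genF (Tr (N j) w) z) <= B1 * pw (N j) (1 - eta / 4).
  move=> zr.
  have zr2 : nrm (z - zeta) <= r / 2 by rewrite (le_trans zr)// ge_min lexx.
  rewrite -ler_sqr ?nnegrE ?nrm_ge0 ?mulr_ge0 ?pw_ge0//.
  have s1 : nrm (genF (Tr (N j) w) z) <= 2 * ravg (N j).+1 (fun u => nrm (genF (Tr (N j) w) (r%:C * cis u + zeta))).
    rewrite -genPE (le_trans (disc_sup r0 (size_genP R (hr (N j))) zr2))// ler_wpM2l//.
    by apply: le_ravg => u _; rewrite genPE.
  apply: (@le_trans _ _ (4 * Y j (Tr (N j) w))).
    rewrite (le_trans (lerXn2r 2 _ _ s1)) ?nnegrE ?nrm_ge0//.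
      rewrite mulr_ge0// /ravg mulr_ge0 ?invr_ge0 ?ler0n// sumr_ge0// => i _; exact: nrm_ge0.
    rewrite exprMn (_ : 2 ^+ 2 = 4 :> R); last by ring.
    by rewrite ler_wpM2l// ravg_sqr.
  have := hK1 j; rewrite /X ler_pdivrMr// => h.
  apply: (@le_trans _ _ (4 * (`|K1| * D j))).
    by rewrite ler_wpM2l// (le_trans h)// ler_wpM2r ?ler_norm// ltW.
  have hD : D j <= 2 * pw (N j) (2 - eta / 2).
    rewrite (_ : 2 - eta / 2 = (2 - eta) + eta / 2); last by field.
    rewrite (pwD _ (2 - eta)) [leRHS]mulrCA /D ler_wpM2l ?pw_ge0//.
    apply: (@le_trans _ _ (2 * j.+1%:R ^+ 2)).
      exact: succ_mul_le.
    rewrite ler_wpM2l// -pw_nat// /N pw_expn// le_pw//.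
    move: Aeta; rewrite ler_pdivrMr// => h4; lra.
  apply: (@le_trans _ _ (8 * `|K1| * pw (N j) (2 - eta / 2))).
    have -> : 8 * `|K1| * pw (N j) (2 - eta / 2) = 4 * (`|K1| * (2 * pw (N j) (2 - eta / 2))) by ring.
    by rewrite ler_wpM2l// ler_wpM2l.
  rewrite exprMn pwX (_ : (1 - eta / 4) * 2 = 2 - eta / 2); last by field.
  rewrite ler_wpM2r ?pw_ge0// /B1; have := normr_ge0 K1; nra.
pose B2 : R := Num.max 1 K2.
have B21 : 1 <= B2 by rewrite le_max lexx.
pose B3 : R := 5 * 2 ^+ A * B2.
exists (B1 + B3); first by rewrite addr_ge0// !mulr_ge0// ?(le_trans ler01).
move=> n z n0 zr.
have [j /andP[j1 j2]] := power_block (isT : (0 < A)%N) n0.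
rewrite -(subrK (genF (Tr (N j) w) z) (genF _ z)) addrC (le_trans (nrmD _ _))// mulrDl.
have nz : nrm z <= 1 + ln 2 / q%:R.
  have := nrmB_ge z zeta; rewrite z1; have : nrm (z - zeta) <= ln 2 / q%:R by rewrite (le_trans zr)// ge_min lexx orbT.
  lra.
have A1 : 1 / (2 * A%:R) <= eta / 4.
  move: Aeta; rewrite ler_pdivrMr// ler_pdivrMr ?mulr_gt0// => h4; lra.
apply: lerD.
  apply: (le_trans (main _ _ zr)); rewrite ler_wpM2l//.
  apply: (@le_trans _ _ (pw n (1 - eta / 4))); first by apply: le_pw_nat => //; lra.
  by apply: le_pw; lra.
apply: (le_trans (genF_diff (B := B2 * pw n (5 / q%:R)) Ts j1 _)).
  move=> i v /andP[i1 i2] hv.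
  have i0 : (0 < i)%N by exact: leq_trans (N0 j) i1.
  rewrite -(@ler_pXn2r _ q) ?nnegrE ?exprn_ge0 ?nrm_ge0 ?mulr_ge0 ?pw_ge0//; last by rewrite (le_trans ler01).
  rewrite exprMn pwX mulfVK ?lt0r_neq0//.
  rewrite -exprM mulnC exprM.
  have zq : nrm z ^+ q <= 2.
    rewrite (le_trans (lerXn2r q _ _ nz)) ?nnegrE ?nrm_ge0//.
      by rewrite addr_ge0// divr_ge0// ltW.
    apply: (@le_trans _ _ (expR (ln 2 / q%:R) ^+ q)).
      by rewrite lerXn2r ?nnegrE ?expR_ge0 ?expR_ge1Dx// addr_ge0// divr_ge0// ltW.
    by rewrite -expRM_natl mulrC mulfVK ?lt0r_neq0// lnK ?posrE.
  apply: (@le_trans _ _ (2 ^+ size v)).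
    by rewrite lerXn2r ?nnegrE ?exprn_ge0 ?nrm_ge0.
  apply: (@le_trans _ _ (genF (Tr i w) 2)).
    rewrite /genF (bigD1_seq v) ?uniq_external//= lerDl sumr_ge0// => u _; exact: exprn_ge0.
  apply: (le_trans (hK2 i i0)).
  apply: ler_pM => //; rewrite ?pw_ge0//.
    apply: (@le_trans _ _ B2); first by rewrite le_max lexx orbT.
    by apply: ler_eXnr => //; rewrite /q /A.
  by apply: le_pw_nat => //; exact: ltnW.
have z5 : nrm (2 * z - 1) <= 5.
  have zz : nrm z <= 2.
    have := nrmB_ge z zeta; rewrite z1; have : nrm (z - zeta) <= r / 2 by rewrite (le_trans zr)// ge_min lexx.
    rewrite /r; lra.
  by rewrite (le_trans (nrmB _ _))// nrmM nrm1 (nrm_nat R 2); lra.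
have gap : ((n - N j)%:R : R) <= 2 ^+ A * pw n (1 - 1 / A%:R).
  apply: (@le_trans _ _ (2 ^+ A * j.+1%:R ^+ A')).
    rewrite -!natrX -natrM ler_nat.
    have := expn_step A' (isT : (0 < j.+1)%N); rewrite -/A -/(N j) => h.
    rewrite leq_subLR; apply: (leq_trans (ltnW j2)); apply: leq_trans h.
    exact: leq_addr.
  rewrite ler_wpM2l ?exprn_ge0// -pw_nat//.
  have -> : A'%:R = (1 - 1 / A%:R) * A%:R :> R.
    by rewrite mulrBl !mul1r mulVf ?lt0r_neq0// /A -natr1 addrK.
  rewrite -pw_expn//; apply: le_pw_nat => //.
    by rewrite subr_ge0 ler_pdivrMr// mul1r ler1n.
  exact: (N0 j).
have e5 : 1 - 1 / (2 * A%:R) = (1 - 1 / A%:R) + 5 / q%:R :> R.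
  by rewrite /q natrM; field; exact: lt0r_neq0.
have -> : B3 * pw n (1 - 1 / (2 * A%:R)) = 5 * (2 ^+ A * pw n (1 - 1 / A%:R) * (B2 * pw n (5 / q%:R))).
  by rewrite e5 pwD /B3; ring.
have B20 : 0 <= B2 * pw n (5 / q%:R) by rewrite mulr_ge0 ?pw_ge0// (le_trans ler01).
by apply: ler_pM => //; [exact: nrm_ge0|exact: mulr_ge0|exact: ler_wpM2r].
Qed.

Lemma cis_lip (x : R) : `|x| <= 1 -> nrm (cis x - 1 : C) <= 2 * expR 1 * `|x|.
Proof.
move=> x1.
have e : cis x = cexp ((0 +i* x) : C) by rewrite cexpE expR0 mul1r.
have n0 : nrm ((0 +i* x) : C) = `|x| by rewrite /nrm /= expr0n /= add0r sqrtr_sqr.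
have := @exptruncE R 1 (0 +i* x); rewrite n0 => /(_ x1).
by rewrite exptruncS /exptrunc big_ord0 expr0 add0r invr1 mulr1 -e expr1 mulrCA mulrA.
Qed.

Lemma nrm_cis1 (u : R) : nrm (cis u - 1 : C) ^+ 2 = 2 - 2 * cos u :> R.
Proof. by rewrite nrm_sqr ReB ImB /= subr0; have := cos2Dsin2 u; lra. Qed.

(** The arc is covered by finitely many discs of [local_away_ae].  The expectation obeys the same bound, by [m2_away] and Jensen's inequality. *)
Lemma away_ae (u0 : R) : 0 < u0 -> u0 <= pi ->
  exists delta rho : R, [/\ 0 < delta, 0 < rho &
   {ae P, forall w, exists2 K : R, 0 <= K & forall n u r, (0 < n)%N -> u0 <= `|u| -> `|u| <= pi ->
      `|r - 1| <= rho ->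
      nrm (genF (Tr n w) (r%:C * cis u) - EE n (fun t => genF t (r%:C * cis u))) <= K * pw n (1 - delta)}].
Proof.
move=> u00 u0pi.
pose d0 : R := 2 - 2 * cos u0.
have cosu u : u0 <= `|u| -> `|u| <= pi -> cos u <= cos u0.
  move=> h1 h2; have -> : cos u = cos `|u| by case: (ger0P u) => // _; rewrite cosN.
  by rewrite leNgt; apply/negP; rewrite ltr_cos ?in_itv /= ?(ltW u00) ?normr_ge0// ltNge h1.
have d00 : 0 < d0.
  have : cos u0 < cos (0:R) by rewrite ltr_cos ?in_itv /= ?lexx ?pi_ge0 ?(ltW u00).
  rewrite cos0 /d0; lra.
pose s0 := Num.sqrt d0.
have s00 : 0 < s0 by rewrite sqrtr_gt0.
have s02 : s0 ^+ 2 = d0 by rewrite sqr_sqrtr// ltW.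
pose eta : R := Num.min (1 / 2) (d0 / 4).
have e0 : 0 < eta by rewrite lt_min !divr_gt0.
have e2 : eta <= 1 / 2 by rewrite ge_min lexx.
have ed : eta <= d0 / 4 by rewrite ge_min lexx orbT.
have [delta [rho [dl0 dle rho0 rhoe loc]]] := local_away_ae e0 e2.
exists delta, (rho / 2); split => //; first by rewrite divr_gt0.
(* The mesh of the net of centres [cis (v i)]. *)
pose h : R := Num.min 1 (Num.min (rho / 2) (s0 / 2) / (2 * expR 1)).
have h0 : 0 < h by rewrite lt_min ltr01 /= divr_gt0 ?mulr_gt0 ?expR_gt0// lt_min !divr_gt0.
pose v (i : nat) : R := - pi + i%:R * h.
pose m := Num.truncn (2 * pi / h).
have net u : `|u| <= pi -> exists2 i, (i <= m)%N & nrm (cis u - cis (v i) : C) <= Num.min (rho / 2) (s0 / 2).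
  rewrite ler_norml => /andP[u1 u2].
  have upi : 0 <= (u + pi) / h by rewrite divr_ge0 ?(ltW h0)//; lra.
  exists (Num.truncn ((u + pi) / h)).
    by apply: le_truncn; rewrite ler_wpM2r ?invr_ge0 ?(ltW h0)//; lra.
  set i := Num.truncn _.
  have /andP[i1 i2] := truncn_itv upi.
  have x1 : `|u - v i| <= h.
    move: i1 i2; rewrite -/i ler_pdivlMr// ltr_pdivrMr// -natr1 mulrDl mul1r => i1 i2.
    rewrite /v ger0_norm; lra.
  have -> : cis u - cis (v i) = cis (v i) * (cis (u - v i) - 1) :> C.
    by rewrite mulrBr mulr1 -cisD addrCA subrr addr0.
  rewrite nrmM nrm_cis mul1r.
  have x11 : `|u - v i| <= 1 by rewrite (le_trans x1)// ge_min lexx.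
  apply: (le_trans (cis_lip x11)); rewrite -ler_pdivlMl ?mulr_gt0 ?expR_gt0//.
  by rewrite (le_trans x1)// mulrC ge_min lexx orbT.
have ae1 : {ae P, forall w, forall i, eta <= nrm (cis (v i) - 1 : C) ^+ 2 ->
    exists2 K : R, 0 <= K & forall n z, (0 < n)%N -> nrm (z - cis (v i)) <= rho ->
      nrm (genF (Tr n w) z) <= K * pw n (1 - delta)}.
  apply/ae_foralln => i.
  have [hi|hi] := boolP (eta <= nrm (cis (v i) - 1 : C) ^+ 2); last exact: aeW.
  by have := loc _ (nrm_cis (v i)) hi; apply: filterS.
apply: filterS ae1 => w.
have ch i : exists K : R, (eta <= nrm (cis (v i) - 1 : C) ^+ 2 ->
    exists2 K : R, 0 <= K & forall n z, (0 < n)%N -> nrm (z - cis (v i)) <= rho ->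
      nrm (genF (Tr n w) z) <= K * pw n (1 - delta)) ->
   0 <= K /\ (eta <= nrm (cis (v i) - 1 : C) ^+ 2 -> forall n z, (0 < n)%N -> nrm (z - cis (v i)) <= rho ->
      nrm (genF (Tr n w) z) <= K * pw n (1 - delta)).
  have [hi|hi] := boolP (eta <= nrm (cis (v i) - 1 : C) ^+ 2); last by exists 0.
  have [[K K0 hK]|hn] := pselect (exists2 K : R, 0 <= K & forall n z, (0 < n)%N -> nrm (z - cis (v i)) <= rho ->
      nrm (genF (Tr n w) z) <= K * pw n (1 - delta)); first by exists K.
  by exists 0 => /(_ isT).
have [Kf hKf] := choice ch => hw.
have {hKf}hKf i := hKf i (hw i).
pose K1 := \sum_(i < m.+1) Kf i.
have Kle i : (i <= m)%N -> Kf i <= K1.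
  move=> im; rewrite /K1 (bigD1 (Ordinal (im : (i < m.+1)%N)))//= lerDl sumr_ge0// => j _.
  exact: (hKf j).1.
have K10 : 0 <= K1 by rewrite sumr_ge0// => i _; exact: (hKf i).1.
pose K2 : R := (1 + 32 / eta) * expR 2 + 1.
have K21 : 1 <= K2 by rewrite lerDr mulr_ge0 ?expR_ge0// addr_ge0// divr_ge0// ltW.
exists (K1 + K2); first by rewrite addr_ge0// (le_trans ler01).
move=> n u r n0 u1 u2 r1.
have [i im iu] := net u u2.
move: iu; rewrite le_min => /andP[iu1 iu2].
have ci : eta <= nrm (cis (v i) - 1 : C) ^+ 2.
  apply: (le_trans ed).
  have hs : s0 <= nrm (cis u - 1 : C).
    rewrite -ler_sqr ?nnegrE ?nrm_ge0 ?(ltW s00)// s02 nrm_cis1 /d0.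
    by have := cosu u u1 u2; lra.
  have : s0 / 2 <= nrm (cis (v i) - 1 : C).
    have -> : cis (v i) - 1 = (cis u - 1) - (cis u - cis (v i)) :> C by ring.
    by have := nrmB_ge (cis u - 1 : C) (cis u - cis (v i)); lra.
  rewrite -s02 => hh; have -> : s0 ^+ 2 / 4 = (s0 / 2) ^+ 2 by field.
  by rewrite lerXn2r ?nnegrE ?nrm_ge0// divr_ge0// ltW.
have zz : nrm (r%:C * cis u - cis (v i)) <= rho.
  have -> : r%:C * cis u - cis (v i) = (r - 1)%:C * cis u + (cis u - cis (v i)) :> C.
    by rewrite rmorphB rmorph1; ring.
  by rewrite (le_trans (nrmD _ _))// nrmM nrm_cis nrm_real mulr1; lra.
rewrite (le_trans (nrmB _ _))// mulrDl lerD//.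
  apply: (le_trans ((hKf i).2 ci _ _ n0 zz)).
  by rewrite ler_wpM2r ?pw_ge0// Kle.
rewrite -ler_sqr ?nnegrE ?nrm_ge0 ?mulr_ge0 ?pw_ge0 ?(le_trans ler01)//.
apply: (@le_trans _ _ (m2 n (r%:C * cis u))).
  apply: (@le_trans _ _ (EE n (fun t => nrm (genF t (r%:C * cis u))) ^+ 2)).
    rewrite lerXn2r ?nnegrE ?nrm_ge0 ?EE_nrm// EE_ge0// => t _; exact: nrm_ge0.
  exact: EE_sqr_le.
apply: (le_trans (@m2_away R (cis (v i)) _ eta n (nrm_cis _) e0 e2 ci (le_trans zz rhoe) n0)).
rewrite exprMn pwX; apply: ler_pM; rewrite ?pw_ge0 ?mulr_ge0 ?expR_ge0 ?addr_ge0 ?divr_ge0 ?(ltW e0)//.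
  by apply: (@le_trans _ _ K2); [rewrite lerDl|rewrite ler_eXnr].
by apply: le_pw; lra.
Qed.
End AwayAE.

(** * Stirling's formula *)

Section Stirling.
Variable R : realType.
Implicit Types x y : R.

Lemma real_cauchy_rate (x : nat -> R) (K : R) : (forall i j, x i - x j <= K / i.+1%:R + K / j.+1%:R) ->
    exists a, forall j, `|a - x j| <= 2 * K / j.+1%:R.
Proof.
move=> xK.
have [i j|l hl] := @nrm_complete R (fun i => (x i)%:C) K.
  by rewrite -rmorphB nrm_real ler_norml xK andbT lerNl opprB [leRHS]addrC xK.
exists (complex.Re l) => j; apply: le_trans (hl j).
by apply: le_trans (Re_le_nrm _); rewrite ReB.
Qed.

(** A two-sided form of the mean value theorem on a segment. *)
Lemma mean_value_bound (f f' : R -> R) (a b B : R) : a <= b ->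
  (forall x, a <= x <= b -> is_derive x (1:R) f (f' x)) ->
  (forall x, a <= x <= b -> `|f' x| <= B) -> `|f b - f a| <= B * (b - a).
Proof.
move=> ab fd fB.
have fd' x : x \in `]a, b[ -> is_derive x (1:R) f (f' x).
  by rewrite in_itv /= => /andP[h1 h2]; apply: fd; rewrite !ltW.
have fc : {within `[a, b], continuous f}.
  apply: derivable_within_continuous => x; rewrite in_itv /= => h.
  by have [] := fd x h.
have [c cab ->] := MVT_segment ab fd' fc.
rewrite normrM (ger0_norm (_ : 0 <= b - a)) ?subr_ge0//.
rewrite ler_wpM2r ?subr_ge0// fB//; by move: cab; rewrite in_itv.
Qed.

Lemma ln1p_taylor x : `|x| <= 1 / 2 -> `|ln (1 + x) - x + x ^+ 2 / 2| <= 2 * `|x| ^+ 3.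
Proof.
move=> x2.
pose f y := ln (1 + y) - y + y ^+ 2 / 2.
pose f' y := (1 + y)^-1 - 1 + y.
have fd y : `|y| <= `|x| -> is_derive y (1:R) f (f' y).
  move=> yx; have y1 : 0 < 1 + y by have := ler_norm (- y); rewrite normrN; lra.
  have dl : is_derive y (1:R) (fun y => ln (1 + y)) ((1 + y)^-1).
    have h1 : is_derive y (1:R) (fun y : R => 1 + y) 1.
      by have := is_deriveD (is_derive_cst (1:R) y (1:R)) (is_derive_id y (1:R)); rewrite add0r.
    have := @is_derive1_comp _ (@ln R) (fun y => 1 + y) y _ _ (is_derive1_ln y1) h1.
    by rewrite mulr1.
  have dq : is_derive y (1:R) (fun y : R => y ^+ 2 / 2) y.
    rewrite (_ : (fun y : R => y ^+ 2 / 2) = (2^-1 \*: (id ^+ 2))); last first.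
      by apply/funext => u /=; rewrite fctE /GRing.scale /= mulrC.
    by apply: is_derive_eq; rewrite /GRing.scale /= expr1 !mulr1; field.
  rewrite /f (_ : (fun y => _) = ((fun y => ln (1 + y)) - id) + (fun y => y ^+ 2 / 2)); last by apply/funext.
  by apply: is_derive_eq.
have fB y : `|y| <= `|x| -> `|f' y| <= 2 * `|x| ^+ 2.
  move=> yx; have y1 : 1 / 2 <= 1 + y by have := ler_norm (- y); rewrite normrN; lra.
  have -> : f' y = y ^+ 2 / (1 + y) by rewrite /f'; field; apply/eqP => h; lra.
  rewrite normrM normfV [`|1 + y|]ger0_norm; last lra.
  rewrite ler_pdivrMr; last lra.
  rewrite normrX.
  have h1 : `|y| ^+ 2 <= `|x| ^+ 2 by rewrite lerXn2r ?nnegrE.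
  have := sqr_ge0 `|x|; nra.
have f0 : f 0 = 0 by rewrite /f addr0 ln1; ring.
have -> : ln (1 + x) - x + x ^+ 2 / 2 = f x - f 0 by rewrite f0 subr0.
have [x0|x0] := leP 0 x.
  have le1 z : 0 <= z <= x -> `|z| <= `|x| by move=> /andP[z0 zx]; rewrite !ger0_norm.
  have := mean_value_bound x0 (fun z h => fd z (le1 z h)) (fun z h => fB z (le1 z h)).
  by rewrite (ger0_norm x0) (_ : 2 * x ^+ 2 * (x - 0) = 2 * x ^+ 3)//; ring.
have le1 z : x <= z <= 0 -> `|z| <= `|x|.
  by move=> /andP[z0 zx]; rewrite !ler0_norm ?lerN2// (le_trans z0).
have := mean_value_bound (ltW x0) (fun z h => fd z (le1 z h)) (fun z h => fB z (le1 z h)).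
by rewrite distrC (ltr0_norm x0) (_ : 2 * (- x) ^+ 2 * (0 - x) = 2 * (- x) ^+ 3)//; ring.
Qed.

(** The antiderivative of cos^n vanishing at 0, through the usual reduction formula; it replaces the Wallis integrals. *)
Fixpoint cosint (n : nat) (x : R) : R :=
  match n with
  | 0 => x
  | 1 => sin x
  | (m.+1 as n').+1 => (sin x * cos x ^+ n' + n'%:R * cosint m x) / n'.+1%:R
  end.

Lemma nat_ind2 (Q : nat -> Prop) : Q 0%N -> Q 1%N -> (forall n, Q n -> Q n.+2) -> forall n, Q n.
Proof.
move=> q0 q1 qs n; suff : Q n /\ Q n.+1 by case.
by elim: n => [|n [h1 h2]]; split => //; exact: qs.
Qed.

Lemma cosint_derive n x : is_derive x (1:R) (cosint n) (cos x ^+ n).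
Proof.
elim/nat_ind2: n => [| |n IH]; first by rewrite expr0; exact: is_derive_id.
  by rewrite expr1; exact: is_derive_sin.
have dc := is_deriveX n.+1 (is_derive_cos x).
have ds := is_deriveM (is_derive_sin x) dc.
have := is_deriveZ (n.+2%:R^-1) (is_deriveD ds (is_deriveZ n.+1%:R IH)).
have n0 : (n.+2%:R : R) != 0 by rewrite pnatr_eq0.
rewrite (_ : _ \*: _ = cosint n.+2); last first.
  by apply/funext => u /=; rewrite /GRing.scale /= mulrC !fctE.
move=> h; apply: (is_derive_eq h); rewrite /GRing.scale /= !fctE.
have e := cos2Dsin2 x.
have -> : sin x * (n.+1%:R * cos x ^+ n * - sin x) = - (n.+1%:R * cos x ^+ n * sin x ^+ 2) by ring.
have -> : sin x ^+ 2 = 1 - cos x ^+ 2 by rewrite -e; ring.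
rewrite !exprS -[n.+2]addn1 natrD in n0 *.
clear dc ds h IH; move: (n.+1%:R : R) n0 => a n0.
by field.
Qed.

Lemma cosint0 n : cosint n 0 = 0.
Proof.
elim/nat_ind2: n => [| |n IH] //=; first by rewrite sin0.
by rewrite sin0 mul0r add0r IH mulr0 mul0r.
Qed.

(** The Wallis integral of cos^n from 0 to pi/2. *)
Definition wallis n : R := cosint n (pi / 2).

Lemma wallisS n : wallis n.+2 = n.+1%:R / n.+2%:R * wallis n.
Proof. by rewrite /wallis /= cos_pihalf exprS mul0r mulr0 add0r mulrAC. Qed.

Lemma wallis_le n : wallis n.+1 <= wallis n.
Proof.
rewrite -subr_ge0.
have p0 : (0:R) <= pi / 2 by rewrite divr_ge0// pi_ge0.
have d y : is_derive y (1:R) (fun y => cosint n y - cosint n.+1 y) (cos y ^+ n - cos y ^+ n.+1).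
  exact: is_deriveB (cosint_derive n y) (cosint_derive n.+1 y).
have c : {within `[0, pi / 2], continuous (fun y => cosint n y - cosint n.+1 y)}.
  by apply: derivable_within_continuous => y _; have [] := d y.
have [y hy e] := MVT_segment p0 (fun y _ => d y) c.
move: e; rewrite !cosint0 !subr0 -/(wallis n) -/(wallis n.+1) => ->.
rewrite mulr_ge0// exprS -{1}[cos y ^+ n]mul1r -mulrBl mulr_ge0// ?subr_ge0 ?cos_le1//.
apply: exprn_ge0; apply: cos_ge0_pihalf; move: hy; rewrite !in_itv /= => /andP[h1 h2].
by rewrite h2 andbT (le_trans _ h1)// oppr_le0.
Qed.

(** The central binomial coefficient binom(2n, n) divided by 4^n. *)
Definition cbr n : R := (n.*2)`!%:R / (n`!%:R ^+ 2 * 4 ^+ n).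

Lemma fact_neq0 n : (n`!%:R : R) != 0. Proof. by rewrite pnatr_eq0 -lt0n fact_gt0. Qed.

Lemma cbrS n : cbr n.+1 = (n.*2.+1)%:R / (n.*2.+2)%:R * cbr n.
Proof.
rewrite /cbr doubleS !factS !natrM (exprS (4:R)).
have h1 := fact_neq0 n; have h2 := fact_neq0 n.*2.
have h3 : (n.*2.+2%:R : R) = 2 * n.+1%:R by rewrite -natrM mul2n doubleS.
have h4 : (n.+1%:R : R) != 0 by rewrite pnatr_eq0.
have h5 : (4 : R) ^+ n != 0 by rewrite expf_neq0 ?pnatr_eq0.
rewrite h3; move: (_`!%:R) (_`!%:R) (n.+1%:R) (4 ^+ n) (n.*2.+1%:R) h1 h2 h4 h5 => a b c e f h1 h2 h4 h5.
by field; rewrite h1 h4 h5.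
Qed.

Lemma cbr_gt0 n : 0 < cbr n.
Proof. by rewrite divr_gt0 ?mulr_gt0 ?exprn_gt0 ?ltr0n ?fact_gt0. Qed.

Lemma wallis_even n : wallis n.*2 = pi / 2 * cbr n.
Proof.
elim: n => [|n IH]; first by rewrite /wallis /cbr /= fact0 expr1n expr0 !mulr1 divr1 mulr1.
by rewrite doubleS wallisS IH cbrS; ring.
Qed.

Lemma wallis_odd n : wallis n.*2.+1 = ((n.*2.+1)%:R * cbr n)^-1.
Proof.
elim: n => [|n IH].
  by rewrite /wallis /cbr /= sin_pihalf fact0 !(expr1n, expr0, mulr1, divr1, invr1).
rewrite doubleS wallisS IH cbrS.
have h1 := lt0r_neq0 (cbr_gt0 n).
have h2 : (n.*2.+1%:R : R) != 0 by rewrite pnatr_eq0.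
have h3 : (n.*2.+2%:R : R) != 0 by rewrite pnatr_eq0.
have h4 : (n.*2.+3%:R : R) != 0 by rewrite pnatr_eq0.
move: h2 h3 h4; move: (n.*2.+1%:R : R) (n.*2.+2%:R : R) (n.*2.+3%:R : R) => a b c h2 h3 h4.
by field; rewrite h1 h2 h3 h4.
Qed.

(** Monotonicity of the Wallis integrals squeezes the square of the central binomial coefficient. *)
Lemma wallis_bounds n : (0 < n)%N -> 1 - (n.*2.+1)%:R^-1 <= pi * n%:R * cbr n ^+ 2 <= 1.
Proof.
case: n => // n _.
have c0 := cbr_gt0 n.+1.
have h2 : 0 < ((n.+1).*2%:R : R) by rewrite ltr0n.
have h3 : 0 < ((n.+1).*2.+1%:R : R) by rewrite ltr0n.
have e2 : ((n.+1).*2%:R : R) = 2 * n.+1%:R by rewrite -natrM mul2n.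
apply/andP; split.
  have := wallis_le (n.+1).*2; rewrite wallis_even wallis_odd => h.
  have : 1 <= pi / 2 * cbr n.+1 * ((n.+1).*2.+1%:R * cbr n.+1).
    by rewrite -ler_pdivrMr ?mulr_gt0// div1r.
  have -> : 1 - (n.+1).*2.+1%:R^-1 = (n.+1).*2%:R / (n.+1).*2.+1%:R :> R.
    rewrite -[in LHS](natr1 (n.+1).*2) in h3 *; rewrite -natr1; field.
    by rewrite natr1 lt0r_neq0.
  move=> h'; rewrite ler_pdivrMr// e2.
  have := ler_wpM2l (ltW h2) h'; rewrite mulr1 e2; lra.
have := wallis_le n.*2.+1; rewrite wallis_odd -doubleS wallis_even => h.
have hc : cbr n.+1 = (n.*2.+1)%:R * cbr n / (n.+1).*2%:R by rewrite cbrS; ring.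
have : pi / 2 * cbr n.+1 * ((n.+1).*2%:R * cbr n.+1) <= 1.
  rewrite -ler_pdivlMr ?mulr_gt0// div1r (le_trans h)// hc.
  by rewrite [X in _ <= X^-1]mulrC mulfVK// lt0r_neq0.
rewrite e2; lra.
Qed.

(** The logarithm of n! e^n / n^(n + 1/2). *)
Definition stir (n : nat) : R := ln (n`!%:R) + n%:R - (n%:R + 1 / 2) * ln n%:R.

(** The terms of order 1/n cancel in the expansion of (n + 1/2) log (1 + 1/n) - 1. *)
Lemma stir_step n : (0 < n)%N -> `|stir n - stir n.+1| <= 10 / (n%:R * n.+1%:R).
Proof.
move=> n0; have nR : 0 < (n%:R : R) by rewrite ltr0n.
have n1 : 0 < (n.+1%:R : R) by rewrite ltr0n.
have fR : 0 < (n`!%:R : R) by rewrite ltr0n fact_gt0.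
pose x : R := n%:R^-1.
have x0 : 0 < x by rewrite invr_gt0.
have e : stir n - stir n.+1 = (1 / x + 1 / 2) * ln (1 + x) - 1.
  have hl : ln (n.+1%:R : R) = ln n%:R + ln (1 + x).
    rewrite -lnM ?posrE ?addr_gt0//; congr ln.
    by rewrite mulrDr mulr1 mulfV ?lt0r_neq0// natr1.
  rewrite /stir factS natrM lnM ?posrE// hl -natr1 /x invrK; ring.
have [n2|n2] := leqP 2 n; last first.
  have -> : n = 1%N by apply/eqP; rewrite eqn_leq n0 -ltnS n2.
  have h1 : stir 1 - stir 2 = 3 / 2 * ln 2 - 1.
    by rewrite /stir !factS fact0 !muln1 ln1; field.
  rewrite h1; have l2 : 0 <= ln (2 : R) by rewrite ln_ge0// ler1n.
  have l2' : ln (2 : R) <= 1.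
    rewrite -[leRHS]expRK ler_ln ?posrE ?expR_gt0//.
    by have := expR_ge1Dx (1 : R); rewrite -natr1.
  rewrite ler_norml; apply/andP; split; lra.
have x2 : x <= 1 / 2 by rewrite /x -[1 / 2]invrK lef_pV2 ?posrE ?invr_gt0 ?divr_gt0// div1r invrK ler_nat.
have := @ln1p_taylor x; rewrite (ger0_norm (ltW x0)) => /(_ x2).
set l := ln (1 + x); set T := l - x + x ^+ 2 / 2 => hT.
have -> : stir n - stir n.+1 = - x ^+ 2 / 4 + (1 / x + 1 / 2) * T.
  by rewrite e /T -/l; field; exact: lt0r_neq0.
have k : 0 <= 1 / x + 1 / 2 by rewrite addr_ge0// divr_ge0// ltW.
have h3 : `|(1 / x + 1 / 2) * T| <= 2 * x ^+ 2 + x ^+ 3.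
  rewrite normrM (ger0_norm k) (le_trans (ler_wpM2l k hT))//.
  by rewrite le_eqVlt; apply/orP; left; apply/eqP; field; exact: lt0r_neq0.
rewrite (le_trans (ler_normD _ _))//.
apply: (@le_trans _ _ (x ^+ 2 / 4 + (2 * x ^+ 2 + x ^+ 3))).
  by rewrite lerD// mulNr normrN ger0_norm// divr_ge0// sqr_ge0.
apply: (@le_trans _ _ (5 * x ^+ 2)).
  have := sqr_ge0 x; have : x ^+ 3 <= x ^+ 2 by rewrite exprS ler_piMl ?sqr_ge0//; lra.
  lra.
rewrite invfM -/x expr2.
have xx : x <= 2 * n.+1%:R^-1.
  by rewrite ler_pdivlMr// /x mulrC ler_pdivrMr// -natrM ler_nat; lia.
have -> : 10 * (x * n.+1%:R^-1) = 5 * (x * (2 * n.+1%:R^-1)) by ring.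
by rewrite ler_wpM2l// ler_wpM2l// ltW.
Qed.

Lemma stir_cvg : exists a, forall j, `|a - stir j.+1| <= 20 / j.+1%:R.
Proof.
have mono i k : `|stir i.+1 - stir (k + i).+1| <= 10 / i.+1%:R - 10 / (k + i).+1%:R.
  elim: k => [|k IH]; first by rewrite add0n !subrr normr0.
  rewrite addSn -(subrK (stir (k + i).+1) (stir i.+1)) -addrA (le_trans (ler_normD _ _))//.
  rewrite (le_trans (lerD IH (stir_step _)))// -addrA lerD2l.
  have h1 : ((k + i).+1%:R : R) != 0 by rewrite pnatr_eq0.
  have h2 : ((k + i).+1%:R + 1 : R) != 0 by rewrite natr1 pnatr_eq0.
  rewrite -(natr1 (k + i).+1).
  move: h1 h2; move: ((k + i).+1%:R : R) => c h1 h2.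
  by rewrite le_eqVlt; apply/orP; left; apply/eqP; field; rewrite h1 h2.
have := @real_cauchy_rate (fun j => stir j.+1) 10.
rewrite (_ : 2 * 10 = 20 :> R); last by ring.
apply=> i j.
have p i' : 0 <= 10 / i'.+1%:R :> R by rewrite divr_ge0.
have [ij|ij] := leqP i j.
  have := mono i (j - i)%N; rewrite subnK// => h.
  have h' := le_trans (ler_norm _) h; move: h' (p j).
  by move: (10 / i.+1%:R : R) (10 / j.+1%:R : R) => a b; lra.
have := mono j (i - j)%N; rewrite subnK ?(ltnW ij)// distrC => h.
have h' : stir i.+1 - stir j.+1 <= 10 / j.+1%:R - 10 / i.+1%:R by exact: le_trans (ler_norm _) h.
move: h' (p i).
by move: (10 / i.+1%:R : R) (10 / j.+1%:R : R) => a b; lra.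
Qed.

(** The constant is found by comparing [stir n] with [stir (2 n)], which brings in the central binomial coefficient. *)
Lemma stir_double n : (0 < n)%N -> expR (stir n *+ 2 - stir n.*2) ^+ 2 = 2 / (n%:R * cbr n ^+ 2).
Proof.
move=> n0; have nR : 0 < (n%:R : R) by rewrite ltr0n.
have f1 : 0 < (n`!%:R : R) by rewrite ltr0n fact_gt0.
have f2 : 0 < ((n.*2)`!%:R : R) by rewrite ltr0n fact_gt0.
have c0 := cbr_gt0 n.
have lc : ln (cbr n) = ln (n.*2)`!%:R - (ln n`!%:R *+ 2 + n%:R * ln 4).
  rewrite /cbr ln_div ?posrE ?mulr_gt0 ?exprn_gt0// lnM ?posrE ?exprn_gt0//.
  by rewrite !lnXn// mulr_natl.
have l4 : ln (4 : R) = 2 * ln 2.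
  have -> : (4 : R) = 2 ^+ 2 by ring.
  by rewrite lnXn// mulr_natl.
have l2n : ln (n.*2%:R : R) = ln 2 + ln n%:R.
  by rewrite -lnM ?posrE// -natrM mul2n.
rewrite -expRM_natl -[RHS]lnK ?posrE ?divr_gt0 ?mulr_gt0 ?exprn_gt0//; congr expR.
rewrite ln_div ?posrE ?mulr_gt0 ?exprn_gt0// lnM ?posrE ?exprn_gt0// lnXn// lc l4.
rewrite /stir l2n (_ : n.*2%:R = 2 * n%:R :> R); last by rewrite -natrM mul2n.
by field.
Qed.

Lemma stirling : expR (stir n) @[n --> \oo] --> Num.sqrt (2 * pi : R).
Proof.
have [a ha] := stir_cvg.
have sa : stir n @[n --> \oo] --> a.
  rewrite -(cvg_shiftS stir); apply/cvgrPdist_le => e e0.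
  exists (Num.truncn (20 / e)) => // j /= hj; apply: (le_trans (ha j)).
  rewrite ler_pdivrMr// mulrC -ler_pdivrMr// ltW//.
  by apply: (lt_le_trans (truncnS_gt _)); rewrite ler_nat.
have ea : expR (stir n) @[n --> \oo] --> expR a.
  by apply: continuous_cvg => //; exact: continuous_expR.
suff -> : Num.sqrt (2 * pi) = expR a by [].
have s2 : stir n.*2 @[n --> \oo] --> a.
  apply: cvg_comp sa.
  by move=> U [N _ hU]; exists N => // n /= h; apply: hU; rewrite /= (leq_trans h)// -addnn leq_addr.
have lim1 : expR (stir n *+ 2 - stir n.*2) ^+ 2 @[n --> \oo] --> expR a ^+ 2.
  have h : expR (stir n *+ 2 - stir n.*2) @[n --> \oo] --> expR a.
    apply: continuous_cvg; first exact: continuous_expR.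
    by rewrite -[X in _ --> X](addrK a a) -mulr2n; apply: cvgB => //; apply: cvgMn.
  by rewrite (_ : (fun n => _) = (fun n => expR (stir n *+ 2 - stir n.*2) * expR (stir n *+ 2 - stir n.*2)))//; apply: cvgM.
have lim2 : pi * n%:R * cbr n ^+ 2 @[n --> \oo] --> (1 : R).
  apply/cvgrPdist_le => e e0; exists (Num.truncn (1 / e)).+1 => // n /= hn.
  have /andP[w1 w2] := wallis_bounds (leq_ltn_trans (leq0n _) hn).
  apply: (@le_trans _ _ (n.*2.+1%:R^-1)); first by rewrite ger0_norm ?subr_ge0// lerBlDr -lerBlDl.
  rewrite -div1r ler_pdivrMr// mulrC -ler_pdivrMr// ltW//.
  apply: (lt_le_trans (truncnS_gt _)); rewrite ler_nat (leq_trans hn)// -addnn.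
  by rewrite (leq_trans (leq_addr n n)).
have pp := pi_gt0 R.
have lim3 : expR (stir n *+ 2 - stir n.*2) ^+ 2 @[n --> \oo] --> 2 * pi.
  have : 2 * pi / (pi * n%:R * cbr n ^+ 2) @[n --> \oo] --> 2 * pi / 1.
    by apply: cvgM; [exact: cvg_cst|apply: cvgV => //; exact: oner_neq0].
  rewrite divr1; apply: cvg_trans; apply: near_eq_cvg; exists 1%N => // n hn.
  rewrite stir_double//.
  have n1 : (n%:R : R) != 0 by rewrite pnatr_eq0 -lt0n.
  have c1 := lt0r_neq0 (cbr_gt0 n); have p1 := lt0r_neq0 pp.
  move: (pi : R) (n%:R : R) (cbr n) p1 n1 c1 => u v w p1 n1 c1.
  by field; rewrite p1 n1 c1.
have <- := cvg_unique (@Rhausdorff R) lim1 lim3.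
by rewrite sqrtr_sqr ger0_norm// expR_ge0.
Qed.
End Stirling.

(** * Extracting a coefficient *)

Section CoefCircle.
Variable R : realType.
Local Notation C := (Cplx R).
Implicit Types (r lam : R) (q G : {poly C}).

(** The Taylor polynomial of e^(lam z), in place of the entire function. *)
Definition expP lam M : {poly C} := \poly_(l < M) ((lam ^+ l / l`!%:R)%:C).

Lemma expPE lam M z : (expP lam M).[z] = exptrunc M (lam%:C * z).
Proof.
rewrite /expP horner_poly /exptrunc; apply: eq_bigr => l _.
rewrite exprMn rmorphM fmorphV rmorph_nat rmorphXn; ring.
Qed.

Lemma exp_tail (L e : R) : 0 <= L -> 0 < e -> exists m0, forall m, (m0 <= m)%N -> L ^+ m / m`!%:R <= e.
Proof.
move=> L0 e0.
have := cvg_series_cvg_0 (is_cvg_series_exp_coeff L).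
move=> /cvgrPdist_le /(_ e e0)[m0 _ h]; exists m0 => m hm.
by have := h m hm; rewrite sub0r normrN; apply: le_trans; exact: ler_norm.
Qed.

(** The left side is the coefficient of order [k + 2] of G - q e^(lam z).  The exponential is replaced by a Taylor polynomial of large degree, at the cost of an arbitrarily small [e], so that discrete Fourier inversion applies. *)
Lemma coef_circle G q lam r S k N0 : 0 < r -> (size q <= 3)%N -> lam != 0 ->
  (forall M, (N0 <= M)%N -> ravg M (fun u => nrm (G.[r%:C * cis u] - q.[r%:C * cis u] * cexp ((lam * r)%:C * cis u))) <= S) ->
  nrm (G`_k.+2 - (lam ^+ k.+2 / k.+2`!%:R)%:C * (q`_0 + q`_1 * (k.+2%:R / lam)%:C + q`_2 * (k.+2%:R * k.+1%:R / lam ^+ 2)%:C)) * r ^+ k.+2 <= S.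
Proof.
move=> r0 sq l0 hS.
pose Bq := \sum_(i < size q) nrm q`_i * r ^+ i.
have Bq0 : 0 <= Bq by rewrite sumr_ge0// => i _; rewrite mulr_ge0 ?nrm_ge0 ?exprn_ge0// ltW.
pose L := 2 * (`|lam| * r).
have L0 : 0 <= L by rewrite !mulr_ge0// ltW.
apply/ler_addgt0Pr => e e0.
pose D := (Bq + 1) * expR (`|lam| * r).
have D0 : 0 < D by rewrite mulr_gt0 ?expR_gt0// ltr_wpDl.
have [m0 hm0] := exp_tail L0 (divr_gt0 e0 D0).
pose m := maxn m0 k.+3.
pose p := G - q * expP lam m.
have coefE : p`_k.+2 = G`_k.+2 - (lam ^+ k.+2 / k.+2`!%:R)%:C * (q`_0 + q`_1 * (k.+2%:R / lam)%:C + q`_2 * (k.+2%:R * k.+1%:R / lam ^+ 2)%:C).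
  rewrite /p coefB coefM; congr (_ - _).
  rewrite !big_ord_recl /= /bump /= !add1n !subn0 !subSS subn0 big1 ?addr0; last first.
    move=> i _; rewrite (_ : q`__ = 0) ?mul0r//.
    by apply: nth_default; rewrite (leq_trans sq).
  rewrite !coef_poly ?subn0.
  have -> : (k.+2 < m)%N by rewrite /m leq_max leqnn orbT.
  have -> : (k.+1 < m)%N by rewrite /m leq_max orbC ltnW.
  have -> : (k < m)%N by rewrite /m leq_max orbC ltnW// ltnW.
  have f0 : (k`!%:R : R) != 0 by rewrite pnatr_eq0 -lt0n fact_gt0.
  have k1 : (k.+1%:R : R) != 0 by rewrite pnatr_eq0.
  have k2 : (k.+2%:R : R) != 0 by rewrite pnatr_eq0.
  have e1 : lam ^+ k.+1 / k.+1`!%:R = lam ^+ k.+2 / k.+2`!%:R * (k.+2%:R / lam).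
    rewrite !factS !natrM !exprS; move: f0 k1 k2; move: (k`!%:R : R) (k.+1%:R : R) (k.+2%:R : R) => a b c f0 k1 k2.
    by field; rewrite f0 k1 k2 l0.
  have e2 : lam ^+ k / k`!%:R = lam ^+ k.+2 / k.+2`!%:R * (k.+2%:R * k.+1%:R / lam ^+ 2).
    rewrite !factS !natrM !exprS; move: f0 k1 k2; move: (k`!%:R : R) (k.+1%:R : R) (k.+2%:R : R) => a b c f0 k1 k2.
    by field; rewrite f0 k1 k2 l0.
  rewrite e1 e2 !(rmorphM _ (lam ^+ k.+2 / k.+2`!%:R)); ring.
rewrite -coefE.
pose M := maxn N0 (maxn (size p) k.+2).
have h1 : nrm p`_k.+2 * r ^+ k.+2 <= ravg M (fun u => nrm p.[r%:C * cis u]).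
  by apply: coef_le_ravg; [exact: ltW| |]; rewrite /M; lia.
apply: (le_trans h1).
have hM : (N0 <= M)%N by rewrite /M leq_maxl.
rewrite -{1}(ravg_cst M e) (le_trans _ (lerD (hS M hM) (lexx _)))// ravgD; apply: le_ravg => u _.
set z := r%:C * cis u.
have zr : nrm z = r by rewrite /z nrmM nrm_cis mulr1 nrm_real ger0_norm// ltW.
have -> : p.[z] = (G.[z] - q.[z] * cexp ((lam * r)%:C * cis u)) + q.[z] * (cexp (lam%:C * z) - exptrunc m (lam%:C * z)).
  rewrite /p hornerD hornerN hornerM expPE /z mulrA -rmorphM; ring.
rewrite (le_trans (nrmD _ _))// lerD2l nrmM.
have hz : nrm (lam%:C * z) = `|lam| * r by rewrite nrmM nrm_real zr.
have qB : nrm q.[z] <= Bq by rewrite (le_trans (nrm_horner _ _))// zr.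
rewrite (le_trans (ler_pM (nrm_ge0 _) (nrm_ge0 _) qB (exptrunc_bound m _)))// hz -/L.
apply: (@le_trans _ _ (Bq * (expR (`|lam| * r) * (e / D)))).
  rewrite ler_wpM2l// -mulrA ler_wpM2l ?expR_ge0// hm0// /m leq_maxl//.
have -> : Bq * (expR (`|lam| * r) * (e / D)) = e * (Bq * expR (`|lam| * r) / D) by ring.
rewrite ler_piMr ?(ltW e0)// ler_pdivrMr// mul1r /D ler_wpM2r ?expR_ge0//.
by rewrite lerDl.
Qed.

(** A telescoping majorant: the sum is compared with that of 2/((1 + x)(1 + x + h)) over x = j h. *)
Lemma sum_cauchy_le (h : R) m : 0 < h -> \sum_(j < m) (1 + (h * j.+1%:R) ^+ 2)^-1 <= 2 / h.
Proof.
move=> h0.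
suff : \sum_(j < m) (1 + (h * j.+1%:R) ^+ 2)^-1 <= 2 / h * (1 - (1 + h * m%:R)^-1).
  move=> /le_trans; apply; rewrite ler_piMr ?divr_ge0 ?(ltW h0)//.
  by rewrite lerBlDr lerDl invr_ge0 addr_ge0// mulr_ge0// ltW.
elim: m => [|m IH]; first by rewrite big_ord0 mulr0 addr0 invr1 subrr mulr0.
rewrite big_ord_recr /= (le_trans (lerD IH (lexx _)))//.
have m0 : 0 <= (m%:R : R) by [].
rewrite -(natr1 m); set x := h * m%:R.
have x0 : 0 <= x by rewrite mulr_ge0// ltW.
have -> : h * (m%:R + 1) = x + h by rewrite /x; ring.
have p1 : 0 < 1 + x by rewrite ltr_pwDl.
have p2 : 0 < 1 + (x + h) by rewrite ltr_pwDl// addr_ge0// ltW.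
have -> : 2 / h * (1 - (1 + (x + h))^-1) = 2 / h * (1 - (1 + x)^-1) + 2 / ((1 + x) * (1 + (x + h))).
  by field; rewrite !lt0r_neq0.
rewrite lerD2l.
have p3 : 0 < 1 + (x + h) ^+ 2 by rewrite ltr_pwDl// sqr_ge0.
rewrite -[leLHS]div1r ler_pdivrMr// mulrAC ler_pdivlMr ?mulr_gt0//.
have := sqr_ge0 (x + h - 1); nra.
Qed.

(** A Riemann sum of 1/(1 + a u^2) over the circle.  The Cauchy profile dominates the Gaussian and its cubic moment ([exp_cubic]) and can be summed by hand. *)
Lemma ravg_cauchy_le (a : R) : 0 < a -> exists N0, forall M, (N0 <= M)%N ->
  ravg M (fun u => (1 + a * u ^+ 2)^-1) <= 2 / Num.sqrt a.
Proof.
move=> a0; pose s := Num.sqrt a.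
have s0 : 0 < s by rewrite sqrtr_gt0.
have s2 : s ^+ 2 = a by rewrite sqr_sqrtr// ltW.
exists (Num.truncn s) => M hM.
pose N : R := M.*2.+1%:R.
have N1 : 0 < N by rewrite ltr0n.
have Ns : s <= N.
  by rewrite ltW// (lt_le_trans (truncnS_gt _))// ler_nat ltnS (leq_trans hM)// -addnn leq_addr.
pose h : R := 2 * pi * s / N.
have pp := pi_gt0 R.
have h0 : 0 < h by rewrite divr_gt0 ?mulr_gt0.
pose phi (x : R) := (1 + (h * x) ^+ 2)^-1.
have E (l : nat) : (1 + a * ang R M l ^+ 2)^-1 = phi (l%:R - M%:R).
  rewrite /phi /ang -s2 /h -/N; congr (1 + _)^-1; field; exact: lt0r_neq0.
rewrite /ravg; under eq_bigr do rewrite E.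
have -> : \sum_(i < M.*2.+1) phi (i%:R - M%:R) = 1 + \sum_(j < M) phi j.+1%:R + \sum_(j < M) phi j.+1%:R.
  have -> : M.*2.+1 = (M + M.+1)%N by rewrite addnS addnn.
  rewrite big_split_ord /= big_ord_recl /= addrA [_ + phi _]addrC; congr (_ + _ + _).
  - by rewrite addn0 subrr /phi mulr0 expr0n /= addr0 invr1.
  - rewrite (reindex_inj rev_ord_inj) /=; apply: eq_bigr => i _.
    rewrite natrB; last by have := ltn_ord i; lia.
    rewrite addrAC subrr sub0r /phi; congr (1 + _)^-1; ring.
  - apply: eq_bigr => i _; rewrite /bump /= add1n natrD addrAC subrr add0r//.
have hs := sum_cauchy_le M h0.
have N0 : N != 0 by exact: lt0r_neq0.
apply: (@le_trans _ _ (N^-1 * (1 + 2 / h + 2 / h))).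
  by rewrite ler_wpM2l ?invr_ge0 ?(ltW N1)// lerD// lerD2l.
have -> : N^-1 * (1 + 2 / h + 2 / h) = N^-1 + 2 / pi / s.
  rewrite /h; clear -pp s0 N0; clearbody s N.
  move: (pi : R) pp => q q0; field.
  by rewrite N0 !lt0r_neq0.
have -> : 2 / s = s^-1 + s^-1 by field; exact: lt0r_neq0.
rewrite lerD//; first by rewrite lef_pV2 ?posrE.
rewrite ler_piMl ?invr_ge0 ?(ltW s0)// ler_pdivrMr// mul1r; exact: pi_ge2.
Qed.

Lemma exp_cubic (y : R) : 0 <= y -> expR (- y ^+ 2) <= (1 + y ^+ 2)^-1 /\
   expR (- y ^+ 2) * y ^+ 3 <= 27 * (1 + y ^+ 2)^-1.
Proof.
move=> y0; have p1 : 0 < 1 + y ^+ 2 by rewrite ltr_pwDl// sqr_ge0.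
split; first by rewrite expRN lef_pV2 ?posrE ?expR_gt0// expR_ge1Dx.
have h3 : (1 + y ^+ 2 / 3) ^+ 3 <= expR (y ^+ 2).
  have -> : expR (y ^+ 2) = expR (y ^+ 2 / 3) ^+ 3 by rewrite -expRM_natl; congr expR; field.
  by rewrite lerXn2r ?nnegrE ?expR_ge0 ?expR_ge1Dx// addr_ge0// divr_ge0// sqr_ge0.
rewrite expRN mulrC ler_pdivrMr ?expR_gt0// mulrAC ler_pdivlMr//.
apply: (@le_trans _ _ (27 * (1 + y ^+ 2 / 3) ^+ 3)); last by rewrite ler_wpM2l.
have -> : 27 * (1 + y ^+ 2 / 3) ^+ 3 = (3 + y ^+ 2) ^+ 3 by field.
apply: (@le_trans _ _ ((1 + y ^+ 2) ^+ 3)); last first.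
  by rewrite lerXn2r ?nnegrE ?addr_ge0 ?sqr_ge0// lerD2r ler1n.
rewrite [leRHS]exprSr ler_wpM2r ?(ltW p1)//.
have : 0 <= y ^+ 3 by rewrite exprn_ge0.
have -> : (1 + y ^+ 2) ^+ 2 = 1 + 2 * y ^+ 2 + y * y ^+ 3 by ring.
have -> : y ^+ 3 = y * y ^+ 2 by ring.
have := sqr_ge0 (y - 1); have := sqr_ge0 (y ^+ 2 - y); nra.
Qed.
End CoefCircle.

Section CircleEstimate.
Variable R : realType.
Local Notation C := (Cplx R).

Lemma expR1_le4 : expR 1 <= 4 :> R.
Proof.
have h : expR (1 / 2) <= 2 :> R.
  have := expR_ge1Dx (- (1 / 2) : R); rewrite expRN => h1.
  have p := expR_gt0 (1 / 2 : R).
  have : 1 / 2 * expR (1 / 2) <= 1 :> R.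
    rewrite -ler_pdivlMr// [leRHS]div1r; apply: le_trans h1; lra.
  lra.
have -> : expR 1 = expR (1 / 2) * expR (1 / 2) :> R by rewrite -expRD -splitr.
have := expR_ge0 (1 / 2 : R); nra.
Qed.

Lemma exptrunc2 (z : C) : exptrunc 2 z = 1 + z.
Proof.
by rewrite !exptruncS /exptrunc big_ord0 expr0 expr1 !factS fact0 !muln1 invr1 !mul1r add0r.
Qed.

Lemma exptrunc3 (z : C) : exptrunc 3 z = 1 + z + 2^-1 * z ^+ 2.
Proof. by rewrite exptruncS exptrunc2 !factS fact0 !muln1. Qed.

(** The third order Taylor bound for e^(iu). *)
Lemma cos_le_quad (u : R) : `|u| <= 1 / 128 -> cos u <= 1 - u ^+ 2 / 4.
Proof.
move=> hu.
have n0 : nrm ((0 +i* u) : C) = `|u| by rewrite /nrm /= expr0n /= add0r sqrtr_sqr.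
have u1 : nrm ((0 +i* u) : C) <= 1 by rewrite n0; lra.
have := @exptruncE R 3 _ u1; rewrite n0.
have -> : cexp ((0 +i* u) : C) = cis u by rewrite cexpE expR0 mul1r.
move=> /(le_trans (Re_le_nrm _)) /(le_trans (ler_norm _)).
rewrite ReB exptrunc3 !ReD.
have -> : complex.Re ((2%:R^-1 : C) * ((0 +i* u) : C) ^+ 2) = - (u ^+ 2 / 2).
  by rewrite natC -fmorphV ReMr expr2 /= mul0r sub0r -expr2; ring.
rewrite /= addr0 => h.
have e4 := expR1_le4.
have h8 : expR 1 * (2 * `|u|) ^+ 3 <= u ^+ 2 / 4.
  rewrite exprMn -(real_normK (num_real u)) exprS mulrA mulrA.
  have : expR 1 * 2 ^+ 3 * `|u| <= 1 / 4.
    have := normr_ge0 u; have := expR_ge0 (1 : R); nra.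
  have := sqr_ge0 `|u|; nra.
lra.
Qed.

(** Saddle point estimate on the circle of radius [k / lam].  For small angles e^(k cos u) is at most e^k e^(-k u^2 / 4), whose average is of order k^(-1/2), and an additional factor |u|^3 contributes k^(-3/2); the remaining angles contribute [Aw]. *)
Lemma circle_estimate (G q : {poly C}) (lam E Aw u0 : R) (k : nat) :
  let kR : R := k.+2%:R in let r := kR / lam in
  0 < lam -> (size q <= 3)%N -> 0 < u0 -> u0 <= 1 / 128 -> 0 <= E -> 0 <= Aw ->
  (forall u, `|u| <= u0 -> nrm (G.[r%:C * cis u] - q.[r%:C * cis u] * cexp (kR%:C * cis u))
      <= E * expR (kR * cos u) * (`|ln r| ^+ 3 + `|u| ^+ 3)) ->
  (forall u, u0 <= `|u| -> `|u| <= pi ->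
      nrm (G.[r%:C * cis u] - q.[r%:C * cis u] * cexp (kR%:C * cis u)) <= Aw) ->
  nrm (G`_k.+2 - (lam ^+ k.+2 / k.+2`!%:R)%:C * (q`_0 + q`_1 * (kR / lam)%:C + q`_2 * (kR * k.+1%:R / lam ^+ 2)%:C)) * r ^+ k.+2
   <= E * expR kR * (864 * (`|ln r| ^+ 3 / Num.sqrt kR + 1 / kR ^+ 2)) + Aw.
Proof.
move=> kR r lam0 sq u00 u01 E0 Aw0 near away.
have k0 : 0 < kR by rewrite ltr0n.
have r0 : 0 < r by rewrite divr_gt0.
have lr : lam * r = kR by rewrite /r mulrCA mulfV ?mulr1// lt0r_neq0.
pose sk := Num.sqrt kR.
have sk0 : 0 < sk by rewrite sqrtr_gt0.
have sk2 : sk ^+ 2 = kR by rewrite sqr_sqrtr// ltW.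
pose a := kR / 4.
have a0 : 0 < a by rewrite divr_gt0.
have sa : Num.sqrt a = sk / 2.
  have -> : a = (sk / 2) ^+ 2 by rewrite expr_div_n sk2 /a; field.
  by rewrite sqrtr_sqr ger0_norm// divr_ge0// ltW.
have [N0 hN0] := ravg_cauchy_le a0.
pose s3 := `|ln r| ^+ 3.
have s30 : 0 <= s3 by rewrite exprn_ge0.
pose Cn := E * expR kR * (s3 + 216 / sk ^+ 3).
have Cn0 : 0 <= Cn.
  apply: mulr_ge0; first by apply: mulr_ge0 => //; exact: expR_ge0.
  by apply: addr_ge0 => //; apply: divr_ge0 => //; apply: exprn_ge0; exact: ltW.
apply: (@coef_circle R G q lam r (E * expR kR * (864 * (s3 / sk + 1 / kR ^+ 2)) + Aw) k N0 r0 sq (lt0r_neq0 lam0)) => M hM.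
apply: (@le_trans _ _ (ravg M (fun u => Cn * (1 + a * u ^+ 2)^-1 + Aw))).
  apply: le_ravg => u upi; rewrite lr.
  have i0 : 0 <= (1 + a * u ^+ 2)^-1.
    by rewrite invr_ge0 addr_ge0// mulr_ge0 ?sqr_ge0// ltW.
  have [hu|hu] := leP `|u| u0; last first.
    by apply: (le_trans (away u (ltW hu) upi)); rewrite lerDr mulr_ge0.
  apply: (le_trans (near u hu)).
  apply: (@le_trans _ _ (Cn * (1 + a * u ^+ 2)^-1)); last by rewrite lerDl.
  pose y := sk * `|u| / 2.
  have y0 : 0 <= y by rewrite divr_ge0// mulr_ge0// ltW.
  have y2 : y ^+ 2 = a * u ^+ 2.
    by rewrite /y expr_div_n exprMn sk2 real_normK ?num_real// /a; field.
  have [c1 c2] := exp_cubic y0; rewrite y2 in c1 c2.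
  have ec : expR (kR * cos u) <= expR kR * expR (- (a * u ^+ 2)).
    rewrite -expRD ler_expR.
    have := cos_le_quad (le_trans hu u01) => hc.
    have -> : kR + - (a * u ^+ 2) = kR * (1 - u ^+ 2 / 4) by rewrite /a; field.
    by rewrite ler_wpM2l// ltW.
  have u3 : `|u| ^+ 3 = 8 * y ^+ 3 / sk ^+ 3.
    by rewrite /y; field; exact: lt0r_neq0.
  rewrite u3 -/s3.
  apply: (@le_trans _ _ (E * (expR kR * expR (- (a * u ^+ 2))) * (s3 + 8 * y ^+ 3 / sk ^+ 3))).
    rewrite ler_wpM2r ?addr_ge0 ?divr_ge0 ?mulr_ge0 ?exprn_ge0 ?(ltW sk0)//.
    by rewrite ler_wpM2l.
  have -> : E * (expR kR * expR (- (a * u ^+ 2))) * (s3 + 8 * y ^+ 3 / sk ^+ 3) =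
     E * expR kR * (s3 * expR (- (a * u ^+ 2)) + 8 / sk ^+ 3 * (expR (- (a * u ^+ 2)) * y ^+ 3)).
    by field; exact: lt0r_neq0.
  have -> : Cn * (1 + a * u ^+ 2)^-1 = E * expR kR * (s3 * (1 + a * u ^+ 2)^-1 + 8 / sk ^+ 3 * (27 * (1 + a * u ^+ 2)^-1)).
    by rewrite /Cn; ring.
  rewrite ler_wpM2l ?mulr_ge0 ?expR_ge0// lerD// ler_wpM2l// divr_ge0// exprn_ge0// ltW//.
rewrite -ravgD ravg_cst lerD2r.
have -> : ravg M (fun u => Cn * (1 + a * u ^+ 2)^-1) = Cn * ravg M (fun u => (1 + a * u ^+ 2)^-1).
  by rewrite /ravg -mulr_sumr mulrCA.
apply: (le_trans (ler_wpM2l Cn0 (hN0 M hM))).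
rewrite sa /Cn -[leLHS]mulrA ler_wpM2l//; first by apply: mulr_ge0 => //; exact: expR_ge0.
have -> : kR ^+ 2 = sk ^+ 4 by rewrite -sk2; ring.
clearbody s3 sk.
have -> : (s3 + 216 / sk ^+ 3) * (2 / (sk / 2)) = 4 * (s3 / sk) + 864 * (1 / sk ^+ 4).
  by field; exact: lt0r_neq0.
rewrite mulrDr lerD2r ler_wpM2r ?ler_nat// divr_ge0//; exact: ltW.
Qed.

(** The change of variable from beta to e^beta - 1 up to third order; since (e^beta - 1)^2 = beta^2 + O(beta^3) and e^beta - 1 = beta + beta^2/2 + O(beta^3), the quadratic coefficient becomes b - a/2. *)
Lemma taylor_exp_change (a b beta : C) (B : R) : nrm beta <= 1 -> nrm a <= B -> nrm b <= B ->
  nrm (a * beta + b * beta ^+ 2 - (a * (cexp beta - 1) + (b - a / 2) * (cexp beta - 1) ^+ 2))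
  <= 1000 * B * nrm beta ^+ 3.
Proof.
move=> b1 aB bB.
have B0 : 0 <= B by exact: le_trans (nrm_ge0 _) aB.
have e4 := expR1_le4.
set x := nrm beta in b1 *; have x0 : 0 <= x by exact: nrm_ge0.
have E3 := @exptruncE R 3 _ b1; have E2 := @exptruncE R 2 _ b1.
rewrite -/x in E3 E2.
rewrite exptrunc3 in E3; rewrite exptrunc2 in E2.
pose S2 := cexp beta - (1 + beta); pose S3 := cexp beta - (1 + beta + 2^-1 * beta ^+ 2).
have h2 : nrm S2 <= 16 * x ^+ 2.
  apply: (le_trans E2); rewrite exprMn mulrA ler_wpM2r ?sqr_ge0//; lra.
have h3 : nrm S3 <= 32 * x ^+ 3.
  apply: (le_trans E3); rewrite exprMn mulrA ler_wpM2r ?exprn_ge0//.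
  have -> : 2 ^+ 3 = 8 :> R by ring.
  lra.
have -> : a * beta + b * beta ^+ 2 - (a * (cexp beta - 1) + (b - a / 2) * (cexp beta - 1) ^+ 2) =
  - (a * S3) - (b - a / 2) * (S2 * (S2 + 2 * beta)).
  have -> : cexp beta = S3 + (1 + beta + 2^-1 * beta ^+ 2) by rewrite subrK.
  have -> : S2 = S3 + 2^-1 * beta ^+ 2 by rewrite /S2 /S3; ring.
  by field.
rewrite (le_trans (nrmB _ _))// nrmN !nrmM.
have h4 : nrm (b - a / 2) <= 3 / 2 * B.
  rewrite (le_trans (nrmB _ _))// nrmM nrmV (nrm_nat R 2); lra.
have h5 : nrm (S2 + 2 * beta) <= 18 * x.
  rewrite (le_trans (nrmD _ _))// nrmM (nrm_nat R 2) -/x.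
  have : x ^+ 2 <= x by rewrite expr2 ler_piMl.
  lra.
have i1 : nrm a * nrm S3 <= B * (32 * x ^+ 3) by apply: ler_pM => //; exact: nrm_ge0.
have i2 : nrm S2 * nrm (S2 + 2 * beta) <= 16 * x ^+ 2 * (18 * x) by apply: ler_pM => //; exact: nrm_ge0.
have i3 : nrm (b - a / 2) * (nrm S2 * nrm (S2 + 2 * beta)) <= 3 / 2 * B * (16 * x ^+ 2 * (18 * x)).
  by apply: ler_pM => //; [exact: nrm_ge0|rewrite mulr_ge0 ?nrm_ge0].
apply: (le_trans (lerD i1 i3)).
have -> : B * (32 * x ^+ 3) + 3 / 2 * B * (16 * x ^+ 2 * (18 * x)) = 464 * (B * x ^+ 3) by field.
by rewrite -mulrA ler_wpM2r ?mulr_ge0 ?exprn_ge0// ler_nat.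
Qed.
End CircleEstimate.

(** * The martingale near 0 *)

Section Biggins.
Variable R : realType.
Local Notation C := (Cplx R).

Lemma uniform_nrm (K : set C) (f : nat -> C -> C) (g : C -> C) :
  {uniform K, f @ \oo --> g} -> forall e : R, 0 < e ->
  exists N, forall n, (N <= n)%N -> forall z, K z -> nrm (g z - f n z) <= e.
Proof.
move=> h e e0.
have e0' : 0 < e%:C :> C by rewrite ltcR.
have := h _ (proj2 (uniform_nbhs _ _) (ex_intro _ _ (conj (entourage_ball C (PosNum e0')) (fun x hx => hx)))).
move=> [N _ hN]; exists N => n hn z Kz.
have := hN n hn z Kz; rewrite /= -ball_normE /= norm_nrm ltcR; exact: ltW.
Qed.

Lemma compact_square (rho : R) : compact [set z : C | `|complex.Re z| <= rho /\ `|complex.Im z| <= rho].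
Proof.
pose S : set (R * R) := `[- rho, rho]%classic `*` `[- rho, rho]%classic.
have cS : compact S by apply: compact_setX; exact: segment_compact.
pose f (p : R * R) : C := p.1 +i* p.2.
have cf : continuous f.
  move=> [a b]; apply/cvg_nrmP => e e0.
  have e2 : 0 < e / 2 by rewrite divr_gt0.
  have h1 : \forall p \near (a, b), `|a - p.1| < e / 2.
    have : p.1 @[p --> (a, b)] --> a by exact: cvg_fst.
    by move=> /cvgrPdist_lt; apply.
  have h2 : \forall p \near (a, b), `|b - p.2| < e / 2.
    have : p.2 @[p --> (a, b)] --> b by exact: cvg_snd.
    by move=> /cvgrPdist_lt; apply.
  apply: filterS2 h1 h2 => -[c d] /= h1 h2.
  apply: (le_trans (nrm_le_ReIm ((a +i* b) - (c +i* d) : C))) => /=.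
  by rewrite (splitr e) lerD// ltW.
have := continuous_compact (continuous_subspaceT cf) cS.
rewrite (_ : [set f x | x in S] = [set z : C | `|complex.Re z| <= rho /\ `|complex.Im z| <= rho])//.
apply/seteqP; split.
  move=> z [[a b] [/= ha hb] <-]; move: ha hb.
  by rewrite /= !in_itv /= -!ler_norml.
move=> [a b] /= [h1 h2]; exists (a, b) => //; split; rewrite /= in_itv /= -ler_norml//.
Qed.

Lemma bigginsW_genF n t (beta : C) :
  bigginsW n t beta = cexp (- (2 * cexp beta - 1) * (ln n%:R)%:C) * genF t (cexp beta).
Proof.
rewrite /bigginsW /genF; congr (_ * _); apply: eq_bigr => v _.
by rewrite -cexpMn mulr_natr.
Qed.

Lemma genF_bigginsW n t (beta : C) :
  genF t (cexp beta) = cexp ((2 * cexp beta - 1) * (ln n%:R)%:C) * bigginsW n t beta.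
Proof. by rewrite bigginsW_genF mulrA -cexpD mulNr subrr cexp0 mul1r. Qed.

Lemma pa_bigginsW rho n t : polyapprox rho (bigginsW (R := R) n t).
Proof.
rewrite (_ : bigginsW n t = (fun beta => cexp (- (ln n%:R)%:C * (2 * cexp beta - 1)) * \sum_(v <- external t) cexp beta ^+ size v)).
  apply: pa_mul; last by apply: pa_sum => v; apply: pa_exp; apply: pa_cexp; exact: pa_id.
  apply: pa_cexp; apply: pa_scale; apply: pa_sub; last exact: pa_cst.
  by apply: pa_scale; apply: pa_cexp; exact: pa_id.
apply/funext => beta; rewrite bigginsW_genF /genF; congr (cexp _ * _).
by rewrite !mulNr mulrC.
Qed.

Lemma cexp_near1 (beta : C) : nrm beta <= 1 / 16 -> nrm (cexp beta - 1) <= 1 / 2.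
Proof.
move=> b1.
have := @exptruncE R 1 beta ltac:(lra).
rewrite exptruncS /exptrunc big_ord0 expr0 add0r invr1 mulr1 expr1 => h.
by have := expR1_le4 R; have := nrm_ge0 beta; nra.
Qed.

Lemma ReN (z : C) : complex.Re (- z) = - complex.Re z. Proof. by case: z. Qed.

Lemma Re2M (z : C) : complex.Re (2 * z) = 2 * complex.Re z.
Proof. by rewrite !mulr_natl !mulr2n ReD. Qed.

(** The normalisation of W_n cancels the growth found in [m2_near]. *)
Lemma moment_bigginsW n (beta : C) : (0 < n)%N -> nrm beta <= 1 / 16 ->
  EE n (fun t => nrm (bigginsW n t beta) ^+ 2) <= 9 * expR 4.
Proof.
move=> n0 b1.
have z1 := cexp_near1 b1.
set z := cexp beta in z1.
pose s := 4 * complex.Re z - 2.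
have hRe : `|complex.Re z - 1| <= 1 / 2.
  have := Re_le_nrm (z - 1); rewrite ReB => h; exact: le_trans h z1.
have [re1 re2] : 1 / 2 <= complex.Re z /\ complex.Re z <= 3 / 2.
  by move: hRe; rewrite ler_norml => /andP[? ?]; split; lra.
have e : EE n (fun t => nrm (bigginsW n t beta) ^+ 2) = expR (- s * ln n%:R) * m2 n z.
  rewrite /m2 -EE_scale; apply: eq_EE => t _.
  rewrite bigginsW_genF -/z nrmM exprMn nrm_cexp -expRM_natl; congr (expR _ * _).
  rewrite [_ * _%:C]mulrC ReMr ReN ReB Re2M.
  by rewrite /s /=; ring.
rewrite e; have h := m2_near n z1.
have hs : 0 <= s by rewrite /s; lra.
have hq := Qprod_le hs n0.
have p0 : expR (- s * ln n%:R) * pw n s = 1 by rewrite /pw -expRD mulNr addNr expR0.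
have e4 : expR s <= expR 4 by rewrite ler_expR /s; lra.
have := expR_ge0 (- s * ln (n%:R : R)); have := pw_ge0 n s; have := expR_ge0 s.
move: (expR (- s * _)) (pw n s) p0 (expR s) (expR 4) e4 (m2 n z) (Qprod n s) h hq => a p ap b b' bb' m q h hq b0 p0 a0.
have : m <= 9 * (b * p) by rewrite -/s in h; apply: (le_trans h); rewrite ler_pM2l.
move=> /(ler_wpM2l a0) /le_trans; apply.
by rewrite (_ : a * (9 * (b * p)) = 9 * b * (a * p)); [rewrite ap mulr1 ler_pM2l | ring].
Qed.
End Biggins.

Section Limits.
Variable R : realType.
Local Notation C := (Cplx R).

Lemma cvg_nrm_seq (f : nat -> C) (l : C) :
  (f @ \oo --> l) <-> (forall e : R, 0 < e -> exists N, forall n, (N <= n)%N -> nrm (l - f n) <= e).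
Proof.
split.
  by move=> /cvg_nrmP h e /h [N _ hN]; exists N => n hn; apply: hN.
by move=> h; apply/cvg_nrmP => e /h [N hN]; exists N => // n hn; apply: hN.
Qed.

(** If the power series converges at a point of modulus r, its terms are bounded there, and the series converges geometrically on the disc of radius r/2.  This turns pointwise convergence into uniform convergence. *)
Lemma pa_analytic (D : set C) f : analytic_on D f -> D 0 ->
  exists2 rho, 0 < rho & polyapprox rho f.
Proof.
move=> fD /fD [a /nbhs_nrmE[d d0 h]].
pose r := d / 2; have r0 : 0 < r by rewrite divr_gt0.
have S z n : series (fun j => a j * (z - 0) ^+ j) n = \sum_(0 <= j < n) a j * z ^+ j.
  by rewrite /series /= subr0.
have hr : nrm (r%:C - 0) < d.
  by rewrite subr0 nrm_real ger0_norm ?(ltW r0)// /r; lra.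
have [N hN] := proj1 (cvg_nrm_seq _ _) (h _ hr) 1 ltr01.
have ar n : (N <= n)%N -> nrm (a n) * r ^+ n <= 2.
  move=> Nn.
  have e : a n * r%:C ^+ n = (f r%:C - series (fun j => a j * (r%:C - 0) ^+ j) n)
     - (f r%:C - series (fun j => a j * (r%:C - 0) ^+ j) n.+1).
    by rewrite !S big_nat_recr //=; ring.
  have -> : nrm (a n) * r ^+ n = nrm (a n * r%:C ^+ n).
    by rewrite nrmM nrmX nrm_real ger0_norm// ltW.
  rewrite e (le_trans (nrmB _ _))//.
  have h1 := hN n Nn; have h2 := hN n.+1 (leqW Nn).
  by rewrite (_ : 2 = 1 + 1 :> R); [exact: lerD | ring].
exists (r / 2); first by rewrite divr_gt0.
have tail z n m : (N <= n)%N -> nrm z <= r / 2 ->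
    nrm (\sum_(0 <= j < n + m) a j * z ^+ j - \sum_(0 <= j < n) a j * z ^+ j) <= 4 / 2 ^+ n - 4 / 2 ^+ (n + m).
  move=> Nn zr; elim: m => [|m IH]; first by rewrite addn0 !subrr nrm0.
  rewrite addnS big_nat_recr//= addrAC (le_trans (nrmD _ _))//.
  have t1 : nrm (a (n + m)%N * z ^+ (n + m)) <= 2 / 2 ^+ (n + m).
    rewrite nrmM nrmX.
    apply: (le_trans (y := nrm (a (n + m)%N) * (r / 2) ^+ (n + m))).
      by rewrite ler_wpM2l ?nrm_ge0// lerXn2r// nnegrE ?nrm_ge0// divr_ge0// ltW.
    rewrite expr_div_n mulrA ler_wpM2r ?invr_ge0 ?exprn_ge0//.
    by apply: ar; rewrite (leq_trans Nn)// leq_addr.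
  apply: (le_trans (lerD IH t1)); rewrite exprS.
  rewrite invfM.
  by move: (_ / 2 ^+ n) ((2 ^+ (n + m))^-1) => x y; lra.
move=> e e0.
pose n := maxn N (Num.truncn (8 / e)).+1.
have Nn : (N <= n)%N by rewrite leq_maxl.
have hn : 4 / 2 ^+ n <= e / 2.
  rewrite ler_pdivrMr ?exprn_gt0//.
  have : 8 / e < n%:R.
    apply: (lt_le_trans (truncnS_gt _)); rewrite ler_nat leq_maxr//.
  rewrite ltr_pdivrMr// => h1.
  have : (n%:R : R) <= 2 ^+ n by rewrite -natrX ler_nat ltnW// ltn_expl.
  move=> h2; have := ler_wpM2l (ltW e0) h2; lra.
exists (\poly_(i < n) a i) => z zr.
have zd : nrm (z - 0) < d by rewrite subr0 (le_lt_trans zr)// /r; lra.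
have [M hM] := proj1 (cvg_nrm_seq _ _) (h _ zd) (e / 2) ltac:(lra).
have := hM (n + M)%N (leq_addl _ _); rewrite S => h1.
have h2 := tail z n M Nn zr.
have h3 : 0 <= 4 / 2 ^+ (n + M) :> R by rewrite divr_ge0// exprn_ge0.
rewrite horner_poly -(big_mkord xpredT (fun i => a i * z ^+ i)).
rewrite (_ : f z - _ = (f z - \sum_(0 <= j < n + M) a j * z ^+ j) + (\sum_(0 <= j < n + M) a j * z ^+ j - \sum_(0 <= j < n) a j * z ^+ j)); last by ring.
apply: (le_trans (nrmD _ _)).
by move: (_ / 2 ^+ (n + M)) h3 (4 / 2 ^+ n) hn h2 => x ? y; lra.
Qed.

(** Taylor coefficients as limits of difference quotients along 1/m, which exhibits them as measurable functions of a random parameter.  The shift [M0] keeps the points in the domain. *)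
Lemma tc_difference_quotients (rho : R) (f : C -> C) (M0 : nat) : 0 < rho -> polyapprox rho f ->
  (fun m => complex.Re ((m + M0).+1%:R * (f ((m + M0).+1%:R^-1) - f 0))) @ \oo --> complex.Re (tc1 f) /\
  (fun m => complex.Re ((m + M0).+1%:R ^+ 2 * (f ((m + M0).+1%:R^-1) + f (- (m + M0).+1%:R^-1) - 2 * f 0))) @ \oo
   --> 2 * complex.Re (tc2 f).
Proof.
move=> r0 fp.
have [B hB] : exists B : R, forall z, nrm z <= rho -> nrm (f z) <= B.
  have [B B0 hB] := pa_bounded fp; by exists B.
have B0 : 0 <= B by apply: (le_trans (nrm_ge0 (f 0))); apply: hB; rewrite nrm0 ltW.
pose c := 2 * B / rho ^+ 3.
have c0 : 0 <= c by rewrite divr_ge0 ?exprn_ge0 ?(ltW r0)// mulr_ge0.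
have T z : nrm z <= rho / 2 -> nrm (f z - f 0 - tc1 f * z - tc2 f * z ^+ 2) <= c * nrm z ^+ 3.
  move=> /(pa_taylor r0 fp hB); rewrite expr_div_n /c => h; apply: (le_trans h).
  by rewrite [X in 2 * B * X]mulrC mulrA.
have nm m : nrm ((m + M0).+1%:R^-1 : C) = (m + M0).+1%:R^-1 by rewrite nrmV nrm_nat.
have c1 : (fun m => (m + M0).+1%:R^-1 : R) @ \oo --> (0 : R).
  have := @cvg_harmonic R; rewrite -(cvg_shiftn M0); exact.
have nz m : (m + M0).+1%:R != 0 :> C by rewrite pnatr_eq0.
have nzR m : (m + M0).+1%:R != 0 :> R by rewrite pnatr_eq0.
have near0 : \forall m \near \oo, (m + M0).+1%:R^-1 <= rho / 2.
  have := cvgr_le _ c1; apply; by rewrite divr_gt0.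
split.
- apply/cvgrPdist_le => e e0.
  have cc : (fun m => nrm (tc2 f) * (m + M0).+1%:R^-1 + c * (m + M0).+1%:R^-1 ^+ 2) @ \oo --> (0 : R).
    rewrite [X in _ --> X](_ : 0 = nrm (tc2 f) * 0 + c * (0 * 0)); last by rewrite !mulr0 addr0.
    apply: cvgD; first exact: cvgMr.
    by apply: cvgMr; apply: cvgM.
  have ce : \forall m \near \oo, nrm (tc2 f) * (m + M0).+1%:R^-1 + c * (m + M0).+1%:R^-1 ^+ 2 <= e by exact: (cvgr_le _ cc e e0).
  near=> m.
  rewrite -ReB (le_trans (Re_le_nrm _))//.
  have hm : (m + M0).+1%:R^-1 <= rho / 2 by near: m.
  have := T (m + M0).+1%:R^-1; rewrite nm => /(_ hm) h.
  apply: (@le_trans _ _ (nrm (tc2 f) * (m + M0).+1%:R^-1 + c * (m + M0).+1%:R^-1 ^+ 2)); last by near: m.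
  move: h; set x := (m + M0).+1%:R; set y := (m + M0).+1%:R^-1 => h.
  have -> : tc1 f - x * (f x^-1 - f 0) = - (tc2 f * x^-1 + x * (f x^-1 - f 0 - tc1 f * x^-1 - tc2 f * x^-1 ^+ 2)).
    by move: (nz m); rewrite -/x; clearbody x => nx; field.
  rewrite nrmN (le_trans (nrmD _ _))// nrmM nm lerD2l nrmM nrm_nat.
  apply: (le_trans (ler_wpM2l _ h)); first exact: ler0n.
  have -> : (m + M0).+1%:R * (c * y ^+ 3) = c * y ^+ 2 * ((m + M0).+1%:R * y) by ring.
  by rewrite /y mulfV ?nzR// mulr1.
- apply/cvgrPdist_le => e e0.
  have cc : (fun m => 2 * c * (m + M0).+1%:R^-1) @ \oo --> (0 : R).
    rewrite [X in _ --> X](_ : 0 = 2 * c * 0); last by rewrite !mulr0.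
    exact: cvgMr.
  have ce : \forall m \near \oo, 2 * c * (m + M0).+1%:R^-1 <= e by exact: (cvgr_le _ cc e e0).
  near=> m.
  rewrite -Re2M -ReB (le_trans (Re_le_nrm _))//.
  have hm : (m + M0).+1%:R^-1 <= rho / 2 by near: m.
  have := T (m + M0).+1%:R^-1; rewrite nm => /(_ hm) h.
  have := T (- (m + M0).+1%:R^-1); rewrite nrmN nm => /(_ hm) h'.
  apply: (@le_trans _ _ (2 * c * (m + M0).+1%:R^-1)); last by near: m.
  move: h h'; set x := (m + M0).+1%:R; set y := (m + M0).+1%:R^-1 => h h'.
  set u := f x^-1 - _ - _ - _ in h; set v := f (- x^-1) - _ - _ - _ in h'.
  have -> : 2 * tc2 f - x ^+ 2 * (f x^-1 + f (- x^-1) - 2 * f 0) = - (x ^+ 2 * (u + v)).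
    by rewrite /u /v; move: (nz m); rewrite -/x; clear; clearbody x => nx; field.
  rewrite nrmN nrmM nrmX nrm_nat.
  have := le_trans (nrmD u v) (lerD h h') => huv.
  apply: (le_trans (ler_wpM2l _ huv)); first exact: exprn_ge0.
  have -> : (m + M0).+1%:R ^+ 2 * (c * y ^+ 3 + c * y ^+ 3) = 2 * c * y * ((m + M0).+1%:R * y) ^+ 2 by ring.
  by rewrite /y mulfV ?nzR// expr1n mulr1.
Unshelve. all: by end_near.
Qed.

End Limits.

Section TreeMoments.
Variable R : realType.
Local Notation C := (Cplx R).

(** [EE n] involves finitely many trees, so a threshold depending on the tree can be made uniform. *)
Lemma EE_eventually (Q : tree -> nat -> Prop) n :
  (forall t, exists M0, forall M, (M0 <= M)%N -> Q t M) ->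
  exists M0, forall M, (M0 <= M)%N -> forall f g : tree -> R,
    (forall t, Q t M -> f t <= g t) -> EE n f <= EE n g.
Proof.
elim: n Q => [|n IH] Q hQ /=.
  by have [M0 h] := hQ External; exists M0 => M /h q f g; apply.
have /IH : forall t, exists M0, forall M, (M0 <= M)%N -> forall v, v \in external t -> Q (split_at t v) M.
  move=> t; elim: (external t) => [|v s [M1 h1]]; first by exists 0%N.
  have [M2 h2] := hQ (split_at t v).
  exists (maxn M1 M2) => M; rewrite geq_max => /andP[/h1 m1 /h2 m2] u.
  by rewrite inE => /orP[/eqP ->//|]; exact: m1.
move=> [M0 h]; exists M0 => M hM f g fg; apply: (h M hM) => t ht.
rewrite /Avg ler_wpM2l ?invr_ge0//.
by rewrite big_seq [leRHS]big_seq; apply: ler_sum => v vt; apply: fg; exact: ht.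
Qed.

Lemma EE_ravg n M (f : tree -> R -> R) :
  EE n (fun t => ravg M (f t)) = ravg M (fun u => EE n (fun t => f t u)).
Proof. by rewrite /ravg EE_scale EE_sum. Qed.

Lemma EE_pa rho n (f : tree -> C -> C) : (forall t, polyapprox rho (f t)) ->
  polyapprox rho (fun z => EE n (fun t => f t z)).
Proof.
elim: n f => [|n IH] f fp /=; first exact: fp.
by apply: (IH (fun t z => Avg (f^~ z) t)) => t; apply: pa_scale; apply: pa_sum.
Qed.

Lemma EE_tc rho n (f : tree -> C -> C) : 0 < rho -> (forall t, polyapprox rho (f t)) ->
  tc1 (fun z => EE n (fun t => f t z)) = EE n (fun t => tc1 (f t)) /\
  tc2 (fun z => EE n (fun t => f t z)) = EE n (fun t => tc2 (f t)).
Proof.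
move=> r0; elim: n f => [//|n IH] f fp /=.
have pS t : polyapprox rho (fun z => \sum_(v <- external t) f (split_at t v) z) by apply: pa_sum.
have [-> ->] := IH (fun t z => Avg (f^~ z) t) (fun t => pa_scale _ (pS t)).
split; apply: eq_EE => t _; rewrite /Avg.
  have [-> _] := tc_scale (size (external t))%:R^-1 r0 (pS t).
  by have [-> _] := tc_sum (external t) r0 (fun v => fp (split_at t v)).
have [_ ->] := tc_scale (size (external t))%:R^-1 r0 (pS t).
by have [_ ->] := tc_sum (external t) r0 (fun v => fp (split_at t v)).
Qed.

(** By [tc_ravg] the Taylor coefficients of W_n are dominated by averages over a small circle, whose second moments are bounded by [moment_bigginsW]. *)
Lemma tc_moment : exists K : R, forall n, (0 < n)%N ->
  EE n (fun t => nrm (tc1 (bigginsW n t)) ^+ 2) <= K /\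
  EE n (fun t => nrm (tc2 (bigginsW n t)) ^+ 2) <= K.
Proof.
pose rho : R := 1 / 16.
have r0 : 0 < rho by rewrite /rho; lra.
pose B : R := 2 * (9 * expR 4) + 2.
exists (B / rho ^+ 4) => n n0.
pose Q t M := nrm (tc1 (bigginsW n t)) <=
   (ravg M (fun u : R => nrm (bigginsW n t (rho%:C * cis u))) + 1) / rho /\
   nrm (tc2 (bigginsW n t)) <=
   (ravg M (fun u : R => nrm (bigginsW n t (rho%:C * cis u))) + 1) / rho ^+ 2.
have [M0 h] : exists M0, forall M, (M0 <= M)%N -> forall f g : tree -> R,
    (forall t, Q t M -> f t <= g t) -> EE n f <= EE n g.
  by apply: EE_eventually => t; apply: tc_ravg => //; exact: pa_bigginsW.
pose A t := ravg M0 (fun u : R => nrm (bigginsW n t (rho%:C * cis u))).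
pose S t := 2 * ravg M0 (fun u : R => nrm (bigginsW n t (rho%:C * cis u)) ^+ 2) + 2.
have SB : EE n S <= B.
  rewrite /S EE_add EE_cst EE_scale lerD2r ler_pM2l// EE_ravg.
  rewrite -[leRHS](ravg_cst M0); apply: le_ravg => u _; apply: moment_bigginsW => //.
  by rewrite nrmM nrm_cis mulr1 nrm_real ger0_norm ?(ltW r0)//.
have AS t : (A t + 1) ^+ 2 <= S t.
  have := ravg_sqr M0 (fun u : R => nrm (bigginsW n t (rho%:C * cis u))).
  rewrite /S -/(A t); move: (A t) (ravg _ _) => a b hb; have := sqr_ge0 (a - 1); nra.
have A0 t : 0 <= A t.
  by apply: mulr_ge0; rewrite ?invr_ge0 ?ler0n//; apply: sumr_ge0 => i _; exact: nrm_ge0.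
have key (x : tree -> R) : (forall t, 0 <= x t) -> (forall t, Q t M0 -> x t <= (A t + 1) / rho ^+ 2) ->
    EE n (fun t => x t ^+ 2) <= B / rho ^+ 4.
  move=> x0 hx; apply: (@le_trans _ _ (EE n (fun t => (rho ^+ 4)^-1 * S t))).
    apply: (h M0 (leqnn _)) => t /hx xt.
    have : x t ^+ 2 <= ((A t + 1) / rho ^+ 2) ^+ 2.
      by rewrite lerXn2r// nnegrE// divr_ge0 ?exprn_ge0 ?(ltW r0)// addr_ge0.
    move=> /le_trans; apply.
    rewrite expr_div_n -exprM mulrC ler_wpM2l ?invr_ge0 ?exprn_ge0 ?(ltW r0)//.
  by rewrite EE_scale mulrC ler_wpM2r// invr_ge0 exprn_ge0// ltW.
split; apply: key => t; rewrite ?nrm_ge0// => -[h1 h2]//.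
apply: (le_trans h1); rewrite ler_wpM2l//; first by rewrite addr_ge0 ?A0.
by rewrite lef_pV2 ?posrE ?exprn_gt0// /rho; lra.
Qed.

End TreeMoments.

Section TreeExpectation.
Context {d : measure_display} {Omega : measurableType d} {R : realType}.
Variable P : probability Omega R.
Variable Tr : nat -> Omega -> tree.
Hypothesis hTr : is_BST_process P Tr.
Local Notation C := (Cplx R).

(** The signed case of [law_tree], from f = (f + |f|) - |f|. *)
Lemma expectation_tree n (f : tree -> R) :
  fine (\int[P]_w (f (Tr n w))%:E) = EE n f.
Proof.
have iF (g : tree -> R) : P.-integrable setT (fun w => (g (Tr n w))%:E).
  apply: (@sqr_integrable _ _ _ P (fun w => g (Tr n w)) (EE n (fun t => g t ^+ 2))).
    exact: (measurable_fun_tree hTr n (fun t => g t : R)).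
  by rewrite (law_tree hTr n (f := fun t => g t ^+ 2))// => u; exact: sqr_ge0.
have e : (\int[P]_w (f (Tr n w))%:E = \int[P]_w ((f (Tr n w) + `|f (Tr n w)|)%:E - `|f (Tr n w)|%:E))%E.
  by apply: eq_integral => w _; rewrite -EFinB; congr (_%:E); ring.
rewrite e integralB//; last first.
- exact: (iF (fun t => `|f t|)).
- exact: (iF (fun t => f t + `|f t|)).
rewrite (law_tree hTr n (f := fun t => f t + `|f t|)); last first.
  by move=> u; have := ler_norm (- f u); rewrite normrN; lra.
rewrite (law_tree hTr n (f := fun t => `|f t|))// -EFinB /= -EE_sub.
by apply: eq_EE => t _; ring.
Qed.

End TreeExpectation.

Section CentredLimits.
Context {d : measure_display} {Omega : measurableType d} {R : realType}.
Variable P : probability Omega R.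
Variable Tr : nat -> Omega -> tree.
Hypothesis hTr : is_BST_process P Tr.
Local Notation C := (Cplx R).
Variables (D : set C) (W : Omega -> C -> C).
Hypothesis hD : open D.
Hypothesis hD0 : D 0.
Hypothesis hW : random_analytic D W.
Hypothesis hWlim : {ae P, forall w, forall K : set (Cplx R), compact K -> K `<=` D ->
     {uniform K, (fun n => bigginsW n (Tr n w)) @ \oo --> W w}}.

Lemma W2_0E w : W2_0 W w = 2 * complex.Re (tc2 (W w)).
Proof.
by rewrite -Re2M /W2_0 /tc2 mulrC divfK// pnatr_eq0.
Qed.

Lemma disc_in_D : exists2 rho : R, 0 < rho & forall z : C, nrm z < rho -> D z.
Proof.
have : nbhs (0 : C) D by apply: open_nbhs_nbhs.
by move=> /nbhs_nrmE[r r0 h]; exists r => // z hz; apply: h; rewrite subr0.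
Qed.

Lemma measurable_derivatives : measurable_fun setT (chi1_0 W) /\ measurable_fun setT (W2_0 W).
Proof.
have [hA hM] := hW.
have [rho r0 hr] := disc_in_D.
pose M0 := (Num.truncn rho^-1).+1.
have DM m : D ((m + M0).+1%:R^-1) /\ D (- (m + M0).+1%:R^-1).
  have : nrm ((m + M0).+1%:R^-1 : C) < rho.
    rewrite nrmV nrm_nat -[ltRHS]invrK ltf_pV2 ?posrE ?invr_gt0//.
    apply: (lt_le_trans (truncnS_gt _)); rewrite ler_nat -/M0; lia.
  by move=> h; split; apply: hr => //; rewrite nrmN.
have mRe z : D z -> measurable_fun setT (fun w => complex.Re (W w z)) by move=> /hM[].
have T w := let: ex_intro2 _ r0 p := pa_analytic (hA w) hD0 in tc_difference_quotients M0 r0 p.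
split.
  apply: (measurable_fun_cvg (h := fun m w => (m + M0).+1%:R * (complex.Re (W w ((m + M0).+1%:R^-1)) - complex.Re (W w 0)))).
    move=> m; apply: measurable_funM; first exact: measurable_cst.
    by apply: measurable_funB; apply: mRe => //; have [] := DM m.
  move=> w _; have [h _] := T w; move: h; rewrite /chi1_0 -/(tc1 (W w)).
  by under eq_fun do rewrite natC ReMr ReB -natC.
apply: (measurable_fun_cvg (h := fun m w => (m + M0).+1%:R ^+ 2 * (complex.Re (W w ((m + M0).+1%:R^-1)) + complex.Re (W w (- (m + M0).+1%:R^-1)) - 2 * complex.Re (W w 0)))).
  move=> m; apply: measurable_funM; first exact: measurable_cst.
  apply: measurable_funB.
    by apply: measurable_funD; apply: mRe; have [] := DM m.
  by apply: measurable_funM; [exact: measurable_cst | exact: mRe].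
move=> w _; have [_ h] := T w; move: h; rewrite -W2_0E.
by under eq_fun do rewrite -natrX natC ReMr ReB ReD Re2M natrX.
Qed.

Lemma bigginsW_limit : exists rho : R, [/\ 0 < rho, rho <= 1 / 16 &
  {ae P, forall w, forall e, 0 < e -> exists N, forall n, (N <= n)%N -> forall z : C, nrm z <= rho ->
     nrm (W w z - bigginsW n (Tr n w) z) <= e}].
Proof.
have [r r0 hr] := disc_in_D.
pose rho := Num.min (r / 4) (1 / 16).
have rho0 : 0 < rho by rewrite /rho lt_min !divr_gt0.
have rhor : rho <= r / 4 by rewrite /rho ge_min lexx.
exists rho; split => //; first by rewrite /rho ge_min lexx orbT.
apply: filterS hWlim => w h e e0.
have KD : [set z : C | `|complex.Re z| <= rho /\ `|complex.Im z| <= rho] `<=` D.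
  by move=> z /= [h1 h2]; apply: hr; apply: (le_lt_trans (nrm_le_ReIm z)); lra.
have [N hN] := uniform_nrm (h _ (@compact_square R rho) KD) e0.
exists N => n hn z hz; apply: hN => //=; split.
  exact: le_trans (Re_le_nrm z) hz.
exact: le_trans (Im_le_nrm z) hz.
Qed.

Definition centredW n (t : tree) (z : C) : C :=
  bigginsW n t z - EE n (fun t' => bigginsW n t' z).

Lemma centredW_tc n t : tc1 (centredW n t) = tc1 (bigginsW n t) - EE n (fun t' => tc1 (bigginsW n t')) /\
  tc2 (centredW n t) = tc2 (bigginsW n t) - EE n (fun t' => tc2 (bigginsW n t')).
Proof.
have pb (t' : tree) := pa_bigginsW (1 : R) n t'.
have [-> ->] := tc_sub ltr01 (pb t) (EE_pa n pb).
by have [-> ->] := EE_tc n ltr01 pb.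
Qed.

Lemma EE_limit (f : nat -> tree -> R) (Y : Omega -> R) K : measurable_fun setT Y ->
  (forall n, (0 < n)%N -> EE n (fun t => f n t ^+ 2) <= K) ->
  {ae P, forall w, f n (Tr n w) @[n --> \oo] --> Y w} ->
  EE n (f n) @[n --> \oo] --> fine 'E_P[Y].
Proof.
move=> mY fK fY; rewrite -cvg_shiftS unlock.
rewrite (_ : [sequence _]_n = (fun n => fine (\int[P]_w (f n.+1 (Tr n.+1 w))%:E))); last first.
  by apply/funext => n; rewrite (expectation_tree hTr _ (f n.+1)).
apply: (cvg_expectation_sqr (X := fun n w => f n.+1 (Tr n.+1 w)) (K := K)) => //.
- by move=> n; exact: (measurable_fun_tree hTr n.+1 (fun t => f n.+1 t : R)).
- move=> n; rewrite (law_tree hTr n.+1 (f := fun t => f n.+1 t ^+ 2)); last by move=> u; exact: sqr_ge0.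
  by rewrite lee_fin; exact: fK.
- by apply: filterS fY => w; rewrite -[X in X -> _]cvg_shiftS.
Qed.

Lemma bigginsW_tc_limits : {ae P, forall w,
    complex.Re (tc1 (bigginsW n (Tr n w))) @[n --> \oo] --> chi1_0 W w /\
    complex.Re (tc2 (bigginsW n (Tr n w))) @[n --> \oo] --> complex.Re (tc2 (W w))}.
Proof.
have [rho [r0 _ hlim]] := bigginsW_limit.
apply: filterS hlim => w h.
have pW : polyapprox rho (W w).
  apply: pa_lim => e /h [N hN]; exists (bigginsW N (Tr N w)); first exact: pa_bigginsW.
  by move=> z; apply: hN.
have key e : 0 < e -> exists N, forall n, (N <= n)%N ->
   nrm (tc1 (W w) - tc1 (bigginsW n (Tr n w))) <= e /\ nrm (tc2 (W w) - tc2 (bigginsW n (Tr n w))) <= e.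
  move=> e0; pose e' := Num.min (e * rho / 2) (e * rho ^+ 2 / 4).
  have e'0 : 0 < e' by rewrite /e' lt_min !divr_gt0// !mulr_gt0// exprn_gt0.
  have [N hN] := h _ e'0; exists N => n hn.
  have [h1 h2] := tc_dist r0 pW (pa_bigginsW rho n (Tr n w)) (hN n hn).
  have e1 : e' <= e * rho / 2 by rewrite /e' ge_min lexx.
  have e2 : e' <= e * rho ^+ 2 / 4 by rewrite /e' ge_min lexx orbT.
  split.
    apply: (le_trans h1); rewrite ler_pdivrMr//; lra.
  apply: (le_trans h2); rewrite ler_pdivrMr ?exprn_gt0//; lra.
split; apply/cvgrPdist_le => e /key [N hN]; exists N => // n /= /hN [h1 h2].
  by rewrite -ReB; apply: le_trans (Re_le_nrm _) _.
by rewrite -ReB; apply: le_trans (Re_le_nrm _) _.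
Qed.

Lemma expectation_limits :
  EE n (fun t => complex.Re (tc1 (bigginsW n t))) @[n --> \oo] --> fine 'E_P[chi1_0 W] /\
  EE n (fun t => complex.Re (tc2 (bigginsW n t))) @[n --> \oo] --> fine 'E_P[W2_0 W] / 2.
Proof.
have [m1 m2] := measurable_derivatives.
have [K hK] := tc_moment R.
have sqr (x : C) : complex.Re x ^+ 2 <= nrm x ^+ 2.
  by rewrite nrm_sqr lerDl sqr_ge0.
have lims := bigginsW_tc_limits.
split.
  apply: (EE_limit (K := K)) => //; last by apply: filterS lims => w [].
  move=> n n0; apply: le_trans (proj1 (hK n n0)).
  by apply: le_EE => t _; exact: sqr.
have c2 : EE n (fun t => 2 * complex.Re (tc2 (bigginsW n t))) @[n --> \oo] --> fine 'E_P[W2_0 W].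
  apply: (EE_limit (K := 4 * K)) => //.
    move=> n n0; apply: (le_trans (y := 4 * EE n (fun t => nrm (tc2 (bigginsW n t)) ^+ 2))).
      rewrite -EE_scale; apply: le_EE => t _.
      by have := sqr (tc2 (bigginsW n t)); rewrite exprMn -natrX => ?; rewrite ler_wpM2l.
    by rewrite ler_pM2l//; exact: (proj2 (hK n n0)).
  by apply: filterS lims => w [_ h]; rewrite W2_0E; apply: cvgMr.
rewrite (_ : (fun n => EE n _) = (fun n => EE n (fun t => 2 * complex.Re (tc2 (bigginsW n t))) / 2)).
  exact: cvgMl.
by apply/funext => n; rewrite EE_scale mulrC mulKf.
Qed.

(** On the event of uniform convergence, closeness on a disc gives closeness of the Taylor coefficients; the centring converges by [expectation_limits] and is bounded by the second moment. *)
Lemma centredW_limits : exists rho : R, [/\ 0 < rho, rho <= 1 / 16 &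
  {ae P, forall w, [/\ exists B N, forall n, (N <= n)%N -> forall z : C, nrm z <= rho -> nrm (centredW n (Tr n w) z) <= B,
     complex.Re (tc1 (centredW n (Tr n w))) @[n --> \oo] --> centred P (chi1_0 W) w &
     complex.Re (tc2 (centredW n (Tr n w))) @[n --> \oo] --> centred P (W2_0 W) w / 2]}].
Proof.
have [rho [r0 r1 hlim]] := bigginsW_limit.
have [E1 E2] := expectation_limits.
exists rho; split => //; apply: filterS2 hlim bigginsW_tc_limits => w h [L1 L2]; split.
- have pW : polyapprox rho (W w).
    apply: pa_lim => e /h [N hN]; exists (bigginsW N (Tr N w)); first exact: pa_bigginsW.
    by move=> z; apply: hN.
  have [B B0 hB] := pa_bounded pW.
  have [N hN] := h 1 ltr01.
  exists (B + 1 + (1 + 9 * expR 4)), (maxn N 1) => n; rewrite geq_max => /andP[hn n0] z hz.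
  apply: (le_trans (nrmB _ _)); apply: lerD.
    rewrite -[bigginsW _ _ _](subKr (W w z)) (le_trans (nrmB _ _))// lerD ?hB ?hN//.
  apply: (le_trans (EE_nrm _ _)).
  have hm := moment_bigginsW n0 (le_trans hz r1).
  apply: (le_trans _ (_ : 1 + EE n (fun t => nrm (bigginsW n t z) ^+ 2) <= _)); last by rewrite lerD2l.
  rewrite -[X in _ <= X + _](EE_cst n) -EE_add; apply: le_EE => t _.
  have := sqr_ge0 (nrm (bigginsW n t z) - 1); have := nrm_ge0 (bigginsW n t z); nra.
- under eq_fun do rewrite (proj1 (centredW_tc _ _)) ReB EE_Re.
  exact: cvgB.
- under eq_fun do rewrite (proj2 (centredW_tc _ _)) ReB EE_Re.
  rewrite /centred mulrBl; apply: cvgB => //.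
  by rewrite W2_0E mulrC mulKf.
Qed.
End CentredLimits.

(** * The centred profile at a fixed time *)

Section CoefEstimate.
Variable R : realType.
Local Notation C := (Cplx R).

Definition centredP (n : nat) (t : tree) : {poly C} :=
  genP R t - \poly_(i < n.+1) EE n (fun t' => (genP R t')`_i).

Lemma centredPE n t (z : C) : (centredP n t).[z] = genF t z - EE n (fun t' => genF t' z).
Proof.
rewrite /centredP hornerD hornerN genPE horner_poly; congr (_ - _).
under eq_bigr do rewrite mulrC -EE_scale.
rewrite -EE_sum; apply: eq_EE => t' ht'.
rewrite -genPE (horner_coef_wide _ (size_genP R ht')).
by apply: eq_bigr => i _; rewrite mulrC.
Qed.

Definition centredL (n k : nat) (t : tree) : R :=
  (count (fun v => size v == k) (external t))%:R -
  EE n (fun t' => (count (fun v => size v == k) (external t'))%:R).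

Lemma EE_C n (f : tree -> R) : EE n (fun t => (f t)%:C : C) = (EE n f)%:C.
Proof.
elim: n f => [//|n IH] f /=.
rewrite -IH; apply: eq_EE => t _.
by rewrite /Avg natC rmorphM fmorphV rmorph_sum.
Qed.

Lemma coef_centredP n t k : reach n t -> (centredP n t)`_k = (centredL n k t)%:C.
Proof.
move=> ht; rewrite /centredP coefB coef_poly genP_coef /centredL rmorphB /= -natC; congr (_ - _).
case: ltnP => [_|kn].
  by rewrite -EE_C; apply: eq_EE => t' _; rewrite genP_coef natC.
rewrite -EE_C -(EE_cst n (0 : C)); apply: eq_EE => t' ht'.
by rewrite -natC -genP_coef nth_default// (leq_trans (size_genP R ht')).
Qed.

(** The number of external nodes after [n] steps is deterministic. *)
Lemma centredW0 n t : reach n t -> centredW n t (0 : C) = 0.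
Proof.
move=> ht; rewrite /centredW.
have e t' : reach n t' -> bigginsW n t' (0 : C) = cexp (- (2 * cexp 0 - 1) * (ln n%:R)%:C) * n.+1%:R.
  by move=> h; rewrite bigginsW_genF cexp0 genF1 h.
by rewrite e// (eq_EE e) EE_cst subrr.
Qed.

(** The exact relation G_n(e^beta) = n^-1 e^(lambda e^beta) H_n(beta). *)
Lemma centred_genF n t (beta : C) : (0 < n)%N ->
  genF t (cexp beta) - EE n (fun t' => genF t' (cexp beta)) =
  n%:R^-1 * cexp ((2 * ln n%:R)%:C * cexp beta) * centredW n t beta.
Proof.
move=> n0.
have e t' : genF t' (cexp beta) = n%:R^-1 * cexp ((2 * ln n%:R)%:C * cexp beta) * bigginsW n t' beta.
  rewrite (genF_bigginsW n); congr (_ * _).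
  have -> : n%:R^-1 = cexp (- (ln n%:R)%:C) :> C.
    by rewrite -rmorphN cexp_real expRN lnK ?posrE ?ltr0n// natC fmorphV.
  rewrite -cexpD; congr cexp.
  by rewrite rmorphM /= -natC mulrBl mul1r addrC; congr (_ + _); rewrite mulrAC.
by rewrite e (eq_EE (fun t' _ => e t')) EE_scale /centredW mulrBr.
Qed.

Lemma cos_le_away (u0 u : R) : 0 < u0 -> u0 <= 1 / 128 -> u0 <= `|u| -> `|u| <= pi ->
  cos u <= 1 - u0 ^+ 2 / 4.
Proof.
move=> u00 u01 h1 h2.
have h : cos u0 <= 1 - u0 ^+ 2 / 4 by apply: cos_le_quad; rewrite ger0_norm// ltW.
apply: le_trans h.
have -> : cos u = cos `|u| by case: (ger0P u) => // _; rewrite cosN.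
move: h1; rewrite le_eqVlt => /orP[/eqP ->//|h1].
have := @ltr_cos R u0 `|u|; rewrite !in_itv /= (ltW u00) normr_ge0 h2 (le_trans (ltW h1) h2).
by move=> /(_ isT isT) ltc; apply: ltW; rewrite ltc.
Qed.

Lemma cube_add_le (x y : R) : 0 <= x -> 0 <= y -> (x + y) ^+ 3 <= 4 * (x ^+ 3 + y ^+ 3).
Proof.
move=> x0 y0; rewrite -subr_ge0.
have -> : 4 * (x ^+ 3 + y ^+ 3) - (x + y) ^+ 3 = 3 * (x + y) * (x - y) ^+ 2 by ring.
by rewrite mulr_ge0 ?sqr_ge0// mulr_ge0// addr_ge0.
Qed.

(** The constants of the cubic error near the saddle point and of the explicit part away from it. *)
Definition near_const (B rho : R) := 2 * B / rho ^+ 3 + 1000 * (4 * B / rho ^+ 2).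
Definition far_const (B rho : R) := 100 * (B / rho ^+ 2).

Lemma insert_quad (w z a b x : C) :
  w - (a * (z - 1) + (b - a / 2) * (z - 1) ^+ 2) = (w - a * x - b * x ^+ 2) +
  (a * x + b * x ^+ 2 - (a * (z - 1) + (b - a / 2) * (z - 1) ^+ 2)).
Proof. by ring. Qed.

(** The second order expansion of H_n at 0, rewritten in powers of e^beta - 1. *)
Lemma near_bound n t (rho B : R) (beta : C) :
  let a := tc1 (centredW n t) in let h := tc2 (centredW n t) - a / 2 in
  reach n t -> 0 < rho -> rho <= 1 / 16 ->
  (forall z : C, nrm z <= rho -> nrm (centredW n t z) <= B) -> nrm beta <= rho / 2 ->
  nrm (centredW n t beta - (a * (cexp beta - 1) + h * (cexp beta - 1) ^+ 2)) <= near_const B rho * nrm beta ^+ 3.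
Proof.
move=> a h ht r0 r1 hB hb; pose b : C := tc2 (centredW n t).
have pH : polyapprox rho (centredW n t).
  by apply: pa_sub; [exact: pa_bigginsW | apply: EE_pa => t'; exact: pa_bigginsW].
have B0 : 0 <= B by apply: (le_trans (nrm_ge0 _)); apply: (hB 0); rewrite nrm0 ltW.
have [ha hbb] := tc_bound r0 pH hB.
have i0 : 0 <= B / rho ^+ 2 by rewrite divr_ge0// exprn_ge0// ltW.
have irho : rho^-1 <= rho ^- 2 by rewrite lef_pV2 ?posrE ?exprn_gt0//; nra.
have ha' : nrm a <= 4 * B / rho ^+ 2.
  apply: (le_trans ha); have := ler_wpM2l B0 irho; rewrite -!mulrA.
  by move: (B / rho) (B / rho ^+ 2) i0 => u v; lra.
have T := pa_taylor r0 pH hB hb; rewrite (centredW0 ht) subr0 -/a -/b in T.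
have E := taylor_exp_change (le_trans hb _) ha' hbb.
have {}E := E ltac:(lra); rewrite -/a -/b in E.
rewrite /h (insert_quad _ _ _ _ beta).
apply: (le_trans (nrmD _ _)); apply: (le_trans (lerD T E)).
rewrite /near_const [leRHS]mulrDl expr_div_n lerD//.
by rewrite [X in 2 * B * X]mulrC mulrA.
Qed.

Lemma near_const_ge0 (B rho : R) : 0 <= B -> 0 < rho -> 0 <= near_const B rho.
Proof.
move=> B0 r0; rewrite /near_const.
have i3 : 0 <= B / rho ^+ 3 by apply: divr_ge0 => //; apply: exprn_ge0; exact: ltW.
have i2 : 0 <= B / rho ^+ 2 by apply: divr_ge0 => //; apply: exprn_ge0; exact: ltW.
rewrite -!mulrA; move: (B / rho ^+ 3) (B / rho ^+ 2) i3 i2 => u v; lra.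
Qed.

Lemma far_const_ge0 (B rho : R) : 0 <= B -> 0 < rho -> 0 <= far_const B rho.
Proof.
move=> B0 r0; rewrite /far_const.
have i2 : 0 <= B / rho ^+ 2 by apply: divr_ge0 => //; apply: exprn_ge0; exact: ltW.
by rewrite mulr_ge0.
Qed.
End CoefEstimate.

Section CoefEstimate2.
Variable R : realType.
Local Notation C := (Cplx R).

Lemma quad_bound (a b z : C) (v : R) : 0 <= v -> nrm a <= 2 * v -> nrm b <= 4 * v -> nrm z <= 3 ->
  nrm (a * z + (b - a / 2) * z ^+ 2) <= 100 * v.
Proof.
move=> v0 ha hb hz.
have hh : nrm (b - a / 2) <= 5 * v.
  apply: (le_trans (nrmB _ _)); rewrite [nrm (_ / _)]nrmM nrmV nrm_nat.
  by move: (nrm a) (nrm b) ha hb => x y; lra.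
apply: (le_trans (nrmD _ _)); rewrite [nrm (a * z)]nrmM [nrm (_ * z ^+ 2)]nrmM nrmX.
have y0 := nrm_ge0 z.
have y9 : nrm z ^+ 2 <= 9 by move: (nrm z) hz y0 => y; nra.
have t1 := ler_pM (nrm_ge0 a) y0 ha hz.
have t2 := ler_pM (nrm_ge0 (b - a / 2)) (sqr_ge0 _) hh y9.
by apply: (le_trans (lerD t1 t2)); lra.
Qed.

Lemma far_bound n t (rho B : R) (z : C) : 0 < rho -> rho <= 1 / 16 ->
  (forall z : C, nrm z <= rho -> nrm (centredW n t z) <= B) -> nrm (z - 1) <= 3 ->
  nrm (tc1 (centredW n t) * (z - 1) +
    (tc2 (centredW n t) - tc1 (centredW n t) / 2) * (z - 1) ^+ 2) <= far_const B rho.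
Proof.
move=> rho0 rho1 hB z1.
have B0 : 0 <= B by apply: (le_trans (nrm_ge0 _)); apply: (hB 0); rewrite nrm0 ltW.
have pH : polyapprox rho (centredW n t).
  by apply: pa_sub; [exact: pa_bigginsW | apply: EE_pa => t'; exact: pa_bigginsW].
have [ha hb] := tc_bound rho0 pH hB.
have i0 : 0 <= B / rho ^+ 2 by rewrite divr_ge0// exprn_ge0// ltW.
have irho : rho^-1 <= rho ^- 2 by rewrite lef_pV2 ?posrE ?exprn_gt0//; nra.
apply: quad_bound => //; last by rewrite mulrA.
apply: (le_trans ha); rewrite -mulrA ler_wpM2l//; exact: ler_wpM2l.
Qed.

Lemma second_moment (k : nat) (lam : R) : lam != 0 ->
  k.+2%:R * k.+1%:R / lam ^+ 2 = (k.+2%:R / lam) ^+ 2 - k.+2%:R / lam / lam.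
Proof. by rewrite -[k.+2%:R]natr1; move: (k.+1%:R : R) => y l0; field. Qed.

(** The identity 1 - 2r + r^2 - r/lam = x^2 - (1 + x)/lam, with x = r - 1, in the form in which the main term appears. *)
Lemma main_term_id (p L A m ra rh r l : R) :
  p * L - A * p * m * (ra * (r - 1) + rh * ((r - 1) ^+ 2 - (1 + (r - 1)) / l)) =
  (L - A * m * (ra * (r - 1) + rh * (1 - 2 * r + (r ^+ 2 - r / l)))) * p.
Proof. by ring. Qed.

Lemma Re_extract (L A m r s : R) (a h : C) :
  complex.Re (L%:C - A%:C * (m%:C * (h - a) + m%:C * (a - 2 * h) * r%:C + m%:C * h * s%:C)) =
  L - A * m * (complex.Re a * (r - 1) + complex.Re h * (1 - 2 * r + s)).
Proof.
have -> : a - 2 * h = a - h - h by ring.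
by case: a h => a1 a2 [h1 h2] /=; ring.
Qed.

(** [circle_estimate] applied to G_n and to the explicit part n^-1 (a (z - 1) + h (z - 1)^2), with [near_bound] for small angles. *)
Lemma coef_estimate n t k (rho B K delta : R) : let lam := 2 * ln (n%:R : R) in
  let kR : R := k.+2%:R in let r := kR / lam in let x := r - 1 in let u0 := rho / 8 in
  let a : C := tc1 (centredW n t) in let h := tc2 (centredW n t) - a / 2 in
  let S := lam ^+ k.+2 / (k.+2)`!%:R * r ^+ k.+2 * n%:R^-1 in
  (1 < n)%N -> reach n t -> 0 < rho -> rho <= 1 / 16 -> 0 <= K ->
  `|x| <= 1 / 2 -> `|ln r| <= rho / 4 ->
  (forall z : C, nrm z <= rho -> nrm (centredW n t z) <= B) ->
  (forall u, u0 <= `|u| -> `|u| <= pi ->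
     nrm (genF t (r%:C * cis u) - EE n (fun t' => genF t' (r%:C * cis u))) <= K * pw n (1 - delta)) ->
  `|r ^+ k.+2 * centredL R n k.+2 t - S * (complex.Re a * x + complex.Re h * (x ^+ 2 - (1 + x) / lam))| <=
  4 * near_const B rho / n%:R * expR kR * (864 * (`|ln r| ^+ 3 / Num.sqrt kR + 1 / kR ^+ 2)) +
  (K * pw n (1 - delta) + far_const B rho / n%:R * expR (kR * (1 - u0 ^+ 2 / 4))).
Proof.
move=> lam kR r x u0 a h S n1 ht rho0 rho1 K0 x1 lr hB hA.
have n0 : (0 < n)%N by exact: ltnW.
have nR0 : 0 < n%:R :> R by rewrite ltr0n.
have lam0 : 0 < lam by rewrite /lam mulr_gt0// ln_gt0// ltr1n.
have kR0 : 0 < kR by rewrite ltr0n.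
have r0 : 0 < r by rewrite divr_gt0.
have B0 : 0 <= B by apply: (le_trans (nrm_ge0 _)); apply: (hB 0); rewrite nrm0 ltW.
have C10 := near_const_ge0 B0 rho0.
have C20 := far_const_ge0 B0 rho0.
pose q : {poly C} := Poly [:: n%:R^-1 * (h - a); n%:R^-1 * (a - 2 * h); n%:R^-1 * h].
have qE z : q.[z] = n%:R^-1 * (a * (z - 1) + h * (z - 1) ^+ 2).
  by rewrite /q horner_Poly /=; ring.
have u00 : 0 < u0 by rewrite divr_gt0.
have u01 : u0 <= 1 / 128 by rewrite /u0; lra.
have lamr z : lam%:C * (r%:C * z) = kR%:C * z.
  by rewrite mulrA -rmorphM /= /r mulrCA divff ?mulr1// gt_eqF.
have GE beta : cexp beta = r%:C * cis (complex.Im beta) ->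
  (centredP R n t).[cexp beta] = n%:R^-1 * cexp (kR%:C * cis (complex.Im beta)) * centredW n t beta.
  by move=> e; rewrite centredPE centred_genF// -/lam {1}e lamr.
have CE u : cexp (ln r +i* u) = r%:C * cis u by rewrite cexpE lnK.
have nexp u : nrm (cexp (kR%:C * cis u)) = expR (kR * cos u) by rewrite nrm_cexp ReMr.
have ninv : nrm (n%:R^-1 : C) = n%:R^-1 by rewrite nrmV nrm_nat.
have est := @circle_estimate R (centredP R n t) q lam (4 * near_const B rho / n%:R)
   (K * pw n (1 - delta) + far_const B rho / n%:R * expR (kR * (1 - u0 ^+ 2 / 4))) u0 k lam0
   (size_Poly _) u00 u01.
have {}est := est (divr_ge0 (mulr_ge0 (ler0n _ 4) C10) (ler0n _ n)).
have {}est := est (addr_ge0 (mulr_ge0 K0 (pw_ge0 _ _)) (mulr_ge0 (divr_ge0 C20 (ler0n _ n)) (expR_ge0 _))).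
have {}est := est _ _.
have P1 : forall u : R, `|u| <= u0 ->
    nrm ((centredP R n t).[r%:C * cis u] - q.[r%:C * cis u] * cexp (kR%:C * cis u)) <=
    4 * near_const B rho / n%:R * expR (kR * cos u) * (`|ln r| ^+ 3 + `|u| ^+ 3).
  move=> u hu; rewrite -CE GE ?CE// qE /= -CE.
  set beta : C := ln r +i* u.
  have nb : nrm beta <= `|ln r| + `|u| by exact: nrm_le_ReIm.
  have hb : nrm beta <= rho / 2 by apply: (le_trans nb); rewrite /u0 in hu; lra.
  have N := near_bound ht rho0 rho1 hB hb; rewrite -/a -/h in N.
  rewrite (_ : _ - _ = n%:R^-1 * cexp (kR%:C * cis u) *
      (centredW n t beta - (a * (cexp beta - 1) + h * (cexp beta - 1) ^+ 2))); last by ring.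
  rewrite !nrmM ninv nexp.
  have N2 : nrm beta ^+ 3 <= 4 * (`|ln r| ^+ 3 + `|u| ^+ 3).
    apply: le_trans (cube_add_le (normr_ge0 _) (normr_ge0 _)).
    by rewrite lerXn2r// nnegrE ?nrm_ge0// addr_ge0.
  have N3 := le_trans N (ler_wpM2l C10 N2).
  have p0 : 0 <= n%:R^-1 * expR (kR * cos u) by rewrite mulr_ge0 ?expR_ge0 ?invr_ge0.
  apply: (le_trans (ler_wpM2l p0 N3)).
  by rewrite le_eqVlt; apply/orP; left; apply/eqP; ring.
have P2 : forall u : R, u0 <= `|u| -> `|u| <= pi ->
    nrm ((centredP R n t).[r%:C * cis u] - q.[r%:C * cis u] * cexp (kR%:C * cis u)) <=
    K * pw n (1 - delta) + far_const B rho / n%:R * expR (kR * (1 - u0 ^+ 2 / 4)).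
  move=> u h1 h2; apply: (le_trans (nrmB _ _)); apply: lerD.
    by rewrite centredPE; exact: hA.
  rewrite qE !nrmM ninv nexp.
  have ex : expR (kR * cos u) <= expR (kR * (1 - u0 ^+ 2 / 4)).
    by rewrite ler_expR ler_pM2l//; exact: cos_le_away h1 h2.
  have r2 : r <= 3 / 2 by move: x1; rewrite /x ler_norml => /andP[? ?]; lra.
  have z1 : nrm (r%:C * cis u - 1) <= 3.
    apply: (le_trans (nrmB _ _)); rewrite nrmM nrm_cis nrm1 mulr1 nrm_real ger0_norm ?(ltW r0)//; lra.
  have Q : nrm (a * (r%:C * cis u - 1) + h * (r%:C * cis u - 1) ^+ 2) <= far_const B rho.
    exact: far_bound.
  rewrite [n%:R^-1 * _]mulrC; apply: ler_pM ex; rewrite ?expR_ge0 ?mulr_ge0 ?nrm_ge0 ?invr_ge0//.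
  by rewrite ler_wpM2r// invr_ge0.
have {}est := est P1 P2; move: est => /=.
have s2 : kR * k.+1%:R / lam ^+ 2 = r ^+ 2 - r / lam by apply: second_moment; rewrite gt_eqF.
rewrite -/kR -/r s2 (coef_centredP R _ ht) /q !coef_Poly /= => est.
have ninvC : n%:R^-1 = (n%:R^-1)%:C :> C by rewrite natC fmorphV.
rewrite ninvC in est.
have e3 := Re_extract (centredL R n k.+2 t) (lam ^+ k.+2 / (k.+2)`!%:R) n%:R^-1 r (r ^+ 2 - r / lam) a h.
have e4 := le_trans (eq_ind _ (fun y => `|y| <= _) (Re_le_nrm _) _ e3) (lexx _).
have rk0 : 0 <= r ^+ k.+2 by rewrite exprn_ge0// ltW.
have := le_trans (ler_wpM2r rk0 e4) est; apply: le_trans.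
by rewrite -[X in _ <= _ * X](ger0_norm rk0) -normrM /S /x main_term_id.
Qed.
End CoefEstimate2.

Section Normalised.
Variable R : realType.
Local Notation C := (Cplx R).

Lemma ln1p_le (x : R) : `|x| <= 1 / 2 -> `|ln (1 + x)| <= 2 * `|x|.
Proof.
move=> x2; have h := ln1p_taylor x2.
have -> : ln (1 + x) = (ln (1 + x) - x + x ^+ 2 / 2) + (x - x ^+ 2 / 2) by ring.
apply: (le_trans (ler_normD _ _)); apply: (le_trans (lerD h (ler_normB _ _))).
have -> : `|x ^+ 2 / 2| = `|x| ^+ 2 / 2 by rewrite normrM normrX (ger0_norm (_ : 0 <= 2^-1)).
by have := normr_ge0 x; move: `|x| x2 => y y2 y0; nra.
Qed.

Lemma sqr_exp_le (kappa y : R) : 0 < kappa -> 0 < y -> y ^+ 2 * expR (- (kappa * y)) <= 27 / kappa ^+ 3 / y.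
Proof.
move=> k0 y0.
pose w := kappa * y / 3.
have w0 : 0 <= w by rewrite divr_ge0// mulr_ge0// ltW.
have h : w ^+ 3 * expR (- (kappa * y)) <= 1.
  have -> : - (kappa * y) = 3%:R * - w by rewrite /w; field.
  rewrite expRM_natl -exprMn; apply: exprn_ile1; first by apply: mulr_ge0; rewrite ?expR_ge0.
  rewrite expRN ler_pdivrMr ?expR_gt0// mul1r.
  by have := expR_ge1Dx w; lra.
have -> : y ^+ 2 * expR (- (kappa * y)) = 27 / kappa ^+ 3 / y * (w ^+ 3 * expR (- (kappa * y))).
  by move: (expR _) => E; rewrite /w; field; rewrite !gt_eqF.
by rewrite ger_pMr// divr_gt0// divr_gt0// exprn_gt0.
Qed.

(** The Poisson weight e^(-k) k^k / k! in terms of Stirling's formula. *)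
Lemma scale_stir (lam : R) k : 0 < lam -> (0 < k)%N ->
  Num.sqrt lam * (expR (- k%:R) * k%:R ^+ k / k`!%:R) =
  Num.sqrt (lam / k%:R) * (expR (stir R k))^-1.
Proof.
move=> l0 k0.
have k0R : 0 < k%:R :> R by rewrite ltr0n.
have f0 : 0 < k`!%:R :> R by rewrite ltr0n fact_gt0.
have es : expR (stir R k) = k`!%:R * expR k%:R / (k%:R ^+ k * Num.sqrt k%:R).
  rewrite /stir expRB expRD lnK ?posrE//; congr (_ / _).
  rewrite mulrDl expRD; congr (_ * _); first by rewrite expRM_natl lnK ?posrE.
  have -> : expR (1 / 2 * ln k%:R) = Num.sqrt (expR (1 / 2 * ln k%:R) ^+ 2) :> R.
    by rewrite sqrtr_sqr ger0_norm// expR_ge0.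
  congr Num.sqrt; rewrite -expRM_natl mulrA (_ : 2%:R * (1 / 2) = 1) ?mul1r ?lnK ?posrE//.
  by field.
have -> : Num.sqrt lam = Num.sqrt (lam / k%:R) * Num.sqrt k%:R.
  by rewrite -sqrtrM ?divr_ge0 ?(ltW l0)// divfK// gt_eqF.
rewrite es invfM invrK expRN.
have s0 : Num.sqrt k%:R != 0 :> R by rewrite gt_eqF// sqrtr_gt0.
have e0 : expR k%:R != 0 :> R by rewrite gt_eqF// expR_gt0.
have f0' : k`!%:R != 0 :> R by rewrite gt_eqF.
move: (k%:R ^+ k) (Num.sqrt _) (Num.sqrt k%:R) (expR _) (k`!%:R : R) s0 e0 f0' => u v x y z x0 y0 z0.
by field; rewrite y0 z0.
Qed.

(** The centred profile in the normalisation in which it has a nontrivial limit. *)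
Definition scaledL n k (t : tree) : R := let lam := 2 * ln (n%:R : R) in
  Num.sqrt lam * lam * n%:R * expR (- k%:R) * (k%:R / lam) ^+ k * centredL R n k t.

Definition scaled_error (Bn K Bf delta kappa lam x : R) :=
  3456 * Bn * (16 * x ^+ 2 + 4 / Num.sqrt lam) + K * (27 / (delta / 4) ^+ 3 / lam)
  + Bf * (27 / (kappa / 2) ^+ 3 / lam).

Lemma cubic_term (s lam l q y : R) : 0 <= s -> 0 < lam -> 0 < q -> 0 <= y -> s / 2 <= q -> l <= 8 * y ^+ 3 ->
  s * lam * (l / q) <= 16 * y ^+ 2 * (lam * y).
Proof.
move=> s0 l0 q0 y0 sq ly; rewrite mulrA ler_pdivrMr//.
apply: (@le_trans _ _ (s * lam * (8 * y ^+ 3))).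
  by rewrite ler_wpM2l// mulr_ge0// ltW.
have p0 : 0 <= 16 * y ^+ 2 * (lam * y) by exact: mulr_ge0 (mulr_ge0 (ler0n _ 16) (exprn_ge0 _ y0)) (mulr_ge0 (ltW l0) y0).
apply: le_trans (ler_wpM2l p0 sq).
by rewrite le_eqVlt; apply/orP; left; apply/eqP; field.
Qed.

Lemma square_term (s lam q : R) : 0 < s -> 0 < q -> s * s = lam -> lam / 2 <= q ->
  s * lam * (1 / q ^+ 2) <= 4 / s.
Proof.
move=> s0 q0 sl lq; rewrite mulrA mulr1 ler_pdivrMr ?exprn_gt0// mulrAC ler_pdivlMr//.
have -> : s * lam * s = lam ^+ 2 by rewrite mulrAC sl.
have l0 : 0 <= lam by rewrite -sl mulr_ge0// ltW.
have : (lam / 2) ^+ 2 <= q ^+ 2 by rewrite lerXn2r ?nnegrE ?divr_ge0// ltW.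
by rewrite expr_div_n; lra.
Qed.

(** [coef_estimate] multiplied by sqrt(lam) lam n e^(-k).  The four error terms become x^2 |c|, 1/sqrt(lam), and two terms that are exponentially small in lam; the exponent delta survives because |x| <= delta/4 limits the deviation of e^k from n^2. *)
Lemma scaledL_estimate n t k (rho B K delta rho' : R) : let lam := 2 * ln (n%:R : R) in
  let kR : R := k%:R in let r := kR / lam in let x := r - 1 in let u0 := rho / 8 in
  let c := kR - lam in
  let a : C := tc1 (centredW n t) in let h := tc2 (centredW n t) - a / 2 in
  let mu := Num.sqrt (lam / kR) * (expR (stir R k))^-1 in
  (1 < n)%N -> (1 < k)%N -> 1 <= lam -> reach n t -> 0 < rho -> rho <= 1 / 16 -> 0 <= K -> 0 < delta ->
  `|x| <= rho / 8 -> `|x| <= delta / 4 -> `|x| <= rho' ->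
  (forall z : C, nrm z <= rho -> nrm (centredW n t z) <= B) ->
  (forall u r, u0 <= `|u| -> `|u| <= pi -> `|r - 1| <= rho' ->
     nrm (genF t (r%:C * cis u) - EE n (fun t' => genF t' (r%:C * cis u))) <= K * pw n (1 - delta)) ->
  `|scaledL n k t - mu * (complex.Re a * c + complex.Re h * (c * x - 1 - x))| <=
    scaled_error (near_const B rho) K (far_const B rho) delta (u0 ^+ 2 / 4) lam x * (1 + `|c|).
Proof.
move=> lam kR r x u0 c a h mu n1 k1 lam1 ht rho0 rho1 K0 delta0 x8 xd xr hB hA.
have n0 : (0 < n)%N by exact: ltnW.
have B0 : 0 <= B by apply: (le_trans (nrm_ge0 _)); apply: (hB 0); rewrite nrm0 ltW.
have C10 := near_const_ge0 B0 rho0; have C20 := far_const_ge0 B0 rho0.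
have lam0 : 0 < lam by exact: lt_le_trans lam1.
have kR0 : 0 < kR by rewrite ltr0n; exact: ltnW.
have r0 : 0 < r by rewrite divr_gt0.
have x2 : `|x| <= 1 / 2 by apply: (le_trans x8); lra.
have lr : `|ln r| <= 2 * `|x| by rewrite (_ : r = 1 + x) ?ln1p_le// /x; ring.
have lr4 : `|ln r| <= rho / 4 by move: (`|ln r|) (`|x|) lr x8 => y z; lra.
have est := @coef_estimate R n t k.-2 rho B K delta.
have kE : k.-2.+2 = k by move: k1; case: (k) => [|[]].
rewrite /= kE -/lam -/kR -/r -/x -/u0 -/a -/h in est.
have {}est := est n1 ht rho0 rho1 K0 x2 lr4 hB (fun u h1 h2 => hA u r h1 h2 xr).
set S := lam ^+ k / k`!%:R * r ^+ k / n%:R in est.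
pose M := Num.sqrt lam * lam * n%:R * expR (- kR).
have nR0 : 0 < n%:R :> R by rewrite ltr0n.
have slam0 : 0 <= Num.sqrt lam * lam by exact: mulr_ge0 (sqrtr_ge0 _) (ltW lam0).
have M0 : 0 <= M by exact: mulr_ge0 (mulr_ge0 slam0 (ler0n _ _)) (expR_ge0 _).
have {est} := ler_wpM2l M0 est.
rewrite -[X in X * `|_|](ger0_norm M0) -normrM.
have -> : M * (r ^+ k * centredL R n k t - S * (complex.Re a * x + complex.Re h * (x ^+ 2 - (1 + x) / lam))) =
   scaledL n k t - mu * (complex.Re a * c + complex.Re h * (c * x - 1 - x)).
  have -> : c = lam * x by rewrite /c /x /r mulrBr mulr1 mulrC divfK// gt_eqF.
  have <- : Num.sqrt lam * (expR (- k%:R) * k%:R ^+ k / k`!%:R) = mu.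
    by apply: scale_stir => //; exact: ltnW.
  have -> : k%:R ^+ k = lam ^+ k * r ^+ k by rewrite -exprMn /r mulrC divfK// gt_eqF.
  rewrite /scaledL -/lam -/kR -/r -/M /S /M.
  move: (Num.sqrt lam) (expR _) (lam ^+ k) (r ^+ k) (k`!%:R^-1 : R) (centredL R n k t) => s e p q f L.
  move: (complex.Re a) (complex.Re h) => ra rh.
  by clearbody x; clear -nR0 lam0; clearbody lam; field; rewrite !gt_eqF.
move=> /le_trans; apply.
have klam : lam / 2 <= kR.
  have -> : kR = lam * (1 + x) by rewrite /x /r addrC subrK mulrC divfK// gt_eqF.
  by move: x2; rewrite ler_norml => /andP[? ?]; nra.
have sl0 : 0 < Num.sqrt lam by rewrite sqrtr_gt0.
have sl2 : Num.sqrt lam * Num.sqrt lam = lam by rewrite -expr2 sqr_sqrtr// ltW.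
have sk : Num.sqrt lam / 2 <= Num.sqrt kR.
  rewrite -(@ler_pXn2r _ 2)// ?nnegrE ?sqrtr_ge0 ?divr_ge0 ?sqrtr_ge0//.
  by rewrite expr_div_n !sqr_sqrtr ?(ltW kR0) ?(ltW lam0)//; lra.
have sl1 : Num.sqrt lam <= lam.
  have := ler_wsqrtr lam1; rewrite sqrtr1 => s1.
  by rewrite -[leRHS]sl2 ler_peMl// ltW.
have cE : `|c| = lam * `|x|.
  have -> : c = lam * x by rewrite /c /x /r mulrBr mulr1 mulrC divfK// gt_eqF.
  by rewrite normrM ger0_norm// ltW.
have nE : n%:R = expR (lam / 2) :> R by rewrite /lam mulrC mulKf// lnK// posrE.
have t1 : Num.sqrt lam * lam * (`|ln r| ^+ 3 / Num.sqrt kR) <= 16 * x ^+ 2 * `|c|.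
  rewrite cE -(real_normK (num_real x)).
  apply: cubic_term (sqrtr_ge0 _) lam0 _ (normr_ge0 _) sk _; first by rewrite sqrtr_gt0.
  have -> : 8 * `|x| ^+ 3 = (2 * `|x|) ^+ 3 by move: (`|x|) => y; ring.
  by rewrite lerXn2r// nnegrE mulr_ge0.
have t2 : Num.sqrt lam * lam * (1 / kR ^+ 2) <= 4 / Num.sqrt lam by exact: square_term sl0 kR0 sl2 klam.
have kE' : kR = lam * (1 + x) by rewrite /x /r addrC subrK mulrC divfK// gt_eqF.
(* Here n e^(-k) n^(1 - delta) = e^(- lam (x + delta/2)), and x >= - delta/4. *)
have t3 : M * (K * pw n (1 - delta)) <= K * (27 / (delta / 4) ^+ 3 / lam).
  have e1 : n%:R * expR (- kR) * pw n (1 - delta) <= expR (- (delta / 4 * lam)).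
    rewrite nE /pw -!expRD ler_expR.
    have -> : ln (n%:R : R) = lam / 2 by rewrite /lam mulrC mulKf.
    rewrite kE'; move: xd; rewrite ler_norml => /andP[? ?]; nra.
  rewrite mulrCA ler_wpM2l//.
  apply: le_trans (sqr_exp_le (divr_gt0 delta0 _) lam0) => //.
  have -> : M * pw n (1 - delta) = Num.sqrt lam * lam * (n%:R * expR (- kR) * pw n (1 - delta)).
    by rewrite /M; move: (Num.sqrt lam) (expR _) (pw _ _) => s e p; ring.
  apply: ler_pM slam0 (mulr_ge0 (mulr_ge0 (ler0n _ _) (expR_ge0 _)) (pw_ge0 _ _)) _ e1.
  exact: ler_wpM2r (ltW lam0) _ _ sl1.
have t4 : M * (far_const B rho / n%:R * expR (kR * (1 - u0 ^+ 2 / 4))) <= far_const B rho * (27 / ((u0 ^+ 2 / 4) / 2) ^+ 3 / lam).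
  have u00 : 0 < u0 by rewrite divr_gt0.
  have kap0 : 0 < u0 ^+ 2 / 4 / 2 by rewrite !divr_gt0// exprn_gt0.
  have -> : M * (far_const B rho / n%:R * expR (kR * (1 - u0 ^+ 2 / 4))) =
     far_const B rho * (Num.sqrt lam * lam * (expR (- kR) * expR (kR * (1 - u0 ^+ 2 / 4)))).
    rewrite /M; move: (Num.sqrt lam) (expR (- kR)) (expR (kR * _)) (far_const B rho) => s e e' C.
    by clear -nR0; field; rewrite gt_eqF.
  rewrite ler_wpM2l//; apply: le_trans (sqr_exp_le kap0 lam0).
  apply: (ler_pM slam0 (mulr_ge0 (expR_ge0 _) (expR_ge0 _))).
  - exact: ler_wpM2r (ltW lam0) _ _ sl1.
  - rewrite -expRD ler_expR; move: (u0 ^+ 2 / 4) kap0 => v v0; nra.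
have t12 : M * (4 * near_const B rho / n%:R * expR kR * (864 * (`|ln r| ^+ 3 / Num.sqrt kR + 1 / kR ^+ 2))) <=
   3456 * near_const B rho * (16 * x ^+ 2 + 4 / Num.sqrt lam) * (1 + `|c|).
  have -> : M * (4 * near_const B rho / n%:R * expR kR * (864 * (`|ln r| ^+ 3 / Num.sqrt kR + 1 / kR ^+ 2))) =
    3456 * near_const B rho * (Num.sqrt lam * lam * (`|ln r| ^+ 3 / Num.sqrt kR) + Num.sqrt lam * lam * (1 / kR ^+ 2)).
    have ee : expR (- kR) * expR kR = 1 by rewrite -expRD addNr expR0.
    transitivity (3456 * near_const B rho * (Num.sqrt lam * lam * (`|ln r| ^+ 3 / Num.sqrt kR) + Num.sqrt lam * lam * (1 / kR ^+ 2)) * (expR (- kR) * expR kR) * (n%:R * n%:R^-1)).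
      rewrite /M; move: (Num.sqrt lam) (expR (- kR)) (expR kR) (near_const B rho) (_ / Num.sqrt kR) (1 / kR ^+ 2) => s e e' C y z.
      by ring.
    by rewrite ee !mulr1 divff ?mulr1// gt_eqF.
  rewrite -[leRHS]mulrA; apply: (ler_wpM2l (mulr_ge0 (ler0n _ 3456) C10)).
  apply: (le_trans (lerD t1 t2)).
  have := normr_ge0 c; have := sqr_ge0 x; have s40 : 0 <= 4 / Num.sqrt lam by rewrite divr_ge0// ltW.
  move: (x ^+ 2) (4 / Num.sqrt lam) s40 (`|c|) => p q q0 w p0 w0; nra.
rewrite /scaled_error [leLHS]mulrDr [X in _ + X <= _]mulrDr.
apply: (le_trans (lerD t12 (lerD t3 t4))).
have q1 : 0 <= K * (27 / (delta / 4) ^+ 3 / lam).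
  exact: mulr_ge0 K0 (divr_ge0 (divr_ge0 (ler0n _ 27) (exprn_ge0 _ (divr_ge0 (ltW delta0) (ler0n _ 4)))) (ltW lam0)).
have q2 : 0 <= far_const B rho * (27 / ((u0 ^+ 2 / 4) / 2) ^+ 3 / lam).
  exact: mulr_ge0 C20 (divr_ge0 (divr_ge0 (ler0n _ 27) (exprn_ge0 _ (divr_ge0 (divr_ge0 (sqr_ge0 _) (ler0n _ 4)) (ler0n _ 2)))) (ltW lam0)).
have c0 := normr_ge0 c.
move: (3456 * _ * _) (K * _) (far_const B rho * _) (`|c|) q1 q2 c0 => p q s w q0 s0 w0.
by have := mulr_ge0 q0 w0; have := mulr_ge0 s0 w0; rewrite !mulrDr !mulr1 mulrDl mulrDl; lra.
Qed.

End Normalised.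

(** * The asymptotic expansion of the centred profile *)

Section Master.
Variable R : realType.
Local Notation C := (Cplx R).
Variables (T : nat -> tree) (k : nat -> nat).
Variables (rho B K delta rho' alpha b0 : R) (N : nat).
Hypothesis hT : forall n, reach n (T n).
Hypotheses (rho0 : 0 < rho) (rho1 : rho <= 1 / 16) (K0 : 0 <= K) (delta0 : 0 < delta) (rho'0 : 0 < rho').
Hypothesis hB : forall n, (N <= n)%N -> forall z : C, nrm z <= rho -> nrm (centredW n (T n) z) <= B.
Hypothesis hA : forall n u r, (0 < n)%N -> rho / 8 <= `|u| -> `|u| <= pi -> `|r - 1| <= rho' ->
  nrm (genF (T n) (r%:C * cis u) - EE n (fun t' => genF t' (r%:C * cis u))) <= K * pw n (1 - delta).
Hypothesis ha : complex.Re (tc1 (centredW n (T n))) @[n --> \oo] --> alpha.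
Hypothesis hb : complex.Re (tc2 (centredW n (T n))) @[n --> \oo] --> b0.
Let lam n : R := 2 * ln n%:R.
Hypothesis hk : (k n)%:R / lam n @[n --> \oo] --> (1 : R).

Lemma cvg_lam : lam n @[n --> \oo] --> +oo.
Proof.
apply/cvgryPge => A.
near=> n.
have : expR (A / 2) <= n%:R by near: n; exact: nbhs_infty_ger.
move=> h; have n0 : 0 < n%:R :> R by apply: lt_le_trans (expR_gt0 _) h.
have : A / 2 <= ln (n%:R : R) by rewrite -ler_expR lnK// posrE.
by rewrite /lam; lra.
Unshelve. all: by end_near.
Qed.

Lemma cvg_invlam : (lam n)^-1 @[n --> \oo] --> (0 : R).
Proof.
apply/cvgrPdist_le => e e0; near=> n.
have l : e^-1 <= lam n by near: n; exact: (cvgryPge _).1 cvg_lam _.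
have l0 : 0 < lam n by apply: lt_le_trans l; rewrite invr_gt0.
rewrite sub0r normrN ger0_norm ?invr_ge0 ?(ltW l0)//.
by rewrite -[leRHS]invrK lef_pV2 ?posrE ?invr_gt0.
Unshelve. all: by end_near.
Qed.

Lemma cvg_invsqrtlam : (Num.sqrt (lam n))^-1 @[n --> \oo] --> (0 : R).
Proof.
have -> : (0 : R) = Num.sqrt 0 by rewrite sqrtr0.
have h := cvg_comp _ _ cvg_invlam (@sqrt_continuous R 0).
apply: cvg_trans h; apply: near_eq_cvg; near=> n => /=.
by rewrite sqrtrV// ltW//; near: n; exact: cvgry_gt cvg_lam _.
Unshelve. all: by end_near.
Qed.

Lemma cvg_k : k n @[n --> \oo] --> \oo.
Proof.
apply/cvgnyPge => A.
have h1 : \forall n \near \oo, 1 / 2 <= (k n)%:R / lam n by apply: (cvgr_ge (1 : R)) => //; lra.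
near=> n.
have : 1 / 2 <= (k n)%:R / lam n by near: n; exact: h1.
have l : 2 * A%:R + 1 <= lam n by near: n; exact: (cvgryPge _).1 cvg_lam _.
have A0 : 0 <= A%:R :> R by rewrite ler0n.
rewrite ler_pdivlMr; last by lra.
by move=> h; rewrite -(ler_nat R); lra.
Unshelve. all: by end_near.
Qed.

Lemma gather_terms (e p q s c : R) :
  e * (1 + `|c|) + `|p * c + q * c - s - q| <= (e + `|p| + `|q| + `|s| + `|q|) * (1 + `|c|).
Proof.
have h : `|p * c + q * c - s - q| <= `|p| * `|c| + `|q| * `|c| + `|s| + `|q|.
  apply: (le_trans (ler_normB _ _)); rewrite lerD2r.
  apply: (le_trans (ler_normB _ _)); rewrite lerD2r.
  by apply: (le_trans (ler_normD _ _)); rewrite !normrM.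
move: (normr_ge0 p) (normr_ge0 q) (normr_ge0 s) (normr_ge0 c) h.
move: (`|p|) (`|q|) (`|s|) (`|c|) (`|_|) => P Q S Z L P0 Q0 S0 Z0 h.
have := mulr_ge0 S0 Z0; have := mulr_ge0 Q0 Z0; nra.
Qed.

(** The uniform form of the expansion; all three regimes follow from it. *)
Lemma master : let c n := (k n)%:R - lam n in let m0 : R := (Num.sqrt (2 * pi))^-1 in
  exists2 e : nat -> R, e n @[n --> \oo] --> 0 &
  \forall n \near \oo, `|scaledL R n (k n) (T n) - m0 * (alpha * c n - (b0 - alpha / 2))| <= e n * (1 + `|c n|).
Proof.
move=> c m0.
pose x n := (k n)%:R / lam n - 1.
pose a n : R := complex.Re (tc1 (centredW n (T n))).
pose h n : R := complex.Re (tc2 (centredW n (T n)) - tc1 (centredW n (T n)) / 2).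
pose mu n := Num.sqrt (lam n / (k n)%:R) * (expR (stir R (k n)))^-1.
pose eta := b0 - alpha / 2.
pose e1 n := scaled_error (near_const B rho) K (far_const B rho) delta ((rho / 8) ^+ 2 / 4) (lam n) (x n).
have cx : x n @[n --> \oo] --> (0 : R).
  rewrite -[X in _ --> X](subrr 1); apply: cvgB => //; exact: cvg_cst.
have ch : h n @[n --> \oo] --> eta.
  have hE n : h n = complex.Re (tc2 (centredW n (T n))) - a n / 2.
    rewrite /h ReB; congr (_ - _).
    have -> : tc1 (centredW n (T n)) / 2 = (2^-1 : R)%:C * tc1 (centredW n (T n)).
      by rewrite natC -fmorphV mulrC.
    by rewrite ReMr mulrC.
  under eq_fun do rewrite hE.
  apply: cvgB => //; exact: cvgMl.
have cmu : mu n @[n --> \oo] --> m0.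
  rewrite -[m0]mul1r; apply: cvgM.
    have c1 : lam n / (k n)%:R @[n --> \oo] --> (1 : R).
      rewrite (_ : (fun n => lam n / _) = (fun n => ((k n)%:R / lam n)^-1)); last first.
        by apply/funext => n; rewrite invf_div.
      by rewrite -[X in _ --> X](invr1 R); apply: cvgV => //; exact: oner_neq0.
    rewrite -[X in _ --> X](sqrtr1 R).
    exact: (continuous_cvg _ (@sqrt_continuous R 1) c1).
  apply: cvgV; first by rewrite gt_eqF// sqrtr_gt0 mulr_gt0// pi_gt0.
  exact: (cvg_comp _ _ cvg_k (@stirling R)).
exists (fun n => e1 n + `|mu n * a n - m0 * alpha| + `|mu n * h n * x n| + `|mu n * h n - m0 * eta| + `|mu n * h n * x n|).
  have z (f : nat -> R) : f n @[n --> \oo] --> 0 -> `|f n| @[n --> \oo] --> (0 : R).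
    by move=> hf; rewrite -[X in _ --> X](normr0 R); apply: cvg_norm.
  have zz (f : nat -> R) l : f n @[n --> \oo] --> l -> (f n - l) @[n --> \oo] --> (0 : R).
    by move=> hf; rewrite -[X in _ --> X](subrr l); apply: cvgB => //; exact: cvg_cst.
  have cmx : `|mu n * h n * x n| @[n --> \oo] --> (0 : R).
    apply: z; rewrite -[X in _ --> X](mulr0 (m0 * eta)); apply: cvgM => //; exact: cvgM.
  rewrite [X in _ --> X](_ : 0 = 0 + 0 + 0 + 0 + 0); last by rewrite !addr0.
  apply: cvgD => //; apply: cvgD; last by apply: z; apply: zz; exact: cvgM.
  apply: cvgD => //; apply: cvgD; last by apply: z; apply: zz; exact: cvgM.
  rewrite /e1 /scaled_error.
  rewrite [X in _ --> X](_ : 0 = 3456 * near_const B rho * (16 * (0 * 0) + 4 * 0) + K * (27 / (delta / 4) ^+ 3 * 0)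
     + far_const B rho * (27 / ((rho / 8) ^+ 2 / 4 / 2) ^+ 3 * 0)); last by rewrite !(mulr0, addr0).
  apply: cvgD; first apply: cvgD.
  - apply: cvgMr; apply: cvgD; first by apply: cvgMr; exact: cvgM.
    by apply: cvgMr; exact: cvg_invsqrtlam.
  - by apply: cvgMr; apply: cvgMr; exact: cvg_invlam.
  - by apply: cvgMr; apply: cvgMr; exact: cvg_invlam.
have nx (e : R) : 0 < e -> \forall n \near \oo, `|x n| <= e.
  by move=> e0; move/cvgrPdist_le : cx => /(_ e e0); apply: filterS => n; rewrite sub0r normrN.
near=> n.
have n1 : (1 < n)%N by near: n; exact: nbhs_infty_gt.
have nN : (N <= n)%N by near: n; exact: nbhs_infty_ge.
have k1 : (1 < k n)%N by near: n; move/cvgnyPge : cvg_k; exact.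
have l1 : 1 <= lam n by near: n; move/cvgryPge : cvg_lam; exact.
have x1 : `|x n| <= rho / 8 by near: n; apply: nx; rewrite divr_gt0.
have x2 : `|x n| <= delta / 4 by near: n; apply: nx; rewrite divr_gt0.
have x3 : `|x n| <= rho' by near: n; exact: nx.
have n0 : (0 < n)%N by exact: ltnW.
have est := scaledL_estimate n1 k1 l1 (hT n) rho0 rho1 K0 delta0 x1 x2 x3 (hB nN) (fun u r => hA n0).
move: est; rewrite -/(lam n) -/(x n) -/(c n) -/(mu n) -/(a n) -/(h n) -/(e1 n) => est.
rewrite (_ : _ - _ = (scaledL R n (k n) (T n) - mu n * (a n * c n + h n * (c n * x n - 1 - x n)))
  + ((mu n * a n - m0 * alpha) * c n + (mu n * h n * x n) * c n - (mu n * h n - m0 * eta) - mu n * h n * x n)); last first.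
  by rewrite /eta; move: (scaledL _ _ _ _) (mu n) (a n) (h n) (c n) (x n) => s m u v w y; ring.
apply: (le_trans (ler_normD _ _)); apply: (le_trans (lerD est (lexx _))).
exact: gather_terms.
Unshelve. all: by end_near.
Qed.
End Master.

(** * The three regimes *)

Section Regimes.
Variable R : realType.

Lemma cvg0_le (u v : nat -> R) : (\forall n \near \oo, `|u n| <= v n) -> v n @[n --> \oo] --> 0 ->
  u n @[n --> \oo] --> 0.
Proof.
move=> uv v0; apply/cvgrPdist_le => e e0.
move/cvgrPdist_le : v0 => /(_ e e0) h.
apply: filterS2 uv h => n h1; rewrite !sub0r !normrN => h2.
by apply: le_trans h2; apply: le_trans h1 (ler_norm _).
Qed.

Lemma cvg_diff0 (u v : nat -> R) (l : R) : (u n - v n) @[n --> \oo] --> 0 -> v n @[n --> \oo] --> l ->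
  u n @[n --> \oo] --> l.
Proof.
move=> h1 h2; rewrite -[l]add0r.
rewrite (_ : u = (fun n => (u n - v n) + v n)); last by apply/funext => n; rewrite subrK.
exact: cvgD.
Qed.

Variables (k : nat -> int) (L : nat -> R) (al eta : R).
Let lam n : R := 2 * ln n%:R.
Let kr n : R := (k n)%:~R.
Let c n := kr n - lam n.
(** This is e^(-c) r^k with r = k/lambda, the factor by which the saddle point normalisation of the profile differs from lambda^(3/2)/n. *)
Definition saddle_factor n := expR (- c n) * (kr n / lam n) ^ (k n).
Let m0 : R := (Num.sqrt (2 * pi))^-1.
Let Y n := Num.sqrt (lam n) * lam n / n%:R * saddle_factor n * L n.

(** Its logarithm is lam ((1 + x) log (1 + x) - x) with x = c/lam, which is c^2/(2 lam) up to a factor 1 + O(x). *)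
Lemma saddle_factor_limit (a : R) : c n / Num.sqrt (lam n) @[n --> \oo] --> a ->
  saddle_factor n @[n --> \oo] --> expR (a ^+ 2 / 2).
Proof.
move=> ca; pose x n := c n / lam n.
pose s n := c n / Num.sqrt (lam n).
have cs : s n @[n --> \oo] --> a by [].
have l1 : \forall n \near \oo, 1 <= lam n by apply: (cvgryPge _).1; exact: cvg_lam.
have cx : x n @[n --> \oo] --> (0 : R).
  have h : s n * (Num.sqrt (lam n))^-1 @[n --> \oo] --> (0 : R).
    by rewrite -[X in _ --> X](mulr0 a); apply: cvgM => //; exact: cvg_invsqrtlam.
  apply: cvg_trans h; apply: near_eq_cvg; apply: filterS l1 => n hl.
  rewrite /x /s -mulrA -invfM -expr2 sqr_sqrtr//; lra.
have x2 : \forall n \near \oo, `|x n| <= 1 / 2.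
  have p : 0 < 1 / 2 :> R by lra.
  by move/cvgrPdist_le : cx => /(_ _ p); apply: filterS => n; rewrite sub0r normrN.
pose Rm n := ln (1 + x n) - x n + x n ^+ 2 / 2.
have key : \forall n \near \oo, saddle_factor n = expR (s n ^+ 2 / 2 - s n ^+ 2 * x n / 2 + (1 + x n) * (lam n * Rm n)).
  apply: filterS2 l1 x2 => n hl hx.
  have l0 : 0 < lam n by lra.
  have x1 : 0 < 1 + x n by move: hx; rewrite ler_norml => /andP[? ?]; lra.
  have kx : kr n / lam n = 1 + x n by rewrite /x /c mulrBl divff ?gt_eqF// addrC subrK.
  have pE : (kr n / lam n) ^ (k n) = expR (kr n * ln (1 + x n)).
    rewrite kx /kr; case: (k n) => m.
      by rewrite -exprnP -pmulrn expRM_natl lnK.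
    by rewrite NegzE -exprnN mulrNz mulNr expRN -pmulrn expRM_natl lnK.
  rewrite /saddle_factor pE -expRD; congr expR.
  have cE : c n = lam n * x n by rewrite /x mulrC divfK// gt_eqF.
  have kE : kr n = lam n * (1 + x n) by rewrite -kx mulrC divfK// gt_eqF.
  have sE : s n ^+ 2 = lam n * x n ^+ 2.
    by rewrite /s expr_div_n sqr_sqrtr ?(ltW l0)// cE; field; rewrite gt_eqF.
  by rewrite kE cE sE /Rm; move: (ln (1 + x n)) (x n) (lam n) => u v w; field.
have rm : lam n * Rm n @[n --> \oo] --> (0 : R).
  apply: (cvg0_le (v := fun n => 2 * s n ^+ 2 * `|x n|)).
    apply: filterS2 l1 x2 => n hl hx.
    have l0 : 0 < lam n by lra.
    rewrite normrM ger0_norm ?(ltW l0)//.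
    apply: (le_trans (ler_wpM2l (ltW l0) (ln1p_taylor hx))).
    rewrite /s expr_div_n sqr_sqrtr ?(ltW l0)//.
    have -> : c n = lam n * x n by rewrite /x mulrC divfK// gt_eqF.
    rewrite exprMn -[x n ^+ 2](real_normK (num_real _)).
    by rewrite le_eqVlt; apply/orP; left; apply/eqP; field; rewrite gt_eqF.
  rewrite [X in _ --> X](_ : 0 = 2 * (a * a) * `|0 : R|); last by rewrite normr0 mulr0.
  apply: cvgM; last exact: cvg_norm.
  by apply: cvgMr; exact: cvgM.
apply: (cvg_trans (near_eq_cvg (filterS (fun n => esym) key))).
apply: (continuous_cvg _ (@continuous_expR R _)).
rewrite [X in _ --> X](_ : _ = a * a / 2 - a * a * 0 / 2 + (1 + 0) * 0); last by rewrite !mulr0 mul0r subr0 addr0 expr2.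
apply: cvgD; first apply: cvgB.
- by apply: cvgMl; exact: cvgM.
- by apply: cvgMl; apply: cvgM => //; exact: cvgM.
- by apply: cvgM => //; apply: cvgD => //; exact: cvg_cst.
Qed.

Hypothesis est : exists2 e : nat -> R, e n @[n --> \oo] --> 0 &
  \forall n \near \oo, `|Y n - m0 * (al * c n - eta)| <= e n * (1 + `|c n|).

Lemma Y_unbounded : `|c n| @[n --> \oo] --> +oo -> Y n / c n @[n --> \oo] --> m0 * al.
Proof.
move=> coo; have [e e0 he] := est.
have c1 : \forall n \near \oo, 1 <= `|c n| by apply: (cvgryPge _).1.
apply: (cvg_diff0 (v := fun n => m0 * al)); last exact: cvg_cst.
apply: (cvg0_le (v := fun n => `|m0 * eta| * `|c n|^-1 + 2 * `|e n|)).
  apply: filterS2 he c1 => n h hc.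
  have c0 : 0 < `|c n| by lra.
  have cn0 : c n != 0 by rewrite -normr_gt0.
  have -> : Y n / c n - m0 * al = ((Y n - m0 * (al * c n - eta)) - m0 * eta) / c n by field.
  rewrite normrM normfV ler_pdivrMr//.
  apply: (le_trans (ler_normB _ _)); rewrite mulrDl divfK ?gt_eqF// addrC lerD2l.
  apply: (le_trans h); have := ler_norm (e n); have := normr_ge0 (e n).
  move: (e n) (`|e n|) (`|c n|) hc => x y z; nra.
rewrite [X in _ --> X](_ : 0 = `|m0 * eta| * 0 + 2 * `|0 : R|); last by rewrite normr0 !mulr0 addr0.
apply: cvgD; last by apply: cvgMr; exact: cvg_norm.
apply: cvgMr; apply/cvgrPdist_le => d d0.
have h : \forall n \near \oo, d^-1 <= `|c n| by apply: (cvgryPge _).1.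
apply: filterS h => n h.
have c0 : 0 < `|c n| by apply: lt_le_trans h; rewrite invr_gt0.
by rewrite sub0r normrN ger0_norm ?invr_ge0// -[leRHS]invrK lef_pV2 ?posrE ?invr_gt0.
Qed.

Lemma Y_sqrt (a : R) : c n / Num.sqrt (lam n) @[n --> \oo] --> a ->
  Y n / Num.sqrt (lam n) @[n --> \oo] --> m0 * (al * a).
Proof.
move=> ca; have [e e0 he] := est.
have l1 : \forall n \near \oo, 1 <= lam n by apply: (cvgryPge _).1; exact: cvg_lam.
apply: (cvg_diff0 (v := fun n => m0 * (al * (c n / Num.sqrt (lam n)) - eta * (Num.sqrt (lam n))^-1))); last first.
  rewrite [X in _ --> m0 * X](_ : _ = al * a - eta * 0); last by rewrite mulr0 subr0.
  apply: cvgMr; apply: cvgB; first exact: cvgMr.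
  by apply: cvgMr; exact: cvg_invsqrtlam.
apply: (cvg0_le (v := fun n => `|e n| * ((Num.sqrt (lam n))^-1 + `|c n / Num.sqrt (lam n)|))).
  apply: filterS2 he l1 => n h hl.
  have s0 : 0 < Num.sqrt (lam n) by rewrite sqrtr_gt0; lra.
  have -> : Y n / Num.sqrt (lam n) - m0 * (al * (c n / Num.sqrt (lam n)) - eta * (Num.sqrt (lam n))^-1) =
    (Y n - m0 * (al * c n - eta)) / Num.sqrt (lam n).
    by move: (Num.sqrt (lam n)) s0 => s s0; field; rewrite gt_eqF.
  rewrite normrM [X in _ * X]ger0_norm ?invr_ge0 ?(ltW s0)// ler_pdivrMr//.
  apply: (le_trans h).
  rewrite normrM [`|_^-1|]ger0_norm ?invr_ge0 ?(ltW s0)//.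
  rewrite -mulrA mulrDl mulVf ?gt_eqF// divfK ?gt_eqF//.
  by rewrite ler_wpM2r ?ler_norm// addr_ge0.
rewrite [X in _ --> X](_ : 0 = `|0 : R| * (0 + `|a|)); last by rewrite normr0 mul0r.
apply: cvgM; first exact: cvg_norm.
by apply: cvgD; [exact: cvg_invsqrtlam | exact: cvg_norm].
Qed.

Lemma Y_bounded M : (\forall n \near \oo, `|c n| <= M) -> Y n - m0 * (al * c n - eta) @[n --> \oo] --> 0.
Proof.
move=> cM; have [e e0 he] := est.
apply: (cvg0_le (v := fun n => `|e n| * (1 + M))).
  apply: filterS2 he cM => n h hc; apply: (le_trans h).
  have := ler_norm (e n); have := normr_ge0 (e n); have := normr_ge0 (c n).
  move: (e n) (`|e n|) (`|c n|) hc => x y z; nra.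
rewrite [X in _ --> X](_ : 0 = `|0 : R| * (1 + M)); last by rewrite normr0 mul0r.
by apply: cvgMl; exact: cvg_norm.
Qed.
End Regimes.

Section Assembly.
Context {d : measure_display} {Omega : measurableType d} {R : realType}.
Local Notation C := (Cplx R).

(** The function e^b (1 - b) increases for b < 0 and decreases for b > 0, so it takes no value twice on either side of 0.  Both cases come from e^s > 1 + s at s = b - a and s = a - b. *)
Lemma critical_signs (a b : R) : a < b ->
  2 * expR a * (1 - a) = 1 -> 2 * expR b * (1 - b) = 1 -> a < 0 /\ 0 < b.
Proof.
move=> ab ha hb.
have e : expR b = expR a * expR (b - a) by rewrite -expRD addrC subrK.
have a0 := expR_gt0 a; have b0 := expR_gt0 b.
have s0 : b - a != 0 by rewrite subr_eq0 gt_eqF.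
have g1 := expR_gt1Dx s0.
have s0' : - (b - a) != 0 by rewrite oppr_eq0.
have g2 := expR_gt1Dx s0'.
have i : expR (b - a) * expR (- (b - a)) = 1 by rewrite -expRD subrr expR0.
have E1 : 1 - a = expR (b - a) * (1 - b).
  have : 2 * expR a * (1 - a) = 2 * expR a * (expR (b - a) * (1 - b)).
    by rewrite ha; transitivity (2 * expR b * (1 - b)); [rewrite hb | rewrite e; ring].
  by apply: mulfI; rewrite gt_eqF// mulr_gt0.
have E2 : (1 - a) * expR (- (b - a)) = 1 - b by rewrite E1 mulrAC i mul1r.
have a1 : 0 < 1 - a by rewrite -(pmulr_rgt0 _ (_ : 0 < 2 * expR a)) ?ha// mulr_gt0.
have b1 : 0 < 1 - b by rewrite -(pmulr_rgt0 _ (_ : 0 < 2 * expR b)) ?hb// mulr_gt0.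
split; rewrite ltNge; apply/negP => h.
  have : (1 - a) * (1 - (b - a)) < 1 - b by rewrite -E2 ltr_pM2l.
  have : 0 <= a * (b - a) by rewrite mulr_ge0// subr_ge0 ltW.
  lra.
have : (1 + (b - a)) * (1 - b) < 1 - a by rewrite E1 ltr_pM2r.
have : 0 <= - b * (b - a) by rewrite mulr_ge0 ?oppr_ge0// subr_ge0 ltW.
lra.
Qed.

Variable P : probability Omega R.
Variable Tr : nat -> Omega -> tree.
Hypothesis hTr : is_BST_process P Tr.
Variables (D : set C) (W : Omega -> C -> C).
Hypothesis hD : open D.
Hypothesis hD0 : D 0.
Hypothesis hW : random_analytic D W.
Hypothesis hWlim : {ae P, forall w, forall K : set (Cplx R), compact K -> K `<=` D ->
     {uniform K, (fun n => bigginsW n (Tr n w)) @ \oo --> W w}}.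

Lemma centred_profile n (m : nat) w :
  centred P (fun w => (profile (Tr n w) m)%:R) w = centredL R n m (Tr n w).
Proof.
rewrite /centred /centredL unlock (expectation_tree hTr n (fun t => (profile t m)%:R)).
have pE t : profile t m = count (fun v => size v == m) (external t) by [].
by rewrite pE; congr (_ - _); apply: eq_EE => t _; rewrite pE.
Qed.

(** The level is an integer that may be negative at first; eventually it is a natural number and [master] applies. *)
Lemma profile_estimate : {ae P, forall w, forall k : nat -> int,
  (k n)%:~R / (2 * ln n%:R) @[n --> \oo] --> (1 : R) ->
  let al := centred P (chi1_0 W) w in let lam n : R := 2 * ln n%:R in
  let c n := (k n)%:~R - lam n in
  exists2 e : nat -> R, e n @[n --> \oo] --> 0 &
  \forall n \near \oo, `|Num.sqrt (lam n) * lam n / n%:R * saddle_factor R k n *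
      centred P (fun w => (profile (Tr n w) (k n))%:R) w -
      (Num.sqrt (2 * pi))^-1 * (al * c n - (centred P (W2_0 W) w / 2 - al / 2))| <= e n * (1 + `|c n|)}.
Proof.
have [rho [rho0 rho1 hlim]] := centredW_limits hTr hD hD0 hW hWlim.
have u0 : 0 < rho / 8 by rewrite divr_gt0.
have upi : rho / 8 <= pi by have := pi_ge2 R; lra.
have [delta [rho' [delta0 rho'0 haw]]] := away_ae hTr u0 upi.
have hs := ae_splits hTr.
apply: filterS3 hlim haw hs => w [[B [N hB]] ha hb] [K K0 hA] hsp k hk al lam c.
have kpos : \forall n \near \oo, (0 <= k n).
  have h1 : \forall n \near \oo, 1 / 2 <= (k n)%:~R / lam n by apply: (cvgr_ge (1 : R)) => //; lra.
  have l1 : \forall n \near \oo, 1 <= lam n by apply: (cvgryPge _).1; exact: cvg_lam.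
  apply: filterS2 h1 l1 => n h1 l1; rewrite -(ler0z R).
  by move: h1; rewrite ler_pdivlMr; lra.
have kE : \forall n \near \oo, k n = `|k n|%N.
  by apply: filterS kpos => n h; rewrite gez0_abs.
have hk' : (`|k n|%N)%:R / (2 * ln n%:R) @[n --> \oo] --> (1 : R).
  apply: cvg_trans hk; apply: near_eq_cvg; apply: filterS kE => n {1}->.
  by rewrite pmulrn.
have [e e0 he] := master (splits_reach hsp) rho0 rho1 K0 delta0 rho'0 hB hA ha hb hk'.
exists e => //; apply: filterS3 he kE (nbhs_infty_gt 0) => n h kn n0.
have n0R : 0 < n%:R :> R by rewrite ltr0n.
move: h; rewrite /c /saddle_factor kn absz_nat; move: (`|k n|%N) => m.
rewrite -pmulrn centred_profile -exprnP /scaledL -/(lam n) => h.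
apply: le_trans h; rewrite le_eqVlt; apply/orP; left; apply/eqP; congr `|_ - _|.
have nE : n%:R = expR (lam n / 2) :> R by rewrite /lam mulrC mulKf// lnK// posrE.
have -> : expR (- (m%:R - lam n)) = n%:R * n%:R * expR (- m%:R) :> R.
  by rewrite nE -!expRD; congr expR; field.
move: (Num.sqrt (lam n)) (expR (- m%:R)) ((m%:R / lam n) ^+ m) (centredL _ _ _ _) (lam n) => s x y z l.
by field; rewrite gt_eqF.
Qed.

End Assembly.

Lemma sqrt_lam_pow (R : realType) (y : R) : 0 < y ->
  Num.sqrt (2 * y) * (2 * y) = 2 * Num.sqrt 2 * y `^ (3 / 2).
Proof.
move=> y0; have -> : 3 / 2 = 1 + 2^-1 :> R by field.
rewrite powRD ?gt_eqF ?implybT// powRr1 ?(ltW y0)// powR12_sqrt ?(ltW y0)//.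
by rewrite sqrtrM//; ring.
Qed.

Lemma stirling_constant (R : realType) : (Num.sqrt (2 * pi))^-1 / (2 * Num.sqrt 2) = (4 * Num.sqrt pi)^-1 :> R.
Proof.
rewrite sqrtrM// -invfM; congr (_^-1).
have : Num.sqrt 2 * Num.sqrt 2 = 2 :> R by rewrite -expr2 sqr_sqrtr.
move: (Num.sqrt 2) (Num.sqrt pi) => s p h.
by transitivity (2 * (s * s) * p); [ring | rewrite h; ring].
Qed.

Section FourRegimes.
Variable R : realType.

Lemma cvg_eventually (u v : nat -> R) (l : R) : (\forall n \near \oo, u n = v n) ->
  u n @[n --> \oo] --> l -> v n @[n --> \oo] --> l.
Proof. by move=> uv; apply: cvg_trans; apply: near_eq_cvg. Qed.

Variables (k : nat -> int) (L : nat -> R) (al eta : R).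
Let lam n : R := 2 * ln n%:R.
Let kr n : R := (k n)%:~R.
Let c n := kr n - lam n.
Let m0 : R := (Num.sqrt (2 * pi))^-1.
Let Y n := Num.sqrt (lam n) * lam n / n%:R * saddle_factor R k n * L n.
Hypothesis est : exists2 e : nat -> R, e n @[n --> \oo] --> 0 &
  \forall n \near \oo, `|Y n - m0 * (al * c n - eta)|
    <= e n * (1 + `|c n|).

Let lam_gt0 : \forall n \near \oo, 0 < lam n.
Proof. by apply: cvgry_gt; exact: cvg_lam. Qed.

Lemma eventually_nondeg (a : R) : c n / Num.sqrt (lam n) @[n --> \oo] --> a ->
  \forall n \near \oo, 0 < lam n /\ 0 < saddle_factor R k n.
Proof.
move=> ca; have l0 := lam_gt0.
have e0 : \forall n \near \oo, 0 < saddle_factor R k n.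
  by apply: (cvgr_gt (expR (a ^+ 2 / 2))); [exact: saddle_factor_limit | exact: expR_gt0].
by apply: filterS2 l0 e0.
Qed.

Lemma cvg_inv_saddle_factor (a : R) : c n / Num.sqrt (lam n) @[n --> \oo] --> a ->
  (saddle_factor R k n)^-1 @[n --> \oo] --> expR (- (a ^+ 2 / 2)).
Proof.
move=> ca; rewrite expRN; apply: cvgV; first by rewrite gt_eqF// expR_gt0.
exact: saddle_factor_limit.
Qed.

Lemma central_regime (a : R) : c n / Num.sqrt (lam n) @[n --> \oo] --> a ->
  ln n%:R / n%:R * L n @[n --> \oo] --> al / (2 * Num.sqrt (2 * pi)) * (a * expR (- (1 / 2) * a ^+ 2)).
Proof.
move=> ca.
have h : Y n / Num.sqrt (lam n) * (saddle_factor R k n)^-1 / 2 @[n --> \oo] --> m0 * (al * a) * expR (- (a ^+ 2 / 2)) / 2.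
  by apply: cvgMl; apply: cvgM (Y_sqrt est ca) (cvg_inv_saddle_factor ca).
have -> : al / (2 * Num.sqrt (2 * pi)) * (a * expR (- (1 / 2) * a ^+ 2)) = m0 * (al * a) * expR (- (a ^+ 2 / 2)) * 2^-1.
  rewrite /m0 (_ : - (1 / 2) * a ^+ 2 = - (a ^+ 2 / 2)); last by field.
  by rewrite invfM; ring.
apply: cvg_eventually h; apply: filterS (eventually_nondeg ca) => n [l0 e0] /=.
have s0 : 0 < Num.sqrt (lam n) by rewrite sqrtr_gt0.
have e : Num.sqrt (lam n) * lam n / n%:R * saddle_factor R k n * L n / Num.sqrt (lam n) / saddle_factor R k n / 2 =
  lam n / 2 / n%:R * L n.
  move: (Num.sqrt (lam n)) (saddle_factor R k n) s0 e0 (n%:R^-1) => s E s0 e0 m.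
  by field; rewrite !gt_eqF.
by rewrite /Y e [lam n / 2](_ : _ = ln n%:R)// /lam mulrC mulKf.
Qed.

(** Dividing by c, the term proportional to c remains. *)
Lemma wide_regime : `|c n| @[n --> \oo] --> +oo ->
  ln n%:R `^ (3 / 2) / (n%:R * c n * expR (c n)) * (kr n / lam n) ^ (k n) * L n @[n --> \oo] -->
  al / (4 * Num.sqrt pi).
Proof.
move=> coo.
have h : Y n / c n / (2 * Num.sqrt 2) @[n --> \oo] --> m0 * al / (2 * Num.sqrt 2).
  by apply: cvgMl; exact: (Y_unbounded est coo).
have -> : al / (4 * Num.sqrt pi) = m0 * al * (2 * Num.sqrt 2)^-1 by rewrite -stirling_constant /m0; ring.
apply: cvg_eventually h; apply: filterS lam_gt0 => n l0 /=.
have y0 : 0 < ln n%:R :> R by move: l0; rewrite /lam pmulr_rgt0.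
rewrite /Y [X in X / n%:R](sqrt_lam_pow y0) /saddle_factor expRN -/(kr n) -/(lam n) -/(c n) !invfM.
have s2 : Num.sqrt 2 != 0 :> R by rewrite gt_eqF// sqrtr_gt0.
move: (Num.sqrt 2) s2 (_ `^ _) ((expR _)^-1) ((c n)^-1) (n%:R^-1) (_ ^ _) => s s0 p E ci ni q.
by field.
Qed.

(** When c = o(sqrt(lam)) the saddle factor tends to 1. *)
Lemma narrow_regime : `|c n| @[n --> \oo] --> +oo -> c n / Num.sqrt (lam n) @[n --> \oo] --> 0 ->
  ln n%:R `^ (3 / 2) / (n%:R * c n) * L n @[n --> \oo] --> al / (4 * Num.sqrt pi).
Proof.
move=> coo c0.
have h : Y n / c n / (2 * Num.sqrt 2) * (saddle_factor R k n)^-1 @[n --> \oo] --> m0 * al / (2 * Num.sqrt 2) * expR (- (0 ^+ 2 / 2)).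
  by apply: cvgM (cvg_inv_saddle_factor c0); apply: cvgMl; exact: (Y_unbounded est coo).
have -> : al / (4 * Num.sqrt pi) = m0 * al * (2 * Num.sqrt 2)^-1 * expR (- (0 ^+ 2 / 2)).
  by rewrite expr0n mul0r oppr0 expR0 mulr1 -stirling_constant /m0; ring.
apply: cvg_eventually h; apply: filterS (eventually_nondeg c0) => n [l0 e0] /=.
have y0 : 0 < ln n%:R :> R by move: l0; rewrite /lam pmulr_rgt0.
rewrite /Y; move: (saddle_factor R k n) e0 => E e0; rewrite [X in X / n%:R](sqrt_lam_pow y0) -/(kr n) -/(lam n) -/(c n) !invfM.
have s2 : Num.sqrt 2 != 0 :> R by rewrite gt_eqF// sqrtr_gt0.
move: (Num.sqrt 2) s2 (_ `^ _) ((c n)^-1) (n%:R^-1) => s s0 p ci ni.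
by field; rewrite gt_eqF.
Qed.

(** The saddle factor tends to 1 and multiplies a bounded quantity; the constant eta contributes the shift of c by 1/2 and the second derivative. *)
Lemma bounded_regime (M : R) : (\forall n \near \oo, `|c n| <= M) ->
  ln n%:R `^ (3 / 2) / n%:R * L n - al / (4 * Num.sqrt pi) * (c n + 1 / 2) @[n --> \oo] -->
  - ((2 * eta + al) / (8 * Num.sqrt pi)).
Proof.
move=> cM.
have c0 : c n / Num.sqrt (lam n) @[n --> \oo] --> (0 : R).
  apply: (cvg0_le (v := fun n => M * (Num.sqrt (lam n))^-1)); last first.
    rewrite [X in _ --> X](_ : 0 = M * 0); last by rewrite mulr0.
    by apply: cvgMr; exact: cvg_invsqrtlam.
  apply: filterS cM => n h; rewrite normrM [X in _ * X]ger0_norm ?invr_ge0 ?sqrtr_ge0//.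
  by rewrite ler_wpM2r// invr_ge0 sqrtr_ge0.
have g1 : (saddle_factor R k n)^-1 @[n --> \oo] --> (1 : R).
  by have := cvg_inv_saddle_factor c0; rewrite expr0n mul0r oppr0 expR0.
have t1 : (Y n - m0 * (al * c n - eta)) * (saddle_factor R k n)^-1 / (2 * Num.sqrt 2) @[n --> \oo] --> 0 * 1 / (2 * Num.sqrt 2).
  by apply: cvgMl; apply: cvgM g1; exact: (Y_bounded est cM).
have t2 : m0 * (al * c n - eta) * ((saddle_factor R k n)^-1 - 1) / (2 * Num.sqrt 2) @[n --> \oo] --> (0 : R).
  rewrite [X in _ --> X](_ : 0 = 0 / (2 * Num.sqrt 2)); last by rewrite mul0r.
  apply: cvgMl.
  apply: (cvg0_le (v := fun n => `|m0| * (`|al| * M + `|eta|) * `|(saddle_factor R k n)^-1 - 1|)).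
    apply: filterS cM => n h; rewrite 2!normrM ler_wpM2r// ler_wpM2l//.
    apply: (le_trans (ler_normB _ _)); rewrite lerD2r normrM ler_wpM2l//.
  rewrite [X in _ --> X](_ : 0 = `|m0| * (`|al| * M + `|eta|) * `|1 - 1 : R|); last by rewrite subrr normr0 mulr0.
  by apply: cvgMr; apply: cvg_norm; apply: cvgB => //; exact: cvg_cst.
have h : (Y n - m0 * (al * c n - eta)) * (saddle_factor R k n)^-1 / (2 * Num.sqrt 2) +
    m0 * (al * c n - eta) * ((saddle_factor R k n)^-1 - 1) / (2 * Num.sqrt 2) - (2 * eta + al) / (8 * Num.sqrt pi) @[n --> \oo] -->
    0 * 1 / (2 * Num.sqrt 2) + 0 - (2 * eta + al) / (8 * Num.sqrt pi).
  by apply: cvgB; [exact: cvgD | exact: cvg_cst].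
have p0 : Num.sqrt pi != 0 :> R by rewrite gt_eqF// sqrtr_gt0 pi_gt0.
rewrite [X in _ --> X](_ : _ = 0 * 1 / (2 * Num.sqrt 2) + 0 - (2 * eta + al) / (8 * Num.sqrt pi)); last first.
  by rewrite !mul0r !add0r.
apply: cvg_eventually h; apply: filterS (eventually_nondeg c0) => n [l0 e0] /=.
have y0 : 0 < ln n%:R :> R by move: l0; rewrite /lam pmulr_rgt0.
have e1 : Y n * (saddle_factor R k n)^-1 / (2 * Num.sqrt 2) = ln n%:R `^ (3 / 2) / n%:R * L n.
  rewrite /Y [X in X / n%:R](sqrt_lam_pow y0).
  have s2 : Num.sqrt 2 != 0 :> R by rewrite gt_eqF// sqrtr_gt0.
  move: (Num.sqrt 2) s2 (_ `^ _) (saddle_factor R k n) e0 (n%:R^-1) => s s0 p E e0 ni.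
  by field; rewrite s0 gt_eqF.
have e2 : m0 * (al * c n - eta) / (2 * Num.sqrt 2) = (al * c n - eta) / (4 * Num.sqrt pi).
  by rewrite mulrAC stirling_constant mulrC.
rewrite -e1.
transitivity (Y n * (saddle_factor R k n)^-1 / (2 * Num.sqrt 2)
   - m0 * (al * c n - eta) / (2 * Num.sqrt 2) - (2 * eta + al) / (8 * Num.sqrt pi)).
  move: (Y n) (saddle_factor R k n) ((2 * Num.sqrt 2)^-1) (c n) (Num.sqrt pi) m0 => y E q cn sp m.
  by ring.
rewrite e2.
move: (_ * _ / (2 * _)) (Num.sqrt pi) p0 (c n) => u v v0 w.
by field.
Qed.
End FourRegimes.

(** * The theorem *)

Theorem theorem1p9 (R : realType) (d : measure_display) (Omega : measurableType d)
  (P : probability Omega R)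
  (Tr : nat -> Omega -> tree) (hTr : is_BST_process P Tr)
  (beta_m beta_p : R) (hbeta : beta_m < beta_p)
  (hbeta_m : 2 * expR beta_m * (1 - beta_m) = 1)
  (hbeta_p : 2 * expR beta_p * (1 - beta_p) = 1)
  (D : set (Cplx R)) (hD : open D)
  (hDbeta : forall x : R, beta_m < x -> x < beta_p -> D x%:C)
  (W : Omega -> Cplx R -> Cplx R) (hW : random_analytic D W)
  (hWlim : {ae P, forall w, forall K : set (Cplx R), compact K -> K `<=` D ->
     {uniform K, (fun n => bigginsW n (Tr n w)) @ \oo --> W w}})
  (k : nat -> int) :
  let L0 (n : nat) : Omega -> R :=
    centred P (fun w => (profile (Tr n w) (k n))%:R) in
  let logn (n : nat) : R := ln n%:R in
  (* (a) *)
  (forall alpha : R,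
     (fun n => (k n)%:~R - (2 * logn n + alpha * Num.sqrt (2 * logn n)))
       =o_\oo (fun n => Num.sqrt (logn n)) ->
     {ae P, forall w,
       (fun n => logn n / n%:R * L0 n w) @ \oo -->
         centred P (chi1_0 W) w / (2 * Num.sqrt (2 * pi))
           * (alpha * expR (- (1 / 2) * alpha ^+ 2))})
  /\
  (* (b) *)
  (forall c : nat -> R,
     (forall n, (0 < n)%N -> (k n)%:~R = 2 * logn n + c n) ->
     (fun n => `|c n|) @ \oo --> +oo ->
     (c =o_\oo logn ->
      {ae P, forall w,
        (fun n => logn n `^ (3 / 2) / (n%:R * c n * expR (c n))
                  * ((k n)%:~R / (2 * logn n)) ^ (k n) * L0 n w) @ \oo -->
          centred P (chi1_0 W) w / (4 * Num.sqrt pi)})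
     /\
     (c =o_\oo (fun n => Num.sqrt (logn n)) ->
      {ae P, forall w,
        (fun n => logn n `^ (3 / 2) / (n%:R * c n) * L0 n w) @ \oo -->
          centred P (chi1_0 W) w / (4 * Num.sqrt pi)}))
  /\
  (* (c) *)
  (forall c : nat -> R,
     (forall n, (0 < n)%N -> (k n)%:~R = 2 * logn n + c n) ->
     bounded_fun c ->
     {ae P, forall w,
       (fun n => logn n `^ (3 / 2) / n%:R * L0 n w
                 - centred P (chi1_0 W) w / (4 * Num.sqrt pi) * (c n + 1 / 2))
         @ \oo --> - (centred P (W2_0 W) w / (8 * Num.sqrt pi))}).
Proof.
move=> L0 logn.
have [bm bp] := critical_signs hbeta hbeta_m hbeta_p.
have D0 : D 0 by exact: (hDbeta 0 bm bp).
have main := profile_estimate hTr hD D0 hW hWlim.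
pose lam n : R := 2 * ln n%:R.
have l0 : \forall n \near \oo, 0 < lam n by apply: cvgry_gt; exact: cvg_lam.
have is0 : (Num.sqrt (lam n))^-1 @[n --> \oo] --> (0 : R) by exact: cvg_invsqrtlam.
have lnle n : Num.sqrt (logn n) <= Num.sqrt (lam n).
  by apply: ler_wsqrtr; rewrite /lam /logn; have := ln_nat_ge0 R n; lra.
have ratio : ((k n)%:~R - lam n) / lam n @[n --> \oo] --> (0 : R) -> (k n)%:~R / lam n @[n --> \oo] --> (1 : R).
  move=> h; have h1 : ((k n)%:~R - lam n) / lam n + 1 @[n --> \oo] --> (0 + 1 : R).
    by apply: cvgD => //; exact: cvg_cst.
  rewrite add0r in h1; apply: cvg_eventually h1; apply: filterS l0 => n hl.
  by rewrite mulrBl divff ?gt_eqF// subrK.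
have ratio_sqrt (a : R) : ((k n)%:~R - lam n) / Num.sqrt (lam n) @[n --> \oo] --> a ->
    (k n)%:~R / lam n @[n --> \oo] --> (1 : R).
  move=> h; apply: ratio.
  have h1 : ((k n)%:~R - lam n) / Num.sqrt (lam n) * (Num.sqrt (lam n))^-1 @[n --> \oo] --> a * 0 by exact: cvgM.
  rewrite mulr0 in h1; apply: cvg_eventually h1; apply: filterS l0 => n hl.
  by rewrite -mulrA -invfM -expr2 sqr_sqrtr// ltW.
have cE (c : nat -> R) : (forall n, (0 < n)%N -> (k n)%:~R = 2 * logn n + c n) ->
    \forall n \near \oo, (k n)%:~R - lam n = c n.
  move=> h; apply: filterS (nbhs_infty_gt 0) => n n0.
  by rewrite h// /lam /logn addrC addKr.
split; last split.
- move=> alpha ho.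
  have cs : ((k n)%:~R - lam n) / Num.sqrt (lam n) @[n --> \oo] --> alpha.
    apply/cvgrPdist_le => e e0.
    move/eqoP : ho => /(_ e e0) ho.
    apply: filterS2 l0 ho => n hl h.
    have s0 : 0 < Num.sqrt (lam n) by rewrite sqrtr_gt0.
    have -> : alpha - ((k n)%:~R - lam n) / Num.sqrt (lam n) =
      - (((k n)%:~R - (lam n + alpha * Num.sqrt (lam n))) / Num.sqrt (lam n)).
      by field; rewrite gt_eqF.
    rewrite normrN normrM [X in _ * X]ger0_norm ?invr_ge0 ?(ltW s0)// ler_pdivrMr//.
    apply: (le_trans h); rewrite ler_wpM2l ?(ltW e0)// ger0_norm ?sqrtr_ge0//.
  apply: filterS main => w /(_ k (ratio_sqrt _ cs)) est.
  exact: (central_regime est cs).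
- move=> c hc coo; split.
  + move=> ho.
    have cl : ((k n)%:~R - lam n) / lam n @[n --> \oo] --> (0 : R).
      apply/cvgrPdist_le => e e0.
      move/eqoP : ho => /(_ e e0) ho.
      apply: filterS3 (cE c hc) l0 ho => n -> hl h.
      rewrite sub0r normrN normrM normfV ler_pdivrMr ?normr_gt0 ?gt_eqF//.
      apply: (le_trans h); rewrite ler_wpM2l ?(ltW e0)// [`|lam n|]ger0_norm ?(ltW hl)//.
      by rewrite ger0_norm ?ln_nat_ge0//; have := ln_nat_ge0 R n; rewrite /lam /logn; lra.
    have coo' : `|(k n)%:~R - lam n| @[n --> \oo] --> +oo.
      by apply: cvg_trans coo; apply: near_eq_cvg; apply: filterS (cE c hc) => n ->.
    apply: filterS main => w /(_ k (ratio cl)) est.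
    have := wide_regime est coo'; apply: cvg_eventually.
    by apply: filterS (cE c hc) => n /= ->.
  + move=> ho.
    have cs : ((k n)%:~R - lam n) / Num.sqrt (lam n) @[n --> \oo] --> (0 : R).
      apply/cvgrPdist_le => e e0.
      move/eqoP : ho => /(_ e e0) ho.
      apply: filterS3 (cE c hc) l0 ho => n -> hl h.
      have s0 : 0 < Num.sqrt (lam n) by rewrite sqrtr_gt0.
      rewrite sub0r normrN normrM normfV ler_pdivrMr ?normr_gt0 ?gt_eqF//.
      apply: (le_trans h); rewrite ler_wpM2l ?(ltW e0)// !ger0_norm ?sqrtr_ge0//.
    have coo' : `|(k n)%:~R - lam n| @[n --> \oo] --> +oo.
      by apply: cvg_trans coo; apply: near_eq_cvg; apply: filterS (cE c hc) => n ->.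
    apply: filterS main => w /(_ k (ratio_sqrt _ cs)) est.
    have := narrow_regime est coo' cs; apply: cvg_eventually.
    by apply: filterS (cE c hc) => n /= ->.
- move=> c hc [M0 [_ hM0]].
  pose M := M0 + 1.
  have hM n : `|c n| <= M by apply: hM0 => //; rewrite /M ltrDl.
  have cM : \forall n \near \oo, `|(k n)%:~R - lam n| <= M.
    by apply: filterS (cE c hc) => n ->; exact: hM.
  have cs : ((k n)%:~R - lam n) / Num.sqrt (lam n) @[n --> \oo] --> (0 : R).
    apply: (cvg0_le (v := fun n => M * (Num.sqrt (lam n))^-1)); last first.
      rewrite [X in _ --> X](_ : 0 = M * 0); last by rewrite mulr0.
      exact: cvgMr.
    apply: filterS cM => n h; rewrite normrM [X in _ * X]ger0_norm ?invr_ge0 ?sqrtr_ge0//.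
    by rewrite ler_wpM2r// invr_ge0 sqrtr_ge0.
  apply: filterS main => w /(_ k (ratio_sqrt _ cs)) est.
  have := bounded_regime est cM.
  have halves (x y : R) : 2 * (y / 2 - x / 2) + x = y by field.
  rewrite halves.
  apply: cvg_eventually.
  by apply: filterS (cE c hc) => n /= ->.
Qed.
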